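(* Let $E$ be a unimodular locally compact group with countable base and let $\pi$ be a right Haar measure on $E$. Let $X$ be a random walk on $E$ with law $v$ and transition operator $P$, where $v$ is compactly supported, and let $R$ be the convergence parameter of $X$. Assume: (A) for every nonnegative $f\in C_0(E)$ there exist $\gamma>0$ and an integer $j\ge 1$ such that $v^j\ge \gamma\,(f\pi)$; (B) there exists a unique (up to a positive factor) $R$-invariant measure $\nu$ for $X$ taking finite values on compact sets. Let $\varphi$ be the unique continuous exponential on $E$ with $\int\varphi\,dv=1/R$. Then there exists a set $\mathcal N$ of positive integers of density $0$ such that for all $x,y\in E$ and all $f,g\in C_0(E)$ with $\nu(g)\neq 0$, $$\lim_{\substack{n\to\infty\\ n\notin\mathcal N}}\frac{P^nf(x)}{P^ng(y)}=\frac{\pi(\varphi^{-1}f)\,\varphi(x)}{\pi(\varphi^{-1}g)\,\varphi(y)}=\frac{\nu(f)\,\varphi(x)}{\nu(g)\,\varphi(y)},$$ and moreover, for every positive integer $m$, $$\lim_{\substack{n\to\infty\\ n\notin\mathcal N}}\frac{P^{n+m}g(y)}{P^ng(y)}=\frac1{R^m},\qquad y\in E.$$ The convergence in both limits is uniform with respect to $x$ and $y$ ranging over an arbitrary compact set in $E$.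
   Context: Setting: $\mathcal E$ is the Borel $\sigma$-algebra of $E$ and $\mathcal E_+=\{A\in\mathcal E:\pi(A)>0\}$. A random walk $X=(X_n)_{n\ge0}$ on $E$ with law $v$ (a probability measure on $\mathcal E$) is the homogeneous Markov chain on $(E,\mathcal E)$ with transition probabilities $p(x,A)=v(x^{-1}A)$; its transition operator is $Pf(x)=\int f(xy)\,v(dy)$. $v^j$ is the $j$-th convolution power of $v$. $C_0(E)$ is the set of continuous compactly supported functions on $E$. For a measure $\mu$ and function $f$, $\mu(f)=\int f\,d\mu$, and $f\pi$ denotes the measure $A\mapsto\int_A f\,d\pi$. $X$ is spread out if for some $n\ge1$ the measure $v^n$ is nonsingular with respect to $\pi$. A spread out random walk is irreducible if for every $x\in E$ and $A\in\mathcal E_+$ there is $n\ge1$ with $P^n1_A(x)>0$ (for spread out walks this is equivalent to irreducibility in the traditional sense of random walks on groups). It is aperiodic if there are no $d\ge2$ and disjoint nonempty sets $E_0,\dots,E_{d-1}\in\mathcal E$ with $\pi(E\setminus\bigcup_iE_i)=0$ and $p(x,E_{i+1 \bmod d})=1$ for all $x\in E_i$. Assumption (A) is known to imply that $X$ is spread out, irreducible and aperiodic. Small functions and measures (in the sense of Nummelin): a measurable $s:E\to[0,\infty)$ with $\pi(s)>0$ and a nonzero measure $\mu$ on $\mathcal E$ are called a small function and a small measure, respectively, if they occur in an inequality $P^m1_A(x)\ge\beta\,s(x)\mu(A)$ for all $x\in E$, $A\in\mathcal E$, with some integer $m\ge1$ and $\beta>0$. The convergence parameter $R\ge1$ of an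 irreducible $X$ is the radius of convergence of the power series $\sum_n r^n\mu(P^ns)$, where $s$ is a small function and $\mu$ a small measure; it does not depend on the choice of $s$ and $\mu$. A measure $\mu$ on $\mathcal E$ is $r$-invariant for $X$ ($0<r<\infty$) if $\mu(E)>0$ and $\mu=r\,\mu P$, where $\mu P(A)=\int p(x,A)\,\mu(dx)$. An exponential on $E$ is a Borel function $\varphi:E\to(0,\infty)$ with $\varphi(xy)=\varphi(x)\varphi(y)$ for all $x,y\in E$. It is known that under (B) there exists a unique continuous exponential $\varphi$ with $\int\varphi\,dv=1/R$. A set $\mathcal N$ of positive integers has density $0$ if $\lim_{n\to\infty}\frac1n\,\#\{m\in\mathcal N: m\le n\}=0$. *)

(* Defs.v *)
From HB Require Import structures.
From mathcomp Require Import all_boot all_order all_algebra.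
From mathcomp Require Import all_classical all_reals all_analysis.

Set Implicit Arguments.
Unset Strict Implicit.
Unset Printing Implicit Defensive.

Import Order.TTheory GRing.Theory Num.Theory.
Import numFieldNormedType.Exports.

Local Open Scope classical_set_scope.
Local Open Scope ring_scope.

HB.mixin Record isTopologicalGroup G & Group G & Topological G := {
  mulg_continuous : continuous (fun x : G * G => (x.1 * x.2)%g) ;
  invg_continuous : continuous (fun x : G => (x^-1)%g)
}.

HB.structure Definition TopologicalGroup :=
  {G of Group G & Topological G & isTopologicalGroup G}.

HB.mixin Record isBorel d T & Measurable d T & Topological T := {
  measurable_borel : @measurable d T = <<s @open T >>
}.

(* The library requires measurable types to be pointed; the distinguished point
   plays no role here. *)
#[short(type="borelGroupType")]
HB.structure Definition BorelGroup d :=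
  {G of TopologicalGroup G & Measurable d G & isBorel d G}.

Section haar.
Context d (E : borelGroupType d) (R : realType).
Implicit Types mu : {measure set E -> \bar R}.

Definition finite_on_compacts mu :=
  forall K : set E, compact K -> (mu K < +oo)%E.

(* On a locally compact Hausdorff group with a countable base, a Borel measure
   that is finite on compact sets is automatically regular. *)
Definition right_haar_measure mu :=
  [/\ (0 < mu setT)%E, finite_on_compacts mu &
    forall (x : E) A, measurable A -> mu [set (a * x)%g | a in A] = mu A].

Definition left_haar_measure mu :=
  [/\ (0 < mu setT)%E, finite_on_compacts mu &
    forall (x : E) A, measurable A -> mu [set (x * a)%g | a in A] = mu A].

Definition unimodular :=
  forall mu, right_haar_measure mu <-> left_haar_measure mu.

Definition support_of mu : set E :=
  [set x | forall U, open U -> U x -> (0 < mu U)%E].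

Definition compactly_supported mu := compact (support_of mu).

(* C_0(E), here meaning compact support rather than vanishing at infinity *)
Definition continuous_compact_support (f : E -> R) :=
  continuous f /\ compact (closure [set x | f x != 0]).

Definition exponential (phi : E -> R) :=
  [/\ measurable_fun setT phi, forall x, 0 < phi x &
    forall x y, phi (x * y)%g = phi x * phi y].

End haar.
Arguments unimodular {d} E R.

Section random_walk.
Context d (E : borelGroupType d) (R : realType).
Variable v : probability E R.
Local Open Scope ereal_scope.

(* p(x, A) = v(x^-1 A) *)
Definition trans (x : E) (A : set E) : \bar R :=
  v ((fun y : E => (x * y)%g) @^-1` A).

(* Extended-real valued functions are allowed so that the operator also applies
   to unbounded nonnegative functions. *)
Definition walk_op (f : E -> \bar R) (x : E) : \bar R :=
  \int[v]_y f (x * y)%g.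

Definition walk_iter (n : nat) (f : E -> R) (x : E) : \bar R :=
  iter n walk_op (EFin \o f) x.

(* Convolution of two measures:
   (m1 * m2)(A) = \int m2(x^-1 A) m1(dx) = (m1 \x m2) {(x, y) | x y \in A} *)
Definition convolution (m1 m2 : set E -> \bar R) (A : set E) : \bar R :=
  \int[m1]_x m2 ((fun y : E => (x * y)%g) @^-1` A).

Definition conv_power (n : nat) : set E -> \bar R :=
  iter n (convolution v) (\d_(1%g : E) : set E -> \bar R).

Definition r_invariant (r : R) (mu : {measure set E -> \bar R}) :=
  [/\ (0 < r)%R, 0 < mu setT &
    forall A, measurable A -> mu A = r%:E * \int[mu]_x trans x A].

Variable pi : {measure set E -> \bar R}.

(* The inequality P^m 1_A(x) >= beta s(x) mu(A) of Nummelin, with its side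
   conditions on s and mu *)
Definition minorization (s : E -> R) (mu : {measure set E -> \bar R}) :=
  [/\ measurable_fun setT s, forall x, (0 <= s x)%R,
      0 < \int[pi]_x (s x)%:E, 0 < mu setT &
      exists m : nat, exists beta : R, [/\ (0 < m)%N, (0 < beta)%R &
        forall x A, measurable A ->
          beta%:E * (s x)%:E * mu A <= walk_iter m (\1_A) x]].

Definition small_function (s : E -> R) :=
  exists mu : {measure set E -> \bar R}, minorization s mu.

Definition small_measure (mu : {measure set E -> \bar R}) :=
  exists s : E -> R, minorization s mu.

(* Radius of convergence of the power series with nonnegative coefficients a *)
Definition convergence_radius (a : nat -> \bar R) : \bar R :=
  ereal_sup [set r%:E | r in
    [set r : R | (0 <= r)%R /\ \sum_(0 <= n <oo) (r ^+ n)%:E * a n < +oo]].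

(* The small function and the small measure need not occur in the same
   inequality; the radius depends on neither of them. *)
Definition convergence_parameter (r : R) :=
  exists s : E -> R, exists mu : {measure set E -> \bar R},
    [/\ small_function s, small_measure mu &
      convergence_radius (fun n => \int[mu]_x walk_iter n s x) = r%:E].

End random_walk.

Definition density_zero (R : realType) (N : set nat) :=
  (\sum_(1 <= m < n.+1) (\1_N m : R)) / n%:R @[n --> \oo] --> (0 : R).

(* Main.v *)
(* The exceptional set N is empty: the limits hold along all n.  With
   Q f (x) = \int f(xy) r phi(y) v(dy), the walk tilted by phi, one has Q 1 = 1 and
   P^n f = r^-n phi Q^n (phi^-1 f), so everything reduces to asymptotics of Q^n.
   - By (A), some A f (x) = c \int f(xy) f1(y) pi(dy), with A 1 = a > 0, satisfies
     A <= Q^j and A <= Q^(j+1) =: B.  The expansion of B^M = ((B - A) + A)^M counts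
     factors A with a binomial(M, a) law, so D = \sum_i B^i A B^(M-1-i) is a M B^M
     up to a relative error eps and an exponentially small term.  As A Q <= B too,
     D Q is likewise close to a M B^M, besides being close to a M B^M Q, whence Q^n g
     and Q^(n+1) g differ by a small relative error: r being the convergence parameter, Q^n g decays subexponentially and the
     exponentially small term is negligible.
   - So any ultrafilter limit l of the functionals f |-> Q^n f (1) / Q^n g0 (1) is
     Q-invariant, and H(w) = l(y |-> kappa(w y^-1)) satisfies
     H(w) = \int H(w z^-1) r phi(z) v(dz).  Then phi^-1 H pi is r-invariant, so H is
     constant by (B): l is invariant under right translations, hence a multiple of pi.
     All ultrafilter limits being equal, the functionals converge. *)

Require Import Defs.
From HB Require Import structures.
From mathcomp Require Import all_boot all_order all_algebra.
From mathcomp Require Import all_classical all_reals all_analysis.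
From mathcomp Require Import measurable_realfun.
From mathcomp Require Import ring lra.
Import Order.TTheory GRing.Theory Num.Theory.
Import numFieldNormedType.Exports.
Set Implicit Arguments.
Unset Strict Implicit.
Unset Printing Implicit Defensive.
Local Open Scope classical_set_scope.
Local Open Scope ring_scope.

(** The limits l are mere functionals on continuous functions of compact support, with no
    representing measure: one ultrafilter makes [normalized n f] converge for all f at once, and
    exchanging l with an integral rests on [plin_swap]. The inverse in H has a reason: (B) concerns
    measures with mu = r mu P, whose densities are averaged over x z^-1, while Q averages over x z;
    inverting the argument of kappa turns one equation into the other. One base point suffices
    because increments multiply on the right, so that Q commutes with left translations: a value at
    x is the value at 1 of a left translate, and unimodularity makes the Haar integral of that
    translate independent of x. A and B - A need not commute, so the binomial count is not made word
    by word; a tangent line of the exponential reduces it to an induction on M. That r is the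
    convergence parameter enters only through [tilted_divergence]. The solution H = 1 of the same
    equation shows that phi^-1 pi is a multiple of nu, which gives the second form of the limit. *)

Lemma countable_range (T : Type) (A : set T) : countable A -> A !=set0 ->
  exists2 F : nat -> T, A `<=` range F & range F `<=` A.
Proof.
move=> /pfcard_geP[-> [] //|[f] _]; exists f.
  by move=> b /(@surj _ _ _ _ f)[n _ <-]; exists n.
by move=> _ [n _ <-]; exact: funS.
Qed.

Lemma bigcup_countable_measurable d (T : measurableType d) (I : Type)
    (D : set I) (F : I -> set T) : countable D ->
  (forall i, D i -> measurable (F i)) -> measurable (\bigcup_(i in D) F i).
Proof.
move=> cD mF; have [->|/set0P D0] := eqVneq D set0; first by rewrite bigcup_set0.
have [e De eD] := countable_range cD D0.
have -> : \bigcup_(i in D) F i = \bigcup_n F (e n).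
  apply/seteqP; split => x [i Di Fx]; last by exists (e i) => //; apply: eD; exists i.
  by have [n _ en] := De _ Di; exists n => //; rewrite en.
by apply: bigcupT_measurable => n; apply/mF/eD; exists n.
Qed.

(** * Borel groups *)

Section borel_group.
Context d (E : borelGroupType d).

Lemma mulg_continuous2 (T : topologicalType) (f g : T -> E) :
  continuous f -> continuous g -> continuous (fun x => f x * g x)%g.
Proof.
move=> fc gc x.
exact: (@continuous2_cvg _ _ _ _ _ _ f g (fun a b => (a * b)%g) (f x) (g x)
  (@mulg_continuous E (f x, g x)) (fc x) (gc x)).
Qed.

Lemma invg_continuous1 (T : topologicalType) (f : T -> E) :
  continuous f -> continuous (fun x => (f x)^-1)%g.
Proof. by move=> fc x; apply: continuous_comp; [exact: fc|exact: invg_continuous]. Qed.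

Lemma lmulg_continuous (a : E) : continuous (fun x => a * x)%g.
Proof. by apply: mulg_continuous2 => x; [exact: cvg_cst|exact: cvg_id]. Qed.

Lemma rmulg_continuous (a : E) : continuous (fun x => x * a)%g.
Proof. by apply: mulg_continuous2 => x; [exact: cvg_id|exact: cvg_cst]. Qed.

Lemma borel_open (U : set E) : open U -> measurable U.
Proof. by move=> oU; rewrite measurable_borel; exact: sub_sigma_algebra. Qed.

Lemma borel_closed (U : set E) : closed U -> measurable U.
Proof. by move=> cU; rewrite -(setCK U); apply/measurableC/borel_open/closed_openC. Qed.

Lemma borel_compact (K : set E) : hausdorff_space E -> compact K -> measurable K.
Proof. by move=> hE cK; apply: borel_closed; exact: compact_closed. Qed.

Lemma measurable_continuous d' (T : measurableType d') (f : T -> E) :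
  (forall U, open U -> measurable (f @^-1` U)) -> measurable_fun setT f.
Proof.
move=> fo; apply: (@measurability _ _ _ _ setT f _ (@measurable_borel d E)).
by move=> _ [U oU <-]; rewrite setTI; exact: fo.
Qed.

Lemma measurable_continuousR (R : realType) (f : E -> R) :
  continuous f -> measurable_fun setT f.
Proof.
move=> fc; apply: (measurability _ (measurable_realfun.RGenOpens.measurableE R)).
move=> _ [_ [a [b ->]] <-]; rewrite setTI; apply: borel_open.
by apply: open_comp; [move=> x _; exact: fc|exact: interval_open].
Qed.

(** Measurability on E * E refers to the product sigma-algebra, which need not contain all open sets
    of the product; a countable base writes each open preimage as a countable union of open
    rectangles. *)
Lemma measurable_mulg : @second_countable E ->
  measurable_fun setT (fun p : E * E => (p.1 * p.2)%g).
Proof.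
move=> [B cB [Bo Bb]]; apply: measurable_continuous => U oU.
set W := _ @^-1` U.
pose I := [set b : set E * set E | B b.1 /\ B b.2 /\ (b.1 `*` b.2 `<=` W)].
have -> : W = \bigcup_(b in I) (b.1 `*` b.2).
  apply/seteqP; split => [[x y] Wxy|z [b [_ [_ bW]] /bW//]].
  have : nbhs (x, y) W.
    by apply: (@mulg_continuous E (x, y)); apply: open_nbhs_nbhs; split.
  move=> -[[P Q] /= [Px Qy] PQW].
  have [b1 [Bb1 b1x] b1P] := Bb x _ Px.
  have [b2 [Bb2 b2y] b2Q] := Bb y _ Qy.
  exists (b1, b2) => //; split => //; split => //= -[a c] /= [b1a b2c].
  by apply: PQW; split => /=; [exact: b1P|exact: b2Q].
apply: bigcup_countable_measurable.
  apply: (@sub_countable _ _ _ (B `*` B)); last exact: countableX.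
  by apply: subset_card_le => -[b1 b2] [? [? _]].
move=> -[b1 b2] [/= B1 [B2 _]].
by apply: measurableX; apply: borel_open; exact: Bo.
Qed.

Lemma sigma_compact : locally_compact [set: E] -> @second_countable E ->
  exists K : nat -> set E, (forall n, compact (K n)) /\ \bigcup_n K n = setT.
Proof.
move=> lE [B cB [Bo Bb]].
pose C := [set b | B b /\ compact (closure b)].
have cC : countable C by apply: sub_countable cB; apply: subset_card_le => ? [].
have covC (x : E) : exists2 b, C b & b x.
  have [U] := lE x I; rewrite withinET => nU [cU clU].
  have [b [Bb' bx] bU] := Bb x _ nU; exists b => //; split => //.
  apply: (@subclosed_compact _ _ U) => //; first exact: closed_closure.
  by move/closure_id: clU => ->; exact: closureS.
have C0 : C !=set0 by have [b Cb _] := covC point; exists b.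
have [F CF FC] := countable_range cC C0.
exists (fun n => closure (F n)); split => [n|].
  by have [] : C (F n) by apply: FC; exists n.
apply/seteqP; split => // x _; have [b Cb bx] := covC x.
by have [n _ Fn] := CF _ Cb; exists n => //; apply: subset_closure; rewrite Fn.
Qed.

End borel_group.

(** * Continuous functions with compact support *)

(** If P K fails, the sets S with [P (K \ S)] form a proper filter containing K, and a cluster point
    of it in K contradicts the local hypothesis. This induction takes the place of finite subcovers
    below. *)
Lemma compact_local_ind (T : topologicalType) (K : set T) (P : set T -> Prop) :
  compact K -> P set0 -> (forall A B, P A -> P B -> P (A `|` B)) ->
  (forall A B, A `<=` B -> P B -> P A) ->
  (forall x, K x -> exists2 U, nbhs x U & P U) -> P K.
Proof.
move=> cK P0 PU PS Ploc; apply: contrapT => PK.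
pose F := [set S | P (K `\` S)].
have FF : Filter F.
  split; first by rewrite /F /= setDT.
  - by move=> A B FA FB; rewrite /F /= setDIr; exact: PU.
  - by move=> A B AB; apply: PS; exact: setDS.
have PF : ProperFilter F by split => //; rewrite /F /= setD0.
have FK : F K by rewrite /F /= setDv.
have [x [Kx clx]] := cK F PF FK.
have [U nU PUx] := Ploc x Kx.
have FcU : F (~` U) by apply: PS PUx => y [_ /contrapT].
by have [y [nUy Uy]] := clx _ _ FcU nU.
Qed.

Section real_functions.
Context (T : topologicalType) (R : realType).
Implicit Types (f g : T -> R) (K : set T).

Lemma compact_upper_bound f K : continuous f -> compact K ->
  exists2 M, 0 < M & forall x, K x -> `|f x| <= M.
Proof.
move=> fc cK.
pose P A := exists2 M : R, 0 < M & forall x, A x -> `|f x| <= M.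
apply: (@compact_local_ind _ _ P) => //.
- by exists 1.
- move=> A B [M M0 MA] [N N0 NB]; exists (M + N); first exact: addr_gt0.
  by move=> x [/MA|/NB] h; apply: (le_trans h); rewrite ?lerDl ?lerDr ltW.
- by move=> A B AB [M M0 MB]; exists M => // x /AB/MB.
- move=> x Kx; exists [set y | `|f x - f y| <= 1].
    by have /cvgrPdist_le/(_ 1 ltr01) := fc x.
  exists (`|f x| + 1); first by rewrite ltr_wpDl.
  move=> y /= xy; rewrite -[f y](subrKC (f x)) (le_trans (ler_normD _ _))//.
  by rewrite lerD2l distrC.
Qed.

Lemma compact_lower_bound f K : continuous f -> (forall x, K x -> 0 < f x) ->
  compact K -> exists2 c, 0 < c & forall x, K x -> c <= f x.
Proof.
move=> fc f0 cK.
pose P A := exists2 c : R, 0 < c & forall x, A x -> c <= f x.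
apply: (@compact_local_ind _ _ P) => //.
- by exists 1.
- move=> A B [M M0 MA] [N N0 NB]; exists (Num.min M N); first by rewrite lt_min M0.
  by move=> x [/MA|/NB] h; apply: (le_trans _ h); rewrite ge_min lexx ?orbT.
- by move=> A B AB [M M0 MB]; exists M => // x /AB/MB.
- move=> x Kx; have f2 : 0 < f x / 2 by rewrite divr_gt0// f0.
  exists [set y | `|f x - f y| <= f x / 2].
    by have /cvgrPdist_le/(_ _ f2) := fc x.
  by exists (f x / 2) => // y /= /ler_normlP[_]; lra.
Qed.

End real_functions.

Section compact_support.
Context (T : topologicalType) (R : realType).
Implicit Types (f g : T -> R) (K : set T).

Definition cc f := continuous f /\
  exists2 K, compact K & forall x, ~ K x -> f x = 0.

Lemma ccP f : hausdorff_space T ->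
  cc f <-> continuous f /\ compact (closure [set x | f x != 0]).
Proof.
move=> hT; split=> -[fc].
  move=> [K cK fK]; split => //; apply: (subclosed_compact _ cK).
    exact: closed_closure.
  have /closure_id -> := compact_closed hT cK.
  by apply: closureS => x /= /eqP; apply: contra_notP => /fK.
move=> cf; split => //; exists (closure [set x | f x != 0]) => //.
by move=> x; apply: contra_notP => /eqP fx; exact: subset_closure.
Qed.

Lemma cc_lin f g a : cc f -> cc g -> cc (fun x => a * f x + g x).
Proof.
move=> [fc [K cK fK]] [gc [L cL gL]]; split.
  by move=> x; apply: cvgD; [apply: cvgM; [exact: cvg_cst|exact: fc]|exact: gc].
exists (K `|` L); first exact: compactU.
by move=> x /not_orP[/fK -> /gL ->]; rewrite mulr0 addr0.
Qed.

Lemma cc0 : cc (fun=> 0).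
Proof. by split; [move=> x; exact: cvg_cst|exists set0 => //; exact: compact0]. Qed.

Lemma ccMl f g : continuous f -> cc g -> cc (fun x => f x * g x).
Proof.
move=> fc [gc [L cL gL]]; split; first by move=> x; apply: cvgM; [exact: fc|exact: gc].
by exists L => // x /gL ->; rewrite mulr0.
Qed.

Lemma cc_add f g : cc f -> cc g -> cc (fun x => f x + g x).
Proof.
by move=> cf cg; under [X in cc X]funext do rewrite -[f _]mul1r; exact: cc_lin.
Qed.

Lemma cc_abs f : cc f -> cc (fun x => `|f x|).
Proof.
move=> [fc [K cK fK]]; split; first by move=> x; apply: cvg_norm; exact: fc.
by exists K => // x /fK ->; rewrite normr0.
Qed.

Lemma bump K : hausdorff_space T -> locally_compact [set: T] -> compact K ->
  exists f, [/\ cc f, forall x, 0 <= f x & forall x, K x -> 1 <= f x].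
Proof.
move=> hT lT cK.
pose P A := exists f, [/\ cc f, forall x, 0 <= f x & forall x, A x -> 1 <= f x].
apply: (@compact_local_ind _ _ P) => //.
- by exists (fun=> 0); split => //; exact: cc0.
- move=> A B [f [fc f0 fA]] [g [gc g0 gB]]; exists (fun x => f x + g x); split.
  + exact: cc_add.
  + by move=> x; rewrite addr_ge0.
  + by move=> x [/fA|/gB] h; rewrite (le_trans h)// ?lerDl ?lerDr.
- by move=> A B AB [f [fc f0 fB]]; exists f; split => // x /AB/fB.
- move=> x Kx; have [U] := lT x I; rewrite withinET => nU [cU clU].
  have clV : closed (~` U°) by apply: open_closedC; exact: open_interior.
  have nV : ~ (~` U°) x by apply.
  have := @locally_compact_completely_regular T R lT hT x _ clV nV.
  move=> /(@uniform_separatorP _ R)[h [hc h01 hx hU]].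
  have hx0 : h x = 0 by apply: hx; exists x.
  exists [set y | `|h x - h y| <= 1 / 4].
    by have /cvgrPdist_le := hc x; apply; lra.
  (* h is 0 at x and 1 off the interior of U: the truncation vanishes off U and is at least 1
     wherever h <= 1/4. *)
  exists (fun y => Num.max (2 - 4 * h y) 0); split.
  + split.
      move=> y; apply: (@continuous_max _ _ (fun y => 2 - 4 * h y) (fun=> 0)).
        apply: cvgB; first exact: cvg_cst.
        by apply: cvgM; [exact: cvg_cst|exact: hc].
      exact: cvg_cst.
    exists U => // y nUy; have -> : h y = 1.
      by apply: hU; exists y => //= /interior_subset.
    by rewrite max_r//; lra.
  + by move=> y; rewrite le_max lexx orbT.
  + by move=> y /=; rewrite hx0 sub0r normrN => /ler_normlP[_ ?]; rewrite le_max; apply/orP; left; lra.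
Qed.

End compact_support.

(** * Positive functionals and integrals over compact sets *)

Section compact_integral.
Context d (E : borelGroupType d) (R : realType).
Hypothesis hE : hausdorff_space E.
Variable mu : {measure set E -> \bar R}.
Hypothesis muK : finite_on_compacts mu.
Variable K : set E.
Hypothesis cK : compact K.
Implicit Types (f g : E -> R) (B : set E).

Lemma compact_subset_finite B : measurable B -> B `<=` K -> (mu B < +oo)%E.
Proof.
move=> mB BK; apply: le_lt_trans (muK cK).
by apply: le_measure => //; rewrite inE//; exact: borel_compact.
Qed.

Lemma integrable_continuous f B : continuous f -> measurable B -> B `<=` K ->
  mu.-integrable B (EFin \o f).
Proof.
move=> fc mB BK; have [M M0 fM] := compact_upper_bound fc cK.
apply: measurable_bounded_integrable => //.
- exact: compact_subset_finite.
- by apply: measurable_funTS; exact: measurable_continuousR.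
- exists M; split; first exact: num_real.
  by move=> N MN x /= Bx; rewrite (le_trans (fM _ (BK _ Bx)))// ltW.
Qed.

Lemma Rintegral_lin f g a B : continuous f -> continuous g -> measurable B ->
  B `<=` K -> \int[mu]_(x in B) (a * f x + g x) =
  a * \int[mu]_(x in B) f x + \int[mu]_(x in B) g x.
Proof.
move=> fc gc mB BK; rewrite RintegralD//.
- by rewrite RintegralZl//; exact: integrable_continuous.
- apply: (@integrable_continuous (fun x => a * f x)) => // x.
  by apply: cvgM; [exact: cvg_cst|exact: fc].
- exact: integrable_continuous.
Qed.

Lemma Rintegral_mono f g B : continuous f -> continuous g -> measurable B ->
  B `<=` K -> (forall x, B x -> f x <= g x) ->
  \int[mu]_(x in B) f x <= \int[mu]_(x in B) g x.
Proof.
by move=> fc gc mB BK fg; apply: le_Rintegral => //; exact: integrable_continuous.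
Qed.

Lemma Rintegral_cst_approx f B c e : continuous f -> measurable B -> B `<=` K ->
  (forall x, B x -> `|f x - c| <= e) ->
  `|\int[mu]_(x in B) f x - c * fine (mu B)| <= e * fine (mu B).
Proof.
move=> fc mB BK fe.
have cc' (a : R) : continuous (fun _ : E => a) by move=> x; exact: cvg_cst.
rewrite -!(Rintegral_cst mu mB) -RintegralB//; last 2 first.
- exact: integrable_continuous.
- exact: (@integrable_continuous (fun=> c)).
have fcc : continuous (fun x => f x - c).
  by move=> x; apply: cvgB; [exact: fc|exact: cvg_cst].
apply: le_trans (le_normr_Rintegral _ _) _ => //.
  exact: (@integrable_continuous (fun x => f x - c)).
apply: (@Rintegral_mono (fun x => `|f x - c|) (fun=> e)) => //.
by move=> x; apply: cvg_norm; exact: fcc.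
Qed.

Lemma continuous_slice (T U : topologicalType) (k : T -> U -> R) x :
  continuous (fun p => k p.1 p.2) -> continuous (k x).
Proof.
move=> kc y; apply: (@continuous2_cvg _ _ _ _ _ _ (fun=> x) id k x y).
- exact: (kc (x, y)).
- exact: cvg_cst.
- exact: cvg_id.
Qed.

Lemma continuous_slicer (T U : topologicalType) (k : T -> U -> R) y :
  continuous (fun p => k p.1 p.2) -> continuous (k^~ y).
Proof.
move=> kc x; apply: (@continuous2_cvg _ _ _ _ _ _ id (fun=> y) k x y).
- exact: (kc (x, y)).
- exact: cvg_id.
- exact: cvg_cst.
Qed.

(** The tube lemma: compactness of L makes the neighbourhood of x0 independent of y. *)
Lemma near_compact_close (T U : topologicalType) (k : T -> U -> R) (L : set U)
    (x0 : T) (e : R) :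
  continuous (fun p => k p.1 p.2) -> compact L -> 0 < e ->
  \forall x \near x0, forall y, L y -> `|k x y - k x0 y| <= e.
Proof.
move=> kc /compact_near_coveringP cL e0.
apply: (cL T (nbhs x0) (fun x y => `|k x y - k x0 y| <= e)) => y Ly.
have e2 : 0 < e / 2 by rewrite divr_gt0.
have /cvgrPdist_le/(_ _ e2)[[P Q] /= [nP nQ] PQ] := kc (x0, y).
exists (Q, P) => //= -[y' x] /= [Qy' Px].
have h1 := PQ (x, y') (conj Px Qy').
have h2 := PQ (x0, y') (conj (nbhs_singleton nP) Qy').
rewrite /= in h1 h2.
move/ler_normlP : h1 => [h1 h1']; move/ler_normlP : h2 => [h2 h2'].
by apply/ler_normlP; split; lra.
Qed.

Lemma continuous_Rintegral (T : topologicalType) (k : T -> E -> R) B :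
  continuous (fun p => k p.1 p.2) -> measurable B -> B `<=` K ->
  continuous (fun x => \int[mu]_(y in B) k x y).
Proof.
move=> kc mB BK x0; apply/cvgrPdist_le => e e0.
set m := fine (mu B); have m0 : 0 <= m by exact: fine_ge0.
have e1 : 0 < e / (m + 1) by rewrite divr_gt0// ltr_wpDl.
have := near_compact_close x0 kc cK e1.
apply: filterS => x xk.
rewrite -RintegralB//; try by apply: integrable_continuous => //; exact: continuous_slice.
have kcx z : continuous (k z) by exact: continuous_slice.
have fc : continuous (fun y => k x0 y - k x y).
  by move=> y; apply: cvgB; exact: kcx.
have := @Rintegral_cst_approx _ B 0 (e / (m + 1)) fc mB BK.
rewrite mul0r subr0 => H; apply: le_trans (H _) _.
  by move=> y By; rewrite subr0 distrC xk//; exact: BK.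
by rewrite -/m mulrAC ler_pdivrMr ?ltr_wpDl// ler_pM2l// lerDl.
Qed.

End compact_integral.

Section positive_linear.
Context (T : Type) (R : realType).
Implicit Types (C : set (T -> R)) (l : (T -> R) -> R).

(** One notion serves two classes: functionals act on compactly supported functions, whereas
    operators act on all continuous functions, so that they can be applied to the constant 1. *)
Definition linear_class C :=
  C (fun=> 0) /\ forall f g a, C f -> C g -> C (fun x => a * f x + g x).

Definition positive_linear C l :=
  (forall f g a, C f -> C g -> l (fun x => a * f x + g x) = a * l f + l g) /\
  (forall f, C f -> (forall x, 0 <= f x) -> 0 <= l f).

End positive_linear.

Section positive_linear_theory.
Context (T : Type) (R : realType).
Variable C : set (T -> R).
Hypothesis CP : linear_class C.
Variable l : (T -> R) -> R.
Hypothesis lP : positive_linear C l.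
Implicit Types f g : T -> R.

Lemma linear_classZ f a : C f -> C (fun x => a * f x).
Proof.
move=> cf; have := CP.2 f (fun=> 0) a cf CP.1; congr C.
by apply/funext => x; rewrite addr0.
Qed.

Lemma linear_classB f g : C f -> C g -> C (fun x => f x - g x).
Proof.
move=> cf cg; have := CP.2 g f (-1) cg cf; congr C.
by apply/funext => x; rewrite mulN1r addrC.
Qed.

Lemma plin0 : l (fun=> 0) = 0.
Proof.
have := lP.1 (fun=> 0) (fun=> 0) 1 CP.1 CP.1.
under [X in l X = _ -> _]funext do rewrite mulr0 addr0.
by rewrite mul1r => /eqP; rewrite -subr_eq subrr eq_sym => /eqP.
Qed.

Lemma plinZ f a : C f -> l (fun x => a * f x) = a * l f.
Proof.
move=> cf; have := lP.1 f (fun=> 0) a cf CP.1.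
by rewrite plin0 addr0 => <-; congr l; apply/funext => x; rewrite addr0.
Qed.

Lemma plinB f g : C f -> C g -> l (fun x => f x - g x) = l f - l g.
Proof.
move=> cf cg; have := lP.1 g f (-1) cg cf; rewrite mulN1r addrC => <-.
by congr l; apply/funext => x; rewrite mulN1r addrC.
Qed.

Lemma plin_le f g : C f -> C g -> (forall x, f x <= g x) -> l f <= l g.
Proof.
move=> cf cg fg; rewrite -subr_ge0 -plinB//; apply: lP.2.
  exact: linear_classB.
by move=> x; rewrite subr_ge0.
Qed.

Lemma plin_dist f g h e : C f -> C g -> C h ->
  (forall x, `|f x - g x| <= e * h x) -> `|l f - l g| <= e * l h.
Proof.
move=> cf cg ch fgh; rewrite -plinB// -plinZ//.
have cfg := linear_classB cf cg.
apply/ler_normlP; split; last first.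
  by apply: plin_le => // [|x]; [exact: linear_classZ|have /ler_normlP[] := fgh x].
rewrite -mulN1r -plinZ//; apply: plin_le; try exact: linear_classZ.
by move=> x; rewrite mulN1r; have /ler_normlP[] := fgh x.
Qed.

End positive_linear_theory.

Lemma linear_class_cc (T : topologicalType) (R : realType) : linear_class (@cc T R).
Proof. by split; [exact: cc0|move=> f g a; exact: cc_lin]. Qed.

Lemma linear_class_continuous (T : topologicalType) (R : realType) :
  linear_class (fun f : T -> R => continuous f).
Proof.
split; first by move=> x; exact: cvg_cst.
by move=> f g a fc gc x; apply: cvgD; [apply: cvgM; [exact: cvg_cst|exact: fc]|exact: gc].
Qed.

(** * Fubini for a positive functional and an integral over a compact set *)

Section swap.
Context d (E : borelGroupType d) (R : realType).
Hypothesis hE : hausdorff_space E.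
Hypothesis lE : locally_compact [set: E].
Variable mu : {measure set E -> \bar R}.
Hypothesis muK : finite_on_compacts mu.
Variable K : set E.
Hypothesis cK : compact K.
Variables (T : topologicalType) (hT : hausdorff_space T).
Hypothesis lT : locally_compact [set: T].
Variable l : (T -> R) -> R.
Hypothesis lP : positive_linear (@cc T R) l.
Variables (k : T -> E -> R) (L : set T).
Hypothesis kc : continuous (fun p => k p.1 p.2).
Hypothesis cL : compact L.
Hypothesis kL : forall y x, ~ L y -> k y x = 0.

Let ccE := @linear_class_cc T R.

Let kcr : continuous (fun p => k p.2 p.1).
Proof.
move=> p; apply: (@continuous2_cvg _ _ _ _ _ _ snd fst k p.2 p.1).
- exact: (@kc (p.2, p.1)).
- exact: cvg_snd.
- exact: cvg_fst.
Qed.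

Let cc_slice x : cc (k^~ x).
Proof. by split; [exact: continuous_slicer|exists L => // y; exact: kL]. Qed.

(** Constants are not compactly supported, so l cannot be applied to a uniform bound e; the majorant
    e h, with h >= 1 on L, takes its place. *)
Let close x0 e h : (forall y, 0 <= h y) -> (forall y, L y -> 1 <= h y) ->
  0 < e -> \forall x \near x0, forall y, `|k y x - k y x0| <= e * h y.
Proof.
move=> h0 hL e0; have := @near_compact_close R E T (fun x y => k y x) L x0 e kcr cL e0.
apply: filterS => x kx y; have [Ly|nLy] := pselect (L y).
  by rewrite (le_trans (kx y Ly))// ler_peMr ?hL// ltW.
by rewrite !kL// subrr normr0 mulr_ge0// ltW.
Qed.

Lemma cc_Rintegral B : measurable B -> B `<=` K ->
  cc (fun y => \int[mu]_(x in B) k y x).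
Proof.
move=> mB BK; split; first exact: (continuous_Rintegral hE muK cK).
exists L => // y nLy; under eq_Rintegral do rewrite kL//.
by rewrite Rintegral_cst// mul0r.
Qed.

Lemma plin_continuous : continuous (fun x => l (k^~ x)).
Proof.
move=> x0; apply/cvgrPdist_le => e e0.
have [h [hc h0 hL]] := @bump _ R _ hT lT cL.
have lh0 : 0 <= l h by exact: lP.2.
have e1 : 0 < e / (l h + 1) by rewrite divr_gt0// ltr_wpDl.
have := close x0 h0 hL e1; apply: filterS => x kx.
rewrite distrC (le_trans (plin_dist ccE lP _ _ hc kx))//; try exact: cc_slice.
by rewrite mulrAC ler_pdivrMr ?ltr_wpDl// ler_pM2l// lerDl.
Qed.

(** A Riemann sum argument: on a small piece B of K around x0 the kernel is nearly constant in x, so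
    both sides are within e * l h * mu B of mu B * l (k^~ x0). The errors add up to a multiple of mu
    K. *)
Lemma plin_swap : l (fun y => \int[mu]_(x in K) k y x) =
                  \int[mu]_(x in K) l (k^~ x).
Proof.
have [h [hc h0 hL]] := @bump _ R _ hT lT cL.
have lh0 : 0 <= l h by exact: lP.2.
have mK := borel_compact hE cK.
suff H e : 0 < e -> `|l (fun y => \int[mu]_(x in K) k y x) -
    \int[mu]_(x in K) l (k^~ x)| <= e * (2 * l h * fine (mu K)).
  apply/eqP; rewrite -subr_eq0 -normr_le0; apply/ler_addgt0Pl => e e0.
  set c := 2 * l h * fine (mu K) in H.
  have c0 : 0 <= c by rewrite !mulr_ge0// fine_ge0.
  have e1 : 0 < e / (c + 1) by rewrite divr_gt0// ltr_wpDl.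
  rewrite addr0 (le_trans (H _ e1))//.
  by rewrite mulrAC ler_pdivrMr ?ltr_wpDl// ler_pM2l// lerDl.
move=> e0.
pose D B := l (fun y => \int[mu]_(x in B) k y x) - \int[mu]_(x in B) l (k^~ x).
(* Quantifying over all measurable parts B of A' makes P stable under unions: B is cut along the
   first set, and [D] and mu are additive over the two parts. *)
pose P A := exists A', [/\ measurable A', A `<=` A' &
  forall B, measurable B -> B `<=` A' -> B `<=` K ->
  `|D B| <= e * (2 * l h * fine (mu B))].
suff [A' [mA' KA' H]] : P K by exact: (H K).
have lkc := plin_continuous.
apply: (@compact_local_ind _ _ P) => //.
- exists set0; split => // B _; rewrite subset0 => -> _.
  rewrite /D !Rintegral_set0 measure0 mulr0 mulr0.
  under [X in l X]funext do rewrite Rintegral_set0.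
  by rewrite (plin0 ccE lP) subrr normr0.
- move=> A1 A2 [A1' [mA1 sA1 H1]] [A2' [mA2 sA2 H2]]; exists (A1' `|` A2').
  split; [exact: measurableU|exact: setUSS|] => B mB BA BK.
  have mB1 : measurable (B `&` A1') by exact: measurableI.
  have mB2 : measurable (B `\` A1') by exact: measurableD.
  have B1K : B `&` A1' `<=` K by move=> x [/BK].
  have B2K : B `\` A1' `<=` K by move=> x [/BK].
  have BE : (B `&` A1') `|` (B `\` A1') = B by rewrite setUIDK.
  have dj : [disjoint B `&` A1' & B `\` A1'].
    by apply/disj_setPS => x [[_ ?] [_ /(_ _)]].
  have muB : fine (mu B) = fine (mu (B `&` A1')) + fine (mu (B `\` A1')).
    rewrite -fineD ?ge0_fin_numE ?(compact_subset_finite hE muK cK)//.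
    by rewrite -measureU ?BE//; apply/eqP; exact: dj.
  have -> : D B = D (B `&` A1') + D (B `\` A1').
    rewrite /D -{1 2}BE.
    rewrite (@Rintegral_setU _ _ _ mu _ _ (fun x => l (k^~ x)) mB1 mB2 _ dj); last first.
      by rewrite BE; exact: (integrable_continuous hE muK cK).
    have -> : (fun y => \int[mu]_(x in (B `&` A1') `|` (B `\` A1')) k y x) =
      fun y => 1 * \int[mu]_(x in B `&` A1') k y x + \int[mu]_(x in B `\` A1') k y x.
      apply/funext => y; rewrite mul1r.
      rewrite (@Rintegral_setU _ _ _ mu _ _ (k y) mB1 mB2 _ dj)// BE.
      apply: (integrable_continuous hE muK cK) => //; exact: continuous_slice.
    by rewrite lP.1 ?mul1r; [ring|exact: cc_Rintegral|exact: cc_Rintegral].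
  rewrite (le_trans (ler_normD _ _))// muB !mulrDr lerD//.
    by apply: H1 => // x [].
  by apply: H2 => // x [/BA[]].
- by move=> A B AB [A' [mA BA' H]]; exists A'; split => //; exact: subset_trans AB _.
- move=> x0 Kx0.
  have : nbhs x0 [set x | forall y, `|k y x - k y x0| <= e * h y] by exact: close.
  rewrite nbhsE => -[U [oU Ux0] Uk].
  exists U; first by exists U.
  exists U; split; [exact: borel_open|by []|] => B mB BU BK.
  set m := fine (mu B); have m0 : 0 <= m by exact: fine_ge0.
  have h1 : `|l (fun y => \int[mu]_(x in B) k y x) - m * l (k^~ x0)| <= e * m * l h.
    rewrite -(plinZ ccE lP)//; apply: (plin_dist ccE lP) => //.
    - exact: cc_Rintegral.
    - by apply: ccMl => // x; exact: cvg_cst.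
    - move=> y; rewrite [m * _]mulrC mulrAC.
      apply: (Rintegral_cst_approx hE muK cK) => //; first exact: continuous_slice.
      by move=> x /BU/Uk.
  have h2 : `|\int[mu]_(x in B) l (k^~ x) - l (k^~ x0) * m| <= e * l h * m.
    apply: (Rintegral_cst_approx hE muK cK) => // x /BU/Uk kx.
    exact: (plin_dist ccE lP).
  move/ler_normlP : h1 => [h1 h1']; move/ler_normlP : h2 => [h2 h2'].
  by apply/ler_normlP; rewrite /D -/m; split; lra.
Qed.

End swap.

(** * Ratio limits for positive operators *)

(** From exp (-x) >= 1 - x, since (1 + x + 2 x^2) (1 - x) = 1 + x^2 (1 - 2 x) >= 1. *)
Lemma expR_le_quadratic (R : realType) (x : R) : x <= 1 / 2 -> expR x <= 1 + x + 2 * x ^+ 2.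
Proof.
move=> x2; have h := expR_ge1Dx (- x).
have x1 : 0 < 1 - x by lra.
rewrite -[x in expR x]opprK expRN.
rewrite invf_ple ?posrE ?expR_gt0//; last by nra.
apply: le_trans h; rewrite -[leLHS]mul1r ler_pdivrMr; nra.
Qed.

Lemma expR_eventually_small (R : realType) (k e : R) : 0 < k -> 0 < e ->
  \forall M \near \oo, expR (- (k * M%:R)) <= e.
Proof.
move=> k0 e0; near=> M.
have M0 : 0 <= k * M%:R by rewrite mulr_ge0// ltW.
rewrite expRN invf_ple ?posrE ?expR_gt0//.
apply: le_trans (expR_ge1Dx _); rewrite ler_wpDl//.
rewrite mulrC -ler_pdivrMr//; near: M; exact: nbhs_infty_ger.
Unshelve. all: by end_near. Qed.

Section positive_operators.
Context (T : Type) (R : realType).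
Variable C : set (T -> R).
Hypothesis CP : linear_class C.
Implicit Types (f g : T -> R) (A B Q : (T -> R) -> T -> R).

Definition positive_operator B :=
  (forall f, C f -> C (B f)) /\ forall x, positive_linear C (B^~ x).

Definition dominated A B :=
  forall f, C f -> (forall x, 0 <= f x) -> forall x, A f x <= B f x.

Lemma pop_lin B f g a x : positive_operator B -> C f -> C g ->
  B (fun x => a * f x + g x) x = a * B f x + B g x.
Proof. by move=> [_ /(_ x)[h _]]; exact: h. Qed.

Lemma pop_ge0 B f x : positive_operator B -> C f -> (forall x, 0 <= f x) ->
  0 <= B f x.
Proof. by move=> [_ /(_ x)[_ h]]; exact: h. Qed.

Lemma pop_le B f g x : positive_operator B -> C f -> C g ->
  (forall x, f x <= g x) -> B f x <= B g x.
Proof. by move=> [_ /(_ x) h] cf cg fg; exact: (plin_le CP h). Qed.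

Lemma pop_id : positive_operator id.
Proof. by split => // x; split => // f cf /(_ x). Qed.

Lemma pop_comp A B : positive_operator A -> positive_operator B ->
  positive_operator (A \o B).
Proof.
move=> Ap Bp; split=> [f cf|x]; first exact/Ap.1/Bp.1.
split=> [f g a cf cg|f cf f0] /=.
  have -> : B (fun x => a * f x + g x) = fun x => a * B f x + B g x.
    by apply/funext => y; exact: pop_lin.
  by rewrite pop_lin//; exact: Bp.1.
by apply: pop_ge0 => //; [exact: Bp.1|move=> y; exact: pop_ge0].
Qed.

Lemma pop_iter B n : positive_operator B -> positive_operator (iter n B).
Proof. by move=> Bp; elim: n => [|n ih] /=; [exact: pop_id|exact: pop_comp]. Qed.

Lemma pop_iter1 B n : positive_operator B -> B (fun=> 1) = (fun=> 1) ->
  iter n B (fun=> 1) = fun=> 1.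
Proof. by move=> Bp B1; elim: n => //= n ->. Qed.

(* The derivative at t = 0 of (B + t A)^M. *)
Fixpoint leibniz B A (M : nat) f : T -> R :=
  if M is M'.+1 then fun x => B (leibniz B A M' f) x + A (iter M' B f) x
  else fun=> 0.

Lemma linear_classD f g : C f -> C g -> C (fun x => f x + g x).
Proof.
move=> cf cg; have := CP.2 f g 1 cf cg; congr C.
by apply/funext => x; rewrite mul1r.
Qed.

Lemma leibniz_class B A M f : positive_operator A -> positive_operator B ->
  C f -> C (leibniz B A M f).
Proof.
move=> Ap Bp cf; elim: M => [|M ih] /=; first exact: CP.1.
by apply: linear_classD; [exact: Bp.1|apply/Ap.1/(pop_iter M Bp).1].
Qed.

Lemma leibniz_comm B A Q M f : positive_operator B ->
  (forall f, B (Q f) = Q (B f)) ->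
  leibniz B (A \o Q) M f = leibniz B A M (Q f).
Proof.
move=> Bp BQ; elim: M => //= M ->; apply/funext => x; congr (_ + A _ x).
by elim: M => //= M <-.
Qed.

(** * Concentration of the number of factors A *)

Section tilt.
Variables A B : (T -> R) -> T -> R.
Hypotheses (Ap : positive_operator A) (Bp : positive_operator B).
Hypothesis AB : dominated A B.

(** In the expansion of the M-th iterate, a word with s factors A gets the weight t^s; thus iterates
    of [tilt] are generating functions of s, and t = 1 gives back B^M. *)
Definition tilt t f x := (B f x - A f x) + t * A f x.

Lemma tilt_pop t : 0 <= t -> positive_operator (tilt t).
Proof.
move=> t0; split=> [f cf|x].
  apply: linear_classD; last by apply: linear_classZ => //; exact: Ap.1.
  by apply: linear_classB => //; [exact: Bp.1|exact: Ap.1].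
split=> [f g a cf cg|f cf f0]; rewrite /tilt.
  by rewrite !pop_lin//; ring.
by rewrite addr_ge0 ?subr_ge0 ?AB// mulr_ge0//; exact: pop_ge0.
Qed.

(* The right-hand side is the tangent of s |-> exp (theta s) at s = lambda / theta,
   with s counting the factors A in the expansion of B^M = ((B - A) + A)^M. *)
Lemma tilt_tangent theta M : forall lam f x, C f -> (forall x, 0 <= f x) ->
  expR lam * ((1 - lam) * iter M B f x + theta * leibniz B A M f x) <=
  iter M (tilt (expR theta)) f x.
Proof.
elim: M => [|M ih] lam f x cf f0 /=.
  rewrite mulr0 addr0 mulrA -[leRHS]mul1r ler_wpM2r//.
  have := expR_ge1Dx (- lam); rewrite expRN => h.
  by rewrite -ler_pdivlMl ?expR_gt0// mulr1.
have Up := pop_iter M (tilt_pop (ltW (expR_gt0 theta))).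
set U := iter M (tilt _) in ih Up *.
pose G lam x := expR lam * ((1 - lam) * iter M B f x + theta * leibniz B A M f x).
have cB : C (iter M B f) by exact: (pop_iter M Bp).1.
have cD : C (leibniz B A M f) by exact: leibniz_class.
have cU : C (U f) by exact: Up.1.
have cG l : C (G l).
  apply: linear_classZ => //; apply: CP.2 => //; exact: linear_classZ.
have cUG l : C (fun x => U f x - G l x) by exact: linear_classB.
have UG l y : 0 <= U f y - G l y by rewrite subr_ge0; exact: ih.
have GE (L : (T -> R) -> T -> R) l y : positive_operator L -> L (G l) y =
    expR l * ((1 - l) * L (iter M B f) y + theta * L (leibniz B A M f) y).
  move=> Lp; have lL := Lp.2 y.
  rewrite (plinZ CP lL); last by apply: CP.2 => //; exact: linear_classZ.
  by rewrite (pop_lin _ _ Lp)//; [rewrite (plinZ CP lL)|exact: linear_classZ].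
rewrite /tilt.
(* A first factor B - A leaves s unchanged, so the tangent at lam is kept, and domination makes B -
   A monotone. A first factor A raises s by one, so the tangent at lam - theta is used; the weight
   exp theta then restores exp lam. *)
have h1 : B (G lam) x - A (G lam) x <= B (U f) x - A (U f) x.
  rewrite -subr_ge0; have := AB (cUG lam) (UG lam) x.
  rewrite -subr_ge0 (plinB (Bp.2 x))// (plinB (Ap.2 x))//.
  by congr (_ <= _); ring.
have h2 : A (G (lam - theta)) x <= A (U f) x.
  by apply: pop_le => // y; exact: ih.
rewrite (GE B)// (GE A)// in h1; rewrite (GE A)// in h2.
have e0 := expR_gt0 theta.
have := ler_wpM2l (ltW e0) h2; rewrite mulrA -expRD subrKC => h3.
apply: le_trans (lerD h1 h3).
rewrite le_eqVlt; apply/orP; left; apply/eqP; ring.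
Qed.

Variable a : R.
Hypotheses (A1 : A (fun=> 1) = fun=> a) (B1 : B (fun=> 1) = fun=> 1).
Hypothesis C1 : C (fun=> 1).

(** The right-hand side is the generating function of the binomial(M, a) law; it is the exact value
    at f = 1, because A 1 and B 1 are constants. *)
Lemma tilt_bound t M f x : 0 <= t -> C f -> (forall x, f x <= 1) ->
  iter M (tilt t) f x <= (1 - a + t * a) ^+ M.
Proof.
move=> t0 cf f1; have Up := pop_iter M (tilt_pop t0).
apply: le_trans (pop_le x Up cf C1 f1) _.
have -> : iter M (tilt t) (fun=> 1) = fun=> (1 - a + t * a) ^+ M.
  elim: M {Up} => [|M ih]; first by apply/funext => y; rewrite expr0.
  rewrite iterS ih; apply/funext => y; rewrite exprSr.
  have cE c : (fun=> c) = (fun _ : T => c * 1) by apply/funext => z; rewrite mulr1.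
  rewrite [in LHS]cE (plinZ CP ((tilt_pop t0).2 y))//.
  by rewrite /tilt A1 B1.
by [].
Qed.

(** A Chernoff bound for s: the tangents at s = (a + eps) M with theta = eps / 4, and at s = (a -
    eps) M with theta = - eps / 4, are compared with the generating function. Dividing by eps / 4
    isolates the derivative and yields the factor 4 / eps. *)
Lemma leibniz_concentration eps M f x : 0 <= a <= 1 -> 0 < eps <= 1 -> C f ->
  (forall x, 0 <= f x <= 1) ->
  `|leibniz B A M f x - a * M%:R * iter M B f x| <=
  eps * M%:R * iter M B f x + 4 / eps * expR (- (eps ^+ 2 / 8)) ^+ M.
Proof.
move=> /andP[a0 a1] /andP[e0 e1] cf f01.
have f0 y : 0 <= f y by have /andP[] := f01 y.
have f1 y : f y <= 1 by have /andP[] := f01 y.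
set b := iter M B f x; set D := leibniz B A M f x; set m : R := M%:R.
have b0 : 0 <= b by apply: pop_ge0 => //; exact: pop_iter.
have m0 : 0 <= m by exact: ler0n.
set rho := expR _.
(* The second condition bounds the exponent per round of exp (- th c) (1 - a + a exp th). For both
   choices of th and c its left side equals - eps^2 / 4 + a eps^2 / 8. *)
have key th c : `|th| <= eps / 4 -> - (th * c) + a * (th + 2 * th ^+ 2) <= - (eps ^+ 2 / 8) ->
   (1 - th * c * m) * b + th * D <= rho ^+ M.
  move=> thm thc.
  have := tilt_tangent th M (th * c * m) x cf f0; rewrite -/b -/D => h.
  have := le_trans h (tilt_bound M x (ltW (expR_gt0 th)) cf f1).
  rewrite -ler_pdivlMl ?expR_gt0// => /le_trans; apply.
  rewrite -expRN /m -mulNr expRM_natr -exprMn.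
  have t2 : expR th <= 1 + th + 2 * th ^+ 2.
    by apply: expR_le_quadratic; move/ler_normlP : thm => [_ thm']; lra.
  have := expR_gt0 th => eth.
  rewrite lerXn2r ?nnegrE ?expR_ge0//; first by rewrite mulr_ge0 ?expR_ge0// addr_ge0 ?subr_ge0// mulr_ge0 ?expR_ge0.
  apply: (@le_trans _ _ (expR (- (th * c)) * expR (a * (th + 2 * th ^+ 2)))).
    rewrite ler_wpM2l ?expR_ge0//; apply: le_trans (expR_ge1Dx _).
    have := ler_wpM2l a0 t2; lra.
  by rewrite -expRD ler_expR.
have e4 : 0 < eps / 4 by rewrite divr_gt0.
have k1 := key (eps / 4) (a + eps).
have k2 := key (- (eps / 4)) (a - eps).
set r := rho ^+ M in k1 k2 *; set X := 4 / eps * r.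
have XE : eps / 4 * X = r by rewrite /X; field; rewrite gt_eqF.
have {}k1 : (1 - eps / 4 * (a + eps) * m) * b + eps / 4 * D <= r.
  by apply: k1; [rewrite gtr0_norm|nra].
have {}k2 : (1 - (- (eps / 4)) * (a - eps) * m) * b + - (eps / 4) * D <= r.
  by apply: k2; [rewrite normrN gtr0_norm|nra].
apply/ler_normlP; split; rewrite -(ler_pM2l e4); lra.
Qed.

End tilt.

(** * Ratio of consecutive iterates *)

Section ratio.
Variables (Q A : (T -> R) -> T -> R) (j : nat) (a : R) (g : T -> R) (x : T).
Hypotheses (Qp : positive_operator Q) (Ap : positive_operator A).
Hypotheses (AQ : dominated A (iter j Q)) (AQ1 : dominated A (iter j.+1 Q)).
Hypotheses (C1 : C (fun=> 1)) (Q1 : Q (fun=> 1) = fun=> 1).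
Hypotheses (a01 : 0 < a <= 1) (A1 : A (fun=> 1) = fun=> a).
Hypotheses (cg : C g) (g01 : forall y, 0 <= g y <= 1).
Let w n := iter n Q g x.
Hypothesis w_subexp : forall t, 1 < t ->
  exists2 c, 0 < c & \forall n \near \oo, c <= t ^+ n * w n.

Let b := j.+1.
Let B := iter b Q.

(** B commutes with Q, so [leibniz] for A Q at Q^s g and for A at Q^(s+1) g are one and the same
    number D. Concentration puts D near both a M w (M b + s) and a M w (M b + s + 1). *)
Lemma ratio_step eps M s : 0 < eps <= 1 ->
  a * M%:R * `|w (M * b + s) - w (M * b + s).+1| <=
  eps * M%:R * (w (M * b + s) + w (M * b + s).+1) +
  8 / eps * expR (- (eps ^+ 2 / 8)) ^+ M.
Proof.
move=> e01; have Bp : positive_operator B by exact: pop_iter.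
have B1 : B (fun=> 1) = fun=> 1 by exact: pop_iter1.
have AQp : positive_operator (A \o Q) by exact: pop_comp.
have AQB : dominated (A \o Q) B.
  move=> f cf f0 y; rewrite /B /b iterSr; apply: AQ; first exact: Qp.1.
  by move=> z; exact: pop_ge0.
have AQ1' : (A \o Q) (fun=> 1) = fun=> a by rewrite /= Q1.
have a01' : 0 <= a <= 1 by case/andP : a01 => /ltW -> ->.
have itp n : positive_operator (iter n Q) by exact: pop_iter.
have it01 n y : 0 <= iter n Q g y <= 1.
  rewrite (pop_ge0 y (itp n))//=; last by move=> z; have /andP[] := g01 z.
  have : iter n Q g y <= iter n Q (fun=> 1) y.
    by apply: pop_le => // z; have /andP[] := g01 z.
  by rewrite pop_iter1.
have BM n y : iter M B (iter n Q g) y = iter (M * b + n) Q g y.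
  by rewrite iterD; congr (_ y); rewrite /B; elim: M => // M ih; rewrite iterS ih mulSn [RHS]iterD.
have cs : C (iter s Q g) by exact: (itp s).1.
have cs1 : C (iter s.+1 Q g) by exact: (itp s.+1).1.
have h1 := @leibniz_concentration _ _ AQp Bp AQB a AQ1' B1 C1 eps M _ x a01' e01 cs (it01 s).
have h2 := @leibniz_concentration _ _ Ap Bp AQ1 a A1 B1 C1 eps M _ x a01' e01 cs1 (it01 s.+1).
have comm f : B (Q f) = Q (B f) by rewrite /B -iterSr.
rewrite (leibniz_comm _ _ _ Bp comm) -iterS BM in h1; rewrite BM addnS in h2.
rewrite -/(w _) in h1; rewrite -/(w _) in h2.
set D := leibniz B A M _ x in h1 h2; set r := _ ^+ M in h1 h2 *.
have -> : 8 / eps * r = 4 / eps * r + 4 / eps * r by rewrite -mulrDl; congr (_ * _); lra.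
have m0 : 0 <= M%:R :> R by exact: ler0n.
have am : 0 <= a * M%:R by rewrite mulr_ge0//; case/andP : a01'.
rewrite -[X in X * `|_|]ger0_norm// -normrM.
move/ler_normlP : h1 => [h1 h1']; move/ler_normlP : h2 => [h2 h2'].
by apply/ler_normlP; split; lra.
Qed.

Lemma ratio_step_limit : w n.+1 / w n @[n --> \oo] --> (1 : R).
Proof.
case/andP : (a01) => a0 a1.
apply/cvgrPdist_le => delta d0.
(* The final estimate reads a D <= eps (3 w n + D), with D the distance of w n and w (n + 1): eps <=
   a / 2 absorbs D on the right, and eps <= delta a / 8 leaves D <= delta w n. *)
pose eps := Num.min (a / 2) (delta * a / 8).
have e0 : 0 < eps by rewrite lt_min !divr_gt0//= mulr_gt0.
have ea : eps <= a / 2 by rewrite ge_min lexx.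
have ed : eps <= delta * a / 8 by rewrite ge_min lexx orbT.
have e1 : eps <= 1 by lra.
have b0 : 0 < b%:R :> R by rewrite ltr0n.
(* Half the Chernoff exponent: the error is u^2 with u = exp (- kap M). One factor u is paid for by
   subexponential decay at the rate t = exp (kap / b), as t^n is at most exp kap / u; the other
   factor makes the error small relative to w n. *)
pose kap := eps ^+ 2 / 16; have k0 : 0 < kap by rewrite divr_gt0// exprn_gt0.
pose t := expR (kap / b%:R).
have t1 : 1 < t by rewrite expR_gt1 divr_gt0.
have [c c0 wc] := w_subexp t1.
have e' : 0 < eps ^+ 2 * c / (8 * expR kap).
  by rewrite divr_gt0 ?mulr_gt0 ?exprn_gt0 ?expR_gt0.
have [N _ NP] := expR_eventually_small k0 e'.
near=> n.
have [M [s [Ms sb]]] : exists M s, n = (M * b + s)%N /\ (s < b)%N.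
  by exists (n %/ b)%N, (n %% b)%N; split; [exact: divn_eq|exact: ltn_pmod].
have NM : (maxn N 1 <= M)%N.
  have : ((maxn N 1).+1 * b <= n)%N by near: n; exact: nbhs_infty_ge.
  have lt : (n < M.+1 * b)%N by rewrite Ms mulSn addnC ltn_add2r.
  by move=> /leq_ltn_trans/(_ lt); rewrite ltn_mul2r => /andP[_ /ltnW].
have M1 : 1 <= M%:R :> R by rewrite ler1n (leq_trans _ NM)// leq_maxr.
have wn : c <= t ^+ n * w n by near: n.
have w0 : 0 < w n.
  have tn0 : 0 < t ^+ n by rewrite exprn_gt0// expR_gt0.
  by rewrite -(pmulr_rgt0 _ tn0) (lt_le_trans c0).
set r := expR (- (eps ^+ 2 / 8)) ^+ M.
have small : 8 / eps * r <= eps * w n.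
  have tn : t ^+ n <= expR (kap * M%:R) * expR kap.
    rewrite /t -expRM_natr -expRD ler_expR Ms natrD natrM.
    have -> : kap / b%:R * (M%:R * b%:R + s%:R) = kap * M%:R + kap * (s%:R / b%:R).
      by field; rewrite gt_eqF.
    by rewrite lerD2l ler_piMr ?(ltW k0)// ler_pdivrMr// mul1r ler_nat ltnW.
  have rE : r = expR (- (kap * M%:R)) * expR (- (kap * M%:R)).
    by rewrite /r -expRM_natr -expRD; congr expR; rewrite /kap; field.
  have h1 : expR (- (kap * M%:R)) <= eps ^+ 2 * c / (8 * expR kap).
    by apply: NP => /=; apply: leq_trans NM; exact: leq_maxl.
  set u := expR (- (kap * M%:R)) in rE h1.
  have u0 : 0 < u by exact: expR_gt0.
  have uE : u * expR (kap * M%:R) = 1 by rewrite mulrC expRxMexpNx_1.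
  (* c u <= u t^n w <= e^kap w *)
  have h2 : c * u <= expR kap * w n.
    have := ler_wpM2l (ltW u0) wn; rewrite mulrC => /le_trans; apply.
    rewrite mulrA ler_wpM2r ?(ltW w0)//.
    by have := ler_wpM2l (ltW u0) tn; rewrite mulrA uE mul1r.
  have ek0 := expR_gt0 kap.
  rewrite ler_pdivlMr ?mulr_gt0// in h1.
  have h3 : 8 * (u * u) <= eps ^+ 2 * w n.
    rewrite -(ler_pM2l ek0); have := ler_wpM2r (ltW u0) h1.
    by have := ler_wpM2l (ltW (exprn_gt0 2 e0)) h2; lra.
  by rewrite rE mulrAC ler_pdivrMr//; lra.
have e01 : 0 < eps <= 1 by rewrite e0 e1.
have := ratio_step M s e01; rewrite -Ms -/r.
set z := w n.+1 => h.
have [D0 DE] : 0 <= `|w n - z| /\ z <= w n + `|w n - z|.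
  by split => //; have := ler_norm (z - w n); rewrite distrC; lra.
set D := `|w n - z| in h D0 DE.
have h3 : a * M%:R * D <= M%:R * (eps * (3 * w n + D)).
  have em0 : 0 <= eps * M%:R by rewrite mulr_ge0 ?ltW// (lt_le_trans _ M1).
  have := ler_wpM2l em0 DE; have := ler_wpM2r (mulr_ge0 (ltW e0) (ltW w0)) M1.
  by rewrite mul1r; lra.
have h4 : a * D <= eps * (3 * w n + D).
  by rewrite -(@ler_pM2l _ M%:R) ?(lt_le_trans _ M1)//; lra.
have h5 : D <= delta * w n.
  by rewrite -(ler_pM2l a0); nra.
rewrite -(@mulfV _ (w n)) ?gt_eqF// -mulrBl normrM normfV (gtr0_norm w0).
by rewrite ler_pdivrMr.
Unshelve. all: by end_near. Qed.

End ratio.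
End positive_operators.

(** * Measures *)

Section sigma_finite_measure_of.
Context d (T : measurableType d) (R : realType) (mu : {measure set T -> \bar R}).
Hypothesis mu_sf : sigma_finite setT mu.

(** A fresh constant taking the proof as an argument, so that the structure instance can be attached
    to it for an arbitrary mu. *)
Definition sigma_finite_copy of sigma_finite setT mu : set T -> \bar R := mu.
HB.instance Definition _ := Measure.copy (sigma_finite_copy mu_sf) mu.
HB.instance Definition _ :=
  @Measure_isSigmaFinite.Build d T R (sigma_finite_copy mu_sf) mu_sf.

Definition sigma_finite_measure_of : {sigma_finite_measure set T -> \bar R} :=
  sigma_finite_copy mu_sf.

End sigma_finite_measure_of.

Section probability_of.
Context d (T : measurableType d) (R : realType) (mu : {measure set T -> \bar R}).
Hypothesis mu1 : mu setT = 1%E.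

Definition probability_copy of mu setT = 1%E : set T -> \bar R := mu.
HB.instance Definition _ := Measure.copy (probability_copy mu1) mu.
HB.instance Definition _ :=
  @Measure_isProbability.Build d T R (probability_copy mu1) mu1.

Definition probability_of : probability T R := probability_copy mu1.

End probability_of.

Section pushforward_measure_of.
Context d1 d2 (T1 : measurableType d1) (T2 : measurableType d2) (R : realType).
Variables (f : T1 -> T2) (mf : measurable_fun setT f).
Variable mu : {measure set T1 -> \bar R}.

Definition pushforward_copy of measurable_fun setT f : set T2 -> \bar R := pushforward mu f.
Local Notation push := (pushforward_copy mf).

Let push0 : push set0 = 0%E.
Proof. by rewrite /pushforward_copy /pushforward preimage_set0 measure0. Qed.
Let push_ge0 A : (0 <= push A)%E.
Proof. exact: measure_ge0. Qed.
Let push_sigma_additive : semi_sigma_additive push.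
Proof.
pose F : {mfun T1 >-> T2} := HB.pack f (isMeasurableFun.Build _ _ _ _ f mf).
exact: (@measure_semi_sigma_additive _ _ _ (pushforward mu F : {measure set _ -> \bar R})).
Qed.
HB.instance Definition _ := isMeasure.Build _ _ _ push push0 push_ge0 push_sigma_additive.

Definition pushforward_of : {measure set T2 -> \bar R} := push.

Lemma ge0_integral_pushforward_of (g : T2 -> \bar R) : measurable_fun setT g ->
  (forall y, 0 <= g y)%E -> (\int[pushforward_of]_y g y = \int[mu]_x g (f x))%E.
Proof. by move=> mg g0; rewrite ge0_integral_pushforward. Qed.

End pushforward_measure_of.

Section density.
Context d (T : measurableType d) (R : realType) (mu : {measure set T -> \bar R}).
Variable h : T -> R.
Hypotheses (mh : measurable_fun setT h) (h0 : forall x, 0 <= h x).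

Definition density_copy of measurable_fun setT h & (forall x, 0 <= h x) :=
  fun A : set T => (\int[mu]_(x in A) (h x)%:E)%E.
Local Notation dens := (density_copy mh h0).
Let dens0 : dens set0 = 0%E. Proof. exact: integral_set0. Qed.
Let dens_ge0 A : (0 <= dens A)%E.
Proof. by apply: integral_ge0 => x _; rewrite lee_fin. Qed.
Let dens_sigma_additive : semi_sigma_additive dens.
Proof.
move=> F mF tF mUF; rewrite /density_copy ge0_integral_bigcup//; last 2 first.
- by apply: measurable_funTS; exact/measurable_EFinP.
- by move=> x _; rewrite lee_fin.
apply: is_cvg_ereal_nneg_natsum => n _.
exact: dens_ge0.
Qed.
HB.instance Definition _ := isMeasure.Build _ _ _ dens dens0 dens_ge0 dens_sigma_additive.

Definition density_measure : {measure set T -> \bar R} := dens.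

Import HBNNSimple.

(** On indicators this is the definition of the density measure; linearity gives it on simple
    functions and monotone convergence along [f_] in general. *)
Lemma ge0_integral_density (f : T -> \bar R) : measurable_fun setT f ->
  (forall x, 0 <= f x)%E ->
  (\int[density_measure]_x f x = \int[mu]_x (f x * (h x)%:E))%E.
Proof.
move=> mf f0.
have mhE : measurable_fun setT (EFin \o h) by exact/measurable_EFinP.
pose f_ := nnsfun_approx measurableT mf.
have f_cvg x : EFin (f_ n x) @[n --> \oo] --> f x.
  by apply: cvg_nnsfun_approx => // y _.
have f_nd x : {homo (fun n => (f_ n x)%:E) : n m / (n <= m)%N >-> (n <= m)%E}.
  move=> n m nm; rewrite lee_fin.
  by have /lefP/(_ x) := nd_nnsfun_approx measurableT mf nm.
have nnsf (n : nat) : (\int[density_measure]_x (f_ n x)%:E =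
    \int[mu]_x ((f_ n x)%:E * (h x)%:E))%E.
  under eq_integral do rewrite fimfunE -fsumEFin//.
  under [RHS]eq_integral => x _.
    rewrite fimfunE -fsumEFin//.
    rewrite ge0_mule_fsuml; last by move=> y; rewrite EFinM nnfun_muleindic_ge0.
    over.
  rewrite ge0_integral_fsum//; last 2 first.
  - by move=> y; apply/measurable_EFinP; exact: measurable_funM.
  - by move=> y x _; rewrite EFinM nnfun_muleindic_ge0.
  rewrite ge0_integral_fsum//; last 2 first.
  - move=> y; apply: emeasurable_funM => //.
    by apply/measurable_EFinP; exact: measurable_funM.
  - by move=> y x _; rewrite mule_ge0 ?lee_fin// -lee_fin EFinM nnfun_muleindic_ge0.
  apply: eq_fsbigr => r rfn.
  have r0 : 0 <= r by move: rfn; rewrite inE => -[t _ <-].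
  rewrite integralZl_indic_nnsfun// integral_indic// setIT.
  under [RHS]eq_integral do rewrite EFinM -muleA.
  rewrite ge0_integralZl//; last 2 first.
  - by apply: emeasurable_funM => //; apply/measurable_EFinP.
  - by move=> x _; rewrite mule_ge0 ?lee_fin.
  congr (_ * _)%E; rewrite /density_measure /= /density_copy integral_mkcond.
  apply: eq_integral => x _; rewrite patchE indicE; case: ifPn => _.
    by rewrite mul1e.
  by rewrite mul0e.
transitivity (limn (fun n => \int[density_measure]_x (f_ n x)%:E)%E).
  rewrite -monotone_convergence//.
  - by apply: eq_integral => x _; apply/esym/cvg_lim.
  - by move=> n; apply/measurable_EFinP.
  - by move=> n x _; rewrite lee_fin.
under [X in limn X]funext do rewrite nnsf.
rewrite -monotone_convergence//.
- apply: eq_integral => x _; apply/cvg_lim => //; apply: cvgeZr => //.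
- by move=> n; apply: emeasurable_funM => //; apply/measurable_EFinP.
- by move=> n x _; rewrite mule_ge0 ?lee_fin.
- by move=> x _ n m nm; rewrite lee_wpmul2r ?lee_fin//; have := f_nd x n m nm; rewrite lee_fin.
Qed.

End density.

Lemma countable_bigcup_null d (T : measurableType d) (R : realType)
    (mu : {measure set T -> \bar R}) (I : Type) (D : set I) (F : I -> set T) :
  countable D -> (forall i, D i -> measurable (F i)) ->
  (forall i, D i -> mu (F i) = 0%E) -> mu (\bigcup_(i in D) F i) = 0%E.
Proof.
move=> cD mF F0; have mU := bigcup_countable_measurable cD mF.
have [D0|/set0P D0] := eqVneq D set0; first by rewrite D0 bigcup_set0 measure0.
have [e De eD] := countable_range cD D0.
suff : mu.-negligible (\bigcup_(i in D) F i) by move/negligibleP; exact.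
have -> : \bigcup_(i in D) F i = \bigcup_n F (e n).
  apply/seteqP; split => x [i Di Fx]; last by exists (e i) => //; apply: eD; exists i.
  by have [n _ en] := De _ Di; exists n => //; rewrite en.
apply: negligible_bigcup => n; have De' : D (e n) by apply: eD; exists n.
by apply/negligibleP; [exact: mF|exact: F0].
Qed.

(** * Random walks *)

Section walk.
Context d (E : borelGroupType d) (R : realType).
Hypothesis cE : @second_countable E.
Variable v : probability E R.

(** The complement of the support is the union of the null open sets of a countable base. *)
Lemma support_null : v (~` support_of v) = 0%E.
Proof.
have [B cB [Bo Bb]] := cE.
have -> : ~` support_of v = \bigcup_(b in [set b | B b /\ v b = 0%E]) b.
  apply/seteqP; split => x.
    move=> /existsNP[U /not_implyP[oU /not_implyP[Ux]]] /negP.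
    rewrite -leNgt measure_le0 => /eqP vU.
    have [b [Bb' bx] bU] := Bb x U (open_nbhs_nbhs (conj oU Ux)).
    exists b => //; split => //; apply/eqP; rewrite -measure_le0 -vU.
    by apply: le_measure => //; rewrite inE; apply: borel_open => //; exact: Bo.
  move=> [b [Bb' vb] bx] /(_ b (Bo _ Bb') bx).
  by rewrite lt0e => /andP[/eqP + _]; apply.
apply: countable_bigcup_null => [|b [Bb' _]|b []//].
  by apply: sub_countable cB; apply: subset_card_le => ? [].
by apply: borel_open; exact: Bo.
Qed.

Lemma lmulg_measurable (x : E) : measurable_fun setT (fun y : E => (x * y)%g).
Proof.
apply: measurable_continuous => U oU; apply: borel_open.
by apply: open_comp => // y _; exact: lmulg_continuous.
Qed.

Lemma rmulg_measurable (x : E) : measurable_fun setT (fun y : E => (y * x)%g).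
Proof.
apply: measurable_continuous => U oU; apply: borel_open.
by apply: open_comp => // y _; exact: rmulg_continuous.
Qed.

Lemma measurable_preimage d1 d2 (T1 : measurableType d1) (T2 : measurableType d2)
    (f : T1 -> T2) (A : set T2) :
  measurable_fun setT f -> measurable A -> measurable (f @^-1` A).
Proof. by move=> mf mA; rewrite -[X in measurable X]setTI; exact: mf. Qed.

(** [conv_power] is a bare set function. The induction produces an actual measure, the image of
    [v \x m] under multiplication, because the formula for iterates needs Tonelli at each step. *)
Lemma conv_power_measure n : exists m : probability E R,
  (forall A, measurable A -> conv_power v n A = m A) /\
  forall (F : E -> \bar R) x, measurable_fun setT F -> (forall y, 0 <= F y)%E ->
    iter n (walk_op v) F x = (\int[m]_y F (x * y)%g)%E.
Proof.
elim: n => [|n [m [mc mi]]].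
  exists (\d_(1%g : E) : probability E R); split => // F x mF F0 /=.
  rewrite integral_dirac//; last exact: measurableT_comp mF (lmulg_measurable x).
  by rewrite diracT mul1e mulg1.
have mm := measurable_mulg cE.
pose p := pushforward_of mm (v \x m)%E.
have p1 : p setT = 1%E.
  rewrite /p /pushforward_of /= /pushforward preimage_setT.
  have v1 : v setT = 1%E by exact: probability_setT.
  have m1 : m setT = 1%E by exact: probability_setT.
  have : (v \x m)%E ([set: E] `*` [set: E]) = (v setT * m setT)%E.
    exact: product_measure1E.
  by rewrite setXTT v1 m1 mule1; apply.
exists (probability_of p1); split.
  move=> A mA; rewrite /conv_power iterS -/(conv_power v n) /convolution.
  rewrite /probability_of /p /pushforward_of /= /pushforward /product_measure1.
  apply: eq_integral => y _; rewrite mc /=; last first.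
    by apply: measurable_preimage => //; exact: lmulg_measurable.
  by congr (m _); apply/seteqP; split => z /=; [move=> ?; apply/xsectionP|move/xsectionP].
move=> F x mF F0.
have mFx : measurable_fun setT (fun y => F (x * y)%g).
  exact: measurableT_comp mF (lmulg_measurable x).
rewrite (_ : \int[probability_of p1]_y F (x * y)%g = \int[p]_y F (x * y)%g)%E//.
rewrite ge0_integral_pushforward_of// fubini_tonelli1//; last exact: (measurableT_comp mFx mm).
apply: eq_integral => y _.
rewrite -[LHS]/(iter n (walk_op v) F (x * y)%g) mi//.
by rewrite /fubini_F; apply: eq_integral => z _ /=; rewrite mulgA.
Qed.

Lemma ge0_measurable_iter_walk n (F : E -> \bar R) : measurable_fun setT F ->
  (forall y, 0 <= F y)%E -> measurable_fun setT (iter n (walk_op v) F) /\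
  forall y, (0 <= iter n (walk_op v) F y)%E.
Proof.
move=> mF F0; elim: n => // n [mi i0]; rewrite iterS; split.
  apply: (@measurable_fun_fubini_tonelli_F _ _ E E R v
    (fun p => iter n (walk_op v) F (p.1 * p.2)%g)) => //.
  exact: measurableT_comp mi (measurable_mulg cE).
by move=> y; apply: integral_ge0.
Qed.

Lemma walk_op_le (F G : E -> \bar R) : measurable_fun setT F ->
  measurable_fun setT G -> (forall y, 0 <= F y)%E -> (forall y, F y <= G y)%E ->
  forall x, (walk_op v F x <= walk_op v G x)%E.
Proof.
move=> mF mG F0 FG x; apply: ge0_le_integral => //.
  exact: measurableT_comp mF (lmulg_measurable x).
exact: measurableT_comp mG (lmulg_measurable x).
Qed.

Lemma iter_walk_le n (F G : E -> \bar R) : measurable_fun setT F ->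
  measurable_fun setT G -> (forall y, 0 <= F y)%E -> (forall y, F y <= G y)%E ->
  forall x, (iter n (walk_op v) F x <= iter n (walk_op v) G x)%E.
Proof.
move=> mF mG F0 FG; elim: n => // n ih x; rewrite !iterS.
have G0 y : (0 <= G y)%E by exact: le_trans (FG y).
have [mFn Fn0] := ge0_measurable_iter_walk n mF F0.
have [mGn _] := ge0_measurable_iter_walk n mG G0.
exact: walk_op_le.
Qed.

(* A lower bound of P^n 1_A by a measure of A extends from sets to functions. *)
Lemma measure_le_iter_walk n x (rho : {measure set E -> \bar R}) :
  (forall A, measurable A -> (rho A <= walk_iter v n (\1_A) x)%E) ->
  forall F : E -> \bar R, measurable_fun setT F -> (forall y, 0 <= F y)%E ->
  (\int[rho]_y F y <= iter n (walk_op v) F x)%E.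
Proof.
move=> H F mF F0; have [m [_ mi]] := conv_power_measure n.
rewrite mi// -(ge0_integral_pushforward_of (lmulg_measurable x))//.
apply: ge0_le_measure_integral => // A mA; apply: le_trans (H _ mA) _.
have mA1 : measurable_fun setT (EFin \o (\1_A : E -> R)) by apply/measurable_EFinP.
rewrite /walk_iter mi//; last by move=> y; rewrite lee_fin.
rewrite -(ge0_integral_pushforward_of (lmulg_measurable x))//; last first.
  by move=> y; rewrite lee_fin.
by rewrite integral_indic// setIT.
Qed.

Hypothesis hE : hausdorff_space E.
Hypothesis cS : compact (support_of v).
Let S := support_of v.

Let mS : measurable S. Proof. exact: borel_compact. Qed.

Lemma integral_support (f : E -> R) : continuous f ->
  (\int[v]_y (f y)%:E = (\int[v]_(y in S) f y)%:E)%E.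
Proof.
move=> fc; have mf := measurable_continuousR fc.
have vS0 : v (~` S) = 0%E := support_null.
have vK : finite_on_compacts v.
  move=> K cK; apply: le_lt_trans (ltry 1).
  by apply: probability_le1; exact: borel_compact.
have iS : v.-integrable S (EFin \o f) by exact: (integrable_continuous hE vK cS).
have SE : [set: E] `\` ~` S = S by rewrite setTD setCK.
have iT : v.-integrable setT (EFin \o f).
  apply/(negligible_integrable (measurableC mS)) => //; last by rewrite SE.
  exact/measurable_EFinP.
rewrite (negligible_integral (measurableC mS))// SE fineK//.
exact: integrable_fin_num.
Qed.

(** On the compact support every continuous integrand is bounded, so the real-valued operator acts
    on all continuous functions, including unbounded ones such as phi. *)
Definition walk_opR (f : E -> R) (x : E) : R := \int[v]_(y in S) f (x * y)%g.

Lemma walk_opRE (f : E -> R) : continuous f ->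
  walk_op v (EFin \o f) = EFin \o walk_opR f.
Proof.
move=> fc; apply/funext => x; rewrite /walk_op /=.
apply: (@integral_support (fun y => f (x * y)%g)) => y.
by apply: (@continuous_comp _ _ _ (fun y => (x * y)%g) f);
  [exact: lmulg_continuous|exact: fc].
Qed.

End walk.

(** * Haar measure *)

Section cc_group.
Context d (E : borelGroupType d) (R : realType).
Implicit Types f g : E -> R.

Lemma cc_comp f (tau sigma : E -> E) : continuous tau -> continuous sigma ->
  cancel tau sigma -> cc f -> cc (f \o tau).
Proof.
move=> tc sc ts [fc [K cK fK]]; split.
  by move=> x; apply: continuous_comp; [exact: tc|exact: fc].
exists (sigma @` K); first by apply: continuous_compact => //; exact: continuous_subspaceT.
by move=> x nx; apply: fK => Kx; apply: nx; exists (tau x).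
Qed.

Lemma cc_lmul f x : cc f -> cc (fun z => f (x * z)%g).
Proof.
apply: (@cc_comp f (fun z => x * z)%g (fun z => x^-1 * z)%g).
- exact: lmulg_continuous.
- exact: lmulg_continuous.
- exact: mulKg.
Qed.

Lemma cc_rmul f x : cc f -> cc (fun z => f (z * x)%g).
Proof.
apply: (@cc_comp f (fun z => z * x)%g (fun z => z * x^-1)%g).
- exact: rmulg_continuous.
- exact: rmulg_continuous.
- exact: mulgK.
Qed.

Lemma cc_inv f : cc f -> cc (fun z => f (z^-1)%g).
Proof.
apply: (@cc_comp f (fun z => z^-1)%g (fun z => z^-1)%g).
- exact: invg_continuous.
- exact: invg_continuous.
- exact: invgK.
Qed.

Lemma compact_mulg (K L : set E) : compact K -> compact L ->
  compact [set (p.1 * p.2)%g | p in K `*` L].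
Proof.
move=> cK cL; apply: continuous_compact; last exact: compact_setX.
by apply: continuous_subspaceT; exact: mulg_continuous.
Qed.

Lemma compact_invg (K : set E) : compact K -> compact [set (x^-1)%g | x in K].
Proof.
move=> cK; apply: continuous_compact => //.
by apply: continuous_subspaceT; exact: invg_continuous.
Qed.

End cc_group.

Section radon_integral.
Context d (E : borelGroupType d) (R : realType).
Hypothesis hE : hausdorff_space E.
Variable mu : {measure set E -> \bar R}.
Hypothesis muK : finite_on_compacts mu.
Implicit Types f g : E -> R.

Lemma Rintegral_cc f K : (forall x, ~ K x -> f x = 0) ->
  \int[mu]_x f x = \int[mu]_(x in K) f x.
Proof.
move=> fK; rewrite [RHS]Rintegral_mkcond; apply: eq_Rintegral => x _.
by rewrite patchE; case: ifPn => // /negP; rewrite inE => /fK.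
Qed.

Lemma integrable_cc f : cc f -> mu.-integrable setT (EFin \o f).
Proof.
move=> [fc [K cK fK]].
have iK := integrable_continuous hE muK cK fc (borel_compact hE cK) (@subset_refl _ K).
apply/integrableP; split; first by apply/measurable_EFinP; exact: measurable_continuousR.
have /integrableP[_] := iK; rewrite integral_mkcond; congr (_ < _)%E.
apply: eq_integral => x _; rewrite patchE; case: ifPn => // /negP.
by rewrite inE => /fK /= ->; rewrite normr0.
Qed.

Lemma Rintegral_cc_fin f : cc f -> (\int[mu]_x (f x)%:E = (\int[mu]_x f x)%:E)%E.
Proof.
by move=> cf; rewrite fineK//; apply: integrable_fin_num => //; exact: integrable_cc.
Qed.

Lemma positive_linear_radon : positive_linear (@cc E R) (fun f => \int[mu]_x f x).
Proof.
split=> [f g a cf cg|f cf f0]; last exact: Rintegral_ge0.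
have iaf : mu.-integrable setT (EFin \o (fun x => a * f x)).
  apply: integrable_cc; exact: (linear_classZ (@linear_class_cc E R)).
by rewrite RintegralD ?RintegralZl//; exact: integrable_cc.
Qed.

End radon_integral.

Section haar.
Context d (E : borelGroupType d) (R : realType).
Hypothesis hE : hausdorff_space E.
Hypothesis lE : locally_compact [set: E].
Hypothesis cE : @second_countable E.
Hypothesis uE : unimodular E R.
Variable pi : {measure set E -> \bar R}.
Hypothesis piP : right_haar_measure pi.
Implicit Types f g : E -> R.

Lemma haar_finite : finite_on_compacts pi. Proof. by case: piP. Qed.

Lemma haarR (x : E) A : measurable A -> pi ((fun z => (z * x)%g) @^-1` A) = pi A.
Proof.
move=> mA; have [_ _ H] := piP; rewrite -(H (x^-1)%g A mA); congr (pi _).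
apply/seteqP; split => z /= => [Az|[y Ay <-]]; last by rewrite mulgVK.
by exists (z * x)%g => //; rewrite mulgK.
Qed.

Lemma haarL (x : E) A : measurable A -> pi ((fun z => (x * z)%g) @^-1` A) = pi A.
Proof.
move=> mA; have [_ _ H] := (uE pi).1 piP; rewrite -(H (x^-1)%g A mA); congr (pi _).
apply/seteqP; split => z /= => [Az|[y Ay <-]]; last by rewrite mulVKg.
by exists (x * z)%g => //; rewrite mulKg.
Qed.

Lemma ge0_haar_integralR (F : E -> \bar R) x : measurable_fun setT F ->
  (forall z, 0 <= F z)%E -> (\int[pi]_z F (z * x)%g = \int[pi]_z F z)%E.
Proof.
move=> mF F0; rewrite -(ge0_integral_pushforward_of (rmulg_measurable x))//.
by apply: eq_measure_integral => A mA _; exact: haarR.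
Qed.

Lemma ge0_haar_integralL (F : E -> \bar R) x : measurable_fun setT F ->
  (forall z, 0 <= F z)%E -> (\int[pi]_z F (x * z)%g = \int[pi]_z F z)%E.
Proof.
move=> mF F0; rewrite -(ge0_integral_pushforward_of (lmulg_measurable x))//.
by apply: eq_measure_integral => A mA _; exact: haarL.
Qed.

Let split_pm f : f = fun x => 1 * Num.max (f x) 0 - Num.max (- f x) 0.
Proof.
apply/funext => x; rewrite mul1r; have /orP[f0|f0] := le_total 0 (f x).
  by rewrite (max_l f0) max_r ?subr0// oppr_le0.
by rewrite (max_r f0) max_l ?oppr_ge0// sub0r opprK.
Qed.

Let cc_max f : cc f -> cc (fun x => Num.max (f x) 0).
Proof.
move=> [fc [K cK fK]]; split.
  by move=> x; apply: (@continuous_max _ _ f (fun=> 0)); [exact: fc|exact: cvg_cst].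
by exists K => // x /fK ->; rewrite maxxx.
Qed.

Let haar_reduce f (tau : E -> E) :
  (forall g, cc g -> cc (g \o tau)) ->
  (forall F : E -> \bar R, measurable_fun setT F -> (forall z, 0 <= F z)%E ->
    (\int[pi]_z F (tau z) = \int[pi]_z F z)%E) ->
  cc f -> \int[pi]_z f (tau z) = \int[pi]_z f z.
Proof.
move=> ctau H cf.
have ge0 g : cc g -> (forall x, 0 <= g x) -> \int[pi]_z g (tau z) = \int[pi]_z g z.
  move=> cg g0; rewrite /Rintegral (H (EFin \o g))//.
    by apply/measurable_EFinP; exact: measurable_continuousR cg.1.
have cfp := cc_max cf.
have cfn : cc (fun x => Num.max (- f x) 0).
  apply: cc_max; have := linear_classZ (@linear_class_cc E R) (-1) cf.
  by congr cc; apply/funext => x; rewrite mulN1r.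
have lp := positive_linear_radon hE haar_finite.
have mx0 (a : R) : 0 <= Num.max a 0 by rewrite le_max lexx orbT.
have fE : f = fun x => Num.max (f x) 0 - Num.max (- f x) 0.
  by rewrite [LHS](split_pm f); apply/funext => x; rewrite mul1r.
rewrite fE; apply: etrans (plinB lp (ctau _ cfp) (ctau _ cfn)) _.
apply: etrans _ (esym (plinB lp cfp cfn)).
by congr (_ - _); exact: ge0.
Qed.

Lemma haar_RintegralR f x : cc f -> \int[pi]_z f (z * x)%g = \int[pi]_z f z.
Proof.
apply: (@haar_reduce f (fun z => z * x)%g) => [g|F]; first exact: cc_rmul.
exact: ge0_haar_integralR.
Qed.

Lemma haar_RintegralL f x : cc f -> \int[pi]_z f (x * z)%g = \int[pi]_z f z.
Proof.
apply: (@haar_reduce f (fun z => x * z)%g) => [g|F]; first exact: cc_lmul.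
exact: ge0_haar_integralL.
Qed.

(** If U were null, so would be its right translates; these contain basic open sets around every
    point, and countably many null basic sets would cover E. *)
Lemma haar_open_gt0 U : open U -> U !=set0 -> (0 < pi U)%E.
Proof.
move=> oU [u Uu]; rewrite lt0e measure_ge0 andbT; apply/eqP => U0.
have [pi0 _ _] := piP; have [B cB [Bo Bb]] := cE.
have : pi (\bigcup_(b in [set b | B b /\ pi b = 0%E]) b) = 0%E.
  apply: countable_bigcup_null => [|b [Bb' _]|b []//].
    by apply: sub_countable cB; apply: subset_card_le => ? [].
  by apply: borel_open; exact: Bo.
suff -> : \bigcup_(b in [set b | B b /\ pi b = 0%E]) b = setT.
  by move=> piT; rewrite piT ltxx in pi0.
apply/seteqP; split => // x _; pose V := (fun z => (z * (x^-1 * u))%g) @^-1` U.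
have oV : open V by apply: open_comp => // y _; exact: rmulg_continuous.
have Vx : V x by rewrite /V /= mulgA mulgV mul1g.
have [b [Bb' bx] bV] := Bb x V (open_nbhs_nbhs (conj oV Vx)).
exists b => //; split => //; apply/eqP; rewrite -measure_le0 -U0.
rewrite -(haarR (x^-1 * u)%g (borel_open oU)).
by apply: le_measure => //; rewrite inE; apply: borel_open => //; exact: Bo.
Qed.

Lemma haar_cc_gt0 f : cc f -> (forall x, 0 <= f x) -> (exists x, 0 < f x) ->
  0 < \int[pi]_z f z.
Proof.
move=> cf f0 [x fx]; have f2 : 0 < f x / 2 by rewrite divr_gt0.
have nU : nbhs x [set y | `|f x - f y| <= f x / 2].
  by have /cvgrPdist_le/(_ _ f2) := cf.1 x.
move: nU; rewrite nbhsE => -[U [oU Ux] Uf].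
rewrite -lte_fin -Rintegral_cc_fin//; last exact: haar_finite.
have mf : measurable_fun setT (EFin \o f).
  by apply/measurable_EFinP; exact: measurable_continuousR cf.1.
apply: (@lt_le_trans _ _ (\int[pi]_(z in U) (f x / 2)%:E)%E); last first.
  apply: (@le_trans _ _ (\int[pi]_(z in U) (f z)%:E)%E).
    apply: ge0_le_integral => //.
    - exact: borel_open.
    - by move=> z _; rewrite lee_fin ltW.
    - exact: measurable_funTS.
    - by move=> z /Uf /= /ler_normlP[_]; rewrite lee_fin; lra.
  apply: ge0_subset_integral => //; first exact: borel_open.
  by move=> z _; rewrite lee_fin.
rewrite integral_cst; last exact: borel_open.
by rewrite mule_gt0// haar_open_gt0//; exists x.
Qed.

Lemma radon_sigma_finite (mu : {measure set E -> \bar R}) :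
  finite_on_compacts mu -> sigma_finite setT mu.
Proof.
move=> muK; have [K [cK KT]] := sigma_compact lE cE.
by exists K => // n; split; [exact: borel_compact|exact: muK].
Qed.

End haar.

Lemma positive_linear_cc (T : topologicalType) (R : realType) l :
  positive_linear (fun f : T -> R => continuous f) l -> positive_linear (@cc T R) l.
Proof.
by move=> [ll lp]; split=> [f g a [fc _] [gc _]|f [fc _]]; [exact: ll|exact: lp].
Qed.

Lemma cvg_near_eq (R : realType) (u u' : nat -> R) (l : R) :
  (\forall n \near \oo, u n = u' n) -> u n @[n --> \oo] --> l ->
  u' n @[n --> \oo] --> l.
Proof.
move=> uu' /cvgrPdist_le ul; apply/cvgrPdist_le => e e0.
near=> n; have <- : u n = u' n by near: n.
by near: n; exact: ul.
Unshelve. all: by end_near. Qed.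

(** The image filter clusters in the compact segment [-C, C], and an ultrafilter turns a cluster
    point into a limit. *)
Lemma ultra_bounded_cvg (R : realType) (U : set_system nat) (u : nat -> R) (C : R) :
  UltraFilter U -> (\forall n \near U, `|u n| <= C) ->
  exists p : R, u n @[n --> U] --> p.
Proof.
move=> UU uC; have FI : (u @ U) `[-C, C]%classic.
  by apply: filterS uC => n; rewrite ler_norml /= in_itv.
have [p [_ clp]] := @segment_compact R (- C) C (u @ U) _ FI.
exists p; apply/cvgrPdist_lt => e e0.
have [//|h] := in_ultra_setVsetC [set n | `|p - u n| < e] UU.
have nB : nbhs p [set y | `|p - y| < e] by exact: nbhsx_ballx.
by have [y []] := clp [set y | ~ (`|p - y| < e)] _ h nB.
Qed.

(** * The tilted walk *)

Section tilted_walk.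
Context d (E : borelGroupType d) (R : realType).
Hypothesis hE : hausdorff_space E.
Hypothesis lE : locally_compact [set: E].
Hypothesis cE : @second_countable E.
Variable v : probability E R.
Hypothesis cS : compact (support_of v).
Variables (r : R) (phi : E -> R).
Hypothesis r0 : 0 < r.
Hypothesis phi_exp : exponential phi.
Hypothesis phi_cont : continuous phi.
Hypothesis phi_v : (\int[v]_x (phi x)%:E = (r^-1)%:E)%E.
Local Notation S := (support_of v).
Local Notation P := (walk_opR v).
Local Notation cts := (fun f : E -> R => continuous f).
Implicit Types f g : E -> R.

Definition tilted (f : E -> R) (x : E) : R :=
  \int[v]_(y in S) (f (x * y)%g * (r * phi y)).

Local Notation Q := tilted.

Lemma exponential_gt0 x : 0 < phi x. Proof. by case: phi_exp. Qed.

Lemma exponentialM x y : phi (x * y)%g = phi x * phi y. Proof. by case: phi_exp. Qed.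

Lemma exponential1 : phi 1%g = 1.
Proof.
have : phi (1 * 1)%g = phi 1%g * phi 1%g by exact: exponentialM.
by rewrite mulg1 -{1}[phi _]mulr1 => /(mulfI (lt0r_neq0 (exponential_gt0 _))).
Qed.

Lemma exponentialV x : phi (x^-1)%g = (phi x)^-1.
Proof.
have : phi (x^-1 * x)%g = phi (x^-1)%g * phi x by exact: exponentialM.
rewrite mulVg exponential1 => h; apply: (mulIf (lt0r_neq0 (exponential_gt0 x))).
by rewrite -h mulVf// gt_eqF// exponential_gt0.
Qed.

Lemma weight_gt0 y : 0 < r * phi y. Proof. by rewrite mulr_gt0// exponential_gt0. Qed.

Lemma weight_continuous : continuous (fun y => r * phi y).
Proof. by move=> y; apply: cvgM; [exact: cvg_cst|exact: phi_cont]. Qed.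

Lemma walk_finite : finite_on_compacts v.
Proof.
move=> K cK; apply: le_lt_trans (ltry 1).
by apply: probability_le1; exact: borel_compact.
Qed.

Let mS : measurable S. Proof. exact: borel_compact. Qed.

Lemma tilted_kernel f : continuous f ->
  continuous (fun p : E * E => f (p.1 * p.2)%g * (r * phi p.2)).
Proof.
move=> fc p; apply: cvgM.
  apply: (@continuous_comp _ _ _ (fun p : E * E => (p.1 * p.2)%g) f);
    [exact: mulg_continuous|exact: fc].
apply: (@continuous_comp _ _ _ (fun p : E * E => p.2) (fun y => r * phi y));
  [exact: cvg_snd|exact: weight_continuous].
Qed.

Lemma tilted_slice f x : continuous f ->
  continuous (fun y => f (x * y)%g * (r * phi y)).
Proof.
move=> fc.
exact: (@continuous_slice R E E (fun x y => f (x * y)%g * (r * phi y)) x (tilted_kernel fc)).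
Qed.

Lemma tilted_operator : positive_operator cts Q.
Proof.
split=> [f fc|x].
  exact: (continuous_Rintegral hE walk_finite cS (tilted_kernel fc)).
split=> [f g a fc gc|f fc f0]; rewrite /Q.
  rewrite -(Rintegral_lin hE walk_finite cS)//; try exact: tilted_slice.
  by apply: eq_Rintegral => y _; ring.
by apply: Rintegral_ge0 => y _; rewrite mulr_ge0// ltW// weight_gt0.
Qed.

Lemma integral_weight : \int[v]_(y in S) (r * phi y) = 1.
Proof.
have := integral_support cE hE cS weight_continuous.
under eq_integral do rewrite EFinM.
rewrite ge0_integralZl//; last 3 first.
- by apply/measurable_EFinP; exact: measurable_continuousR.
- by move=> y _; rewrite lee_fin ltW// exponential_gt0.
- by rewrite lee_fin ltW.
rewrite phi_v -EFinM mulfV ?gt_eqF// => h.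
by apply/eqP; rewrite -eqe; apply/eqP.
Qed.

Lemma tilted1 : Q (fun=> 1) = fun=> 1.
Proof.
apply/funext => x; rewrite /Q -[RHS]integral_weight.
by apply: eq_Rintegral => y _; rewrite mul1r.
Qed.

Lemma iter_tilted_operator n : positive_operator cts (iter n Q).
Proof. by apply: pop_iter; exact: tilted_operator. Qed.

Lemma iter_tilted1 n : iter n Q (fun=> 1) = fun=> 1.
Proof. by elim: n => //= n ->; exact: tilted1. Qed.

Lemma tilted_cc f : cc f -> cc (Q f).
Proof.
move=> [fc [K cK fK]]; split; first exact: tilted_operator.1.
exists [set (p.1 * p.2)%g | p in K `*` [set (x^-1)%g | x in S]].
  by apply: compact_mulg => //; exact: compact_invg.
move=> x nx; rewrite /Q; under eq_Rintegral => y yS.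
  rewrite fK; first by rewrite mul0r; over.
  move=> Kxy; apply: nx; exists (x * y, y^-1)%g => /=; last by rewrite mulgK.
  by split => //; exists y => //; exact: set_mem.
by rewrite Rintegral_cst// mul0r.
Qed.

Lemma iter_tilted_cc n f : cc f -> cc (iter n Q f).
Proof. by move=> cf; elim: n => //= n; exact: tilted_cc. Qed.

Lemma iter_tilted_plin n x : positive_linear (@cc E R) (fun f => iter n Q f x).
Proof. by apply: positive_linear_cc; exact: (iter_tilted_operator n).2. Qed.

Lemma mul_phi_continuous f : continuous f -> continuous (fun z => phi z * f z).
Proof. by move=> fc z; apply: cvgM; [exact: phi_cont|exact: fc]. Qed.

Lemma exponentialV_continuous : continuous (fun z => (phi z)^-1).
Proof. by move=> z; apply: cvgV; [rewrite gt_eqF// exponential_gt0|exact: phi_cont]. Qed.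

Lemma walk_tilted f x : continuous f ->
  P (fun z => phi z * f z) x = r^-1 * (phi x * Q f x).
Proof.
move=> fc; rewrite mulrA -RintegralZl//; last first.
  exact: (@integrable_continuous _ _ _ hE _ walk_finite _ cS (fun y => f (x * y)%g * (r * phi y)) _ (tilted_slice fc)).
apply: eq_Rintegral => y _; rewrite exponentialM; field; rewrite gt_eqF//.
Qed.

Lemma iter_walk_tilted n f : continuous f ->
  iter n P (fun z => phi z * f z) = fun x => r ^- n * (phi x * iter n Q f x).
Proof.
move=> fc; elim: n => [|n ih] /=; first by apply/funext => x; rewrite expr0 invr1 mul1r.
rewrite ih; apply/funext => x.
have cQ : continuous (iter n Q f) by exact: (iter_tilted_operator n).1.
have -> : (fun x => r ^- n * (phi x * iter n Q f x)) =
    fun z => phi z * (r ^- n * iter n Q f z) by apply/funext => z; ring.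
have cQ' : continuous (fun z => r ^- n * iter n Q f z).
  by move=> z; apply: cvgM; [exact: cvg_cst|exact: cQ].
rewrite walk_tilted//.
rewrite (plinZ (@linear_class_continuous E R) (tilted_operator.2 x))//.
by rewrite exprS invfM; ring.
Qed.

Lemma walk_iterE n f : continuous f ->
  walk_iter v n f = EFin \o iter n P f /\ continuous (iter n P f).
Proof.
move=> fc; elim: n => // n [ih ic]; rewrite -[walk_iter _ _ _]/(walk_op v (walk_iter v n f)) ih.
split; first exact: walk_opRE.
set g := iter n P f in ic *.
have gE : g = fun z => phi z * ((phi z)^-1 * g z).
  by apply/funext => z; rewrite mulrA mulfV ?mul1r// gt_eqF// exponential_gt0.
have gc : continuous (fun z => (phi z)^-1 * g z).
  by move=> z; apply: cvgM; [exact: exponentialV_continuous|exact: ic].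
rewrite iterS -/g gE => x.
rewrite (_ : P _ = fun x => r^-1 * (phi x * Q (fun z => (phi z)^-1 * g z) x)).
  apply: cvgM; first exact: cvg_cst.
  by apply: mul_phi_continuous; exact: tilted_operator.1.
by apply/funext => z; rewrite walk_tilted.
Qed.

Lemma walk_iter_tilted n f x : continuous f ->
  walk_iter v n f x = (r ^- n * (phi x * iter n Q (fun z => (phi z)^-1 * f z) x))%:E.
Proof.
move=> fc; rewrite (walk_iterE n fc).1 /=; congr EFin.
have gc : continuous (fun z => (phi z)^-1 * f z).
  by move=> z; apply: cvgM; [exact: exponentialV_continuous|exact: fc].
rewrite -[RHS]/((fun x => r ^- n * (phi x * iter n Q _ x)) x) -iter_walk_tilted//.
congr (iter n P _ x); apply/funext => z.
by rewrite mulrA mulfV ?mul1r// gt_eqF// exponential_gt0.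
Qed.

(** Increments multiply on the right, hence left translations commute with Q. This brings values at
    arbitrary points back to values at 1. *)
Lemma iter_tilted_transl n f a x : iter n Q (fun z => f (a * z)%g) x = iter n Q f (a * x)%g.
Proof.
elim: n x => //= n ih x; rewrite /Q; apply: eq_Rintegral => y _.
by rewrite -/Q ih mulgA.
Qed.

Section haar.
Variable pi : {measure set E -> \bar R}.
Hypothesis uE : unimodular E R.
Hypothesis piP : right_haar_measure pi.
Hypothesis hypA : forall f : E -> R, continuous_compact_support f ->
      (forall x, 0 <= f x) ->
      exists gamma : R, exists j : nat, [/\ 0 < gamma, (1 <= j)%N &
        forall A, measurable A ->
          (gamma%:E * \int[pi]_(x in A) (f x)%:E <= conv_power v j A)%E].

(** Assumption (A) is applied to phi^-1 chi, since tilting multiplies the density of v^j by r^j phi;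
    this is also the origin of c = r^j gamma. The bound at 1 reaches x by left translation. *)
Lemma tilted_minorization (chi : E -> R) : cc chi -> (forall x, 0 <= chi x) ->
  exists c : R, exists2 j : nat, 0 < c &
    forall F : E -> R, continuous F -> (forall x, 0 <= F x) ->
    forall x, c * \int[pi]_y (F (x * y)%g * chi y) <= iter j Q F x.
Proof.
move=> cchi chi0; pose f0 z := (phi z)^-1 * chi z.
have cf0 : cc f0 by apply: ccMl => //; exact: exponentialV_continuous.
have f00 z : 0 <= f0 z by rewrite mulr_ge0// invr_ge0 ltW// exponential_gt0.
have [|gam [j [g0 j1 H]]] := hypA (f := f0) _ f00; first exact/ccP.
exists (r ^+ j * gam), j; first by rewrite mulr_gt0// exprn_gt0.
move=> F Fc F0 x; pose h z := gam * f0 z.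
have h0 z : 0 <= h z by rewrite mulr_ge0// ltW.
have mh : measurable_fun setT h.
  by apply: measurable_funM => //; exact: measurable_continuousR cf0.1.
pose G z := phi (x * z)%g * F (x * z)%g.
have Gc : continuous G.
  move=> z; apply: (@continuous_comp _ _ _ (fun z => (x * z)%g) (fun z => phi z * F z)).
    exact: lmulg_continuous.
  exact: mul_phi_continuous.
have G0 z : 0 <= G z by rewrite mulr_ge0// ltW// exponential_gt0.
have mG : measurable_fun setT (EFin \o G).
  by apply/measurable_EFinP; exact: measurable_continuousR.
have rho_le A : measurable A -> (density_measure pi mh h0 A <= walk_iter v j (\1_A) 1%g)%E.
  move=> mA; have [m [mc mi]] := conv_power_measure cE v j.
  apply: (@le_trans _ _ (conv_power v j A)).
    apply: le_trans (H _ mA).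
    have mf0 : measurable_fun A (EFin \o f0).
      apply: measurable_funTS; apply/measurable_EFinP.
      exact: measurable_continuousR cf0.1.
    rewrite -(ge0_integralZl _ mA mf0) ?lee_fin ?(ltW g0)//.
      by move=> z _; rewrite lee_fin.
  rewrite mc// /walk_iter mi//; last 2 first.
  - by apply/measurable_EFinP.
  - by move=> y; rewrite lee_fin.
  under eq_integral do rewrite mul1g.
  by rewrite integral_indic// setIT.
have G0E z : (0 <= (EFin \o G) z)%E by rewrite lee_fin.
have := measure_le_iter_walk cE rho_le mG G0E.
rewrite ge0_integral_density//.
have -> : iter j (walk_op v) (EFin \o G) 1%g = (r ^- j * (phi x * iter j Q F x))%:E.
  apply: etrans (walk_iter_tilted j 1%g Gc) _; congr (_ * _)%:E.
  have -> : (fun z => (phi z)^-1 * G z) = fun z => phi x * F (x * z)%g.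
    apply/funext => z; rewrite /G exponentialM; field.
    by rewrite gt_eqF// exponential_gt0.
  have Fxc : continuous (fun z => F (x * z)%g).
    move=> z; apply: (@continuous_comp _ _ _ (fun z => (x * z)%g) F);
      [exact: lmulg_continuous|exact: Fc].
  rewrite (plinZ (@linear_class_continuous E R) ((iter_tilted_operator j).2 1%g))//.
  by rewrite iter_tilted_transl mulg1 exponential1 mul1r.
have cck : cc (fun y => F (x * y)%g * chi y).
  apply: ccMl => // z; apply: (@continuous_comp _ _ _ (fun z => (x * z)%g) F);
    [exact: lmulg_continuous|exact: Fc].
have -> : (\int[pi]_y ((EFin \o G) y * (h y)%:E) =
   (gam * phi x * \int[pi]_y (F (x * y)%g * chi y))%:E)%E.
  rewrite EFinM -Rintegral_cc_fin//; last exact: haar_finite piP.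
  rewrite -ge0_integralZl//; last 3 first.
  - by apply/measurable_EFinP; exact: measurable_continuousR cck.1.
  - by move=> y _; rewrite lee_fin mulr_ge0.
  - by rewrite lee_fin mulr_ge0// ltW// exponential_gt0.
  apply: eq_integral => y _; rewrite -!EFinM; congr EFin.
  rewrite /= /G /h /f0 exponentialM; field.
  by rewrite gt_eqF// exponential_gt0.
rewrite lee_fin => h1.
rewrite -(ler_pM2l (_ : 0 < r ^- j * phi x)); last first.
  by rewrite mulr_gt0 ?invr_gt0 ?exprn_gt0// exponential_gt0.
rewrite -[leRHS]mulrA; apply: le_trans h1.
rewrite le_eqVlt; apply/orP; left; apply/eqP; field.
by rewrite expf_neq0// gt_eqF.
Qed.

Let piK : finite_on_compacts pi. Proof. exact: haar_finite piP. Qed.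
Let ccE := @linear_class_cc E R.
Let ctsE := @linear_class_continuous E R.
Let haar_plin : positive_linear (@cc E R) (fun f => \int[pi]_x f x).
Proof. exact: positive_linear_radon. Qed.

Lemma lmul_comp_continuous (F : E -> R) (x : E) : continuous F -> continuous (fun z => F (x * z)%g).
Proof.
by move=> Fc z; apply: (@continuous_comp _ _ _ (fun z => (x * z)%g) F);
  [exact: lmulg_continuous|exact: Fc].
Qed.

Lemma haar_mono f g : cc f -> cc g -> (forall x, f x <= g x) ->
  \int[pi]_x f x <= \int[pi]_x g x.
Proof. exact: plin_le. Qed.

Lemma iter_tilted_mono n f g x : continuous f -> continuous g ->
  (forall x, f x <= g x) -> iter n Q f x <= iter n Q g x.
Proof.
by move=> fc gc fg; apply: (pop_le ctsE _ (iter_tilted_operator n)).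
Qed.

Lemma iter_tilted_ge0 n f x : continuous f -> (forall x, 0 <= f x) -> 0 <= iter n Q f x.
Proof. by move=> fc f0; apply: (pop_ge0 _ (iter_tilted_operator n)). Qed.

Lemma iter_tiltedZ n f a x : continuous f -> iter n Q (fun z => a * f z) x = a * iter n Q f x.
Proof. by move=> fc; rewrite (plinZ ctsE ((iter_tilted_operator n).2 x)). Qed.

(** With chi >= 1 on K^-1 L, where g vanishes off L, the minorization at any x of K sees the whole
    of g (x y); left invariance of pi then makes the bound independent of x. *)
Lemma tilted_hits K g : compact K -> cc g -> (forall x, 0 <= g x) ->
  (exists x, 0 < g x) ->
  exists j : nat, exists2 c : R, 0 < c & forall x, K x -> c <= iter j Q g x.
Proof.
move=> cK cg g0 gx; have [gc [L cL gL]] := cg.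
have cKL : compact [set (p.1 * p.2)%g | p in [set (x^-1)%g | x in K] `*` L].
  by apply: compact_mulg => //; exact: compact_invg.
have [chi [cchi chi0 chi1]] := @bump _ R _ hE lE cKL.
have [c [j c0 H]] := tilted_minorization cchi chi0.
exists j, (c * \int[pi]_y g y); first by rewrite mulr_gt0// haar_cc_gt0.
move=> x Kx; apply: le_trans (H _ gc g0 x); rewrite ler_pM2l//.
rewrite -(haar_RintegralL hE uE piP x cg); apply: haar_mono.
- exact: cc_lmul.
- by apply: ccMl => //; exact: lmul_comp_continuous.
move=> y; have [gxy|gxy] := eqVneq (g (x * y)%g) 0; first by rewrite gxy mul0r.
rewrite ler_peMr// chi1//; exists (x^-1, x * y)%g => /=; last by rewrite mulKg.
split; first by exists x.
by apply: contrapT => /gL/eqP; rewrite (negbTE gxy).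
Qed.

(** One step from K lands in the compact set K S; a chi that is at least max |psi| there does, as
    the weights r phi have total mass 1. *)
Lemma tilted_cover psi : cc psi -> exists chi, [/\ cc chi, forall x, 0 <= chi x &
  forall x, psi x <= Q chi x].
Proof.
move=> [pc [K cK pK]]; have [M M0 pM] := compact_upper_bound pc cK.
have [chi [cchi chi0 chi1]] := @bump _ R _ hE lE (compact_mulg cK cS).
pose f z := M * chi z; have cf : cc f by exact: (linear_classZ ccE).
have f0 z : 0 <= f z by rewrite mulr_ge0// ltW.
exists f; split => // x; have [Kx|/pK ->] := pselect (K x); last first.
  exact: (iter_tilted_ge0 1 x cf.1 f0).
apply: (@le_trans _ _ M); first by rewrite (le_trans (ler_norm _))// pM.
rewrite -[leLHS]mulr1 -integral_weight -RintegralZl//; last first.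
  exact: (integrable_continuous hE walk_finite cS weight_continuous).
apply: (Rintegral_mono hE walk_finite cS) => //.
- by move=> y; apply: cvgM; [exact: cvg_cst|exact: weight_continuous].
- exact: (@tilted_slice f x cf.1).
- move=> y Sy; rewrite ler_wpM2r ?(ltW (weight_gt0 _))// ler_peMr ?(ltW M0)//.
  by apply: chi1; exists (x, y).
Qed.

Lemma iter_tilted_cover psi i : cc psi -> (forall x, 0 <= psi x) ->
  exists chi, [/\ cc chi, forall x, 0 <= chi x & forall x, psi x <= iter i Q chi x].
Proof.
move=> cpsi psi0; elim: i => [|i [chi [cchi chi0 H]]]; first by exists psi.
have [chi' [cchi' chi0' H']] := tilted_cover cchi.
exists chi'; split => // x; rewrite iterSr; apply: le_trans (H x) _.
apply: iter_tilted_mono => //; first exact: cchi.1.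
exact: (tilted_cc cchi').1.
Qed.

(** A single eta for all residues modulo k, obtained as a sum of covers: the remainder of n modulo k
    is not under control when blocks of k steps are iterated. *)
Lemma tilted_cover_upto psi k : cc psi -> (forall x, 0 <= psi x) ->
  exists eta, [/\ cc eta, forall x, 0 <= eta x &
    forall i, (i < k)%N -> forall x, psi x <= iter i Q eta x].
Proof.
move=> cpsi psi0; elim: k => [|k [eta [ceta eta0 H]]]; first by exists psi.
have [chi [cchi chi0 H']] := iter_tilted_cover k cpsi psi0.
exists (fun x => eta x + chi x); split; first exact: cc_add.
  by move=> x; rewrite addr_ge0.
have cs := (cc_add ceta cchi).1.
move=> i; rewrite ltnS leq_eqVlt => /predU1P[->|ik] x.
  apply: le_trans (H' x) _; apply: iter_tilted_mono => //; first exact: cchi.1.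
  by move=> z; rewrite lerDr.
apply: le_trans (H i ik x) _; apply: iter_tilted_mono => //; first exact: ceta.1.
by move=> z; rewrite lerDl.
Qed.

(** * Subexponential decay and consecutive ratios of the tilted walk *)

Section subexponential.
(* The convergence parameter hypothesis, as divergence of the power series of the
   tilted walk outside the unit disc. *)
Variables (chi0 : E -> R) (x0 : E).
Hypotheses (cchi0 : cc chi0) (chi0_ge0 : forall x, 0 <= chi0 x).
Hypothesis chi0_large : forall t : R, 1 < t -> forall N, exists2 n, (N <= n)%N &
  1 <= t ^+ n * iter n Q chi0 x0.

(** A large value of Q^n chi0 at the single point x0 is spread out. psi is so large that Q^n psi >=
    Q^n chi0 (x0) on U, a compact set carrying the bump u at x0; the minorization then passes the
    bound on to all points where psi is nonzero. In (t^2)^k one power of t compensates Q^n chi0 (x0)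
    and the other the constant c3. *)
Lemma tilted_supersolution : exists psi, [/\ cc psi, forall x, 0 <= psi x, 0 < psi 1%g &
  forall t : R, 1 < t -> exists2 k, (0 < k)%N &
    forall x, psi x <= (t ^+ 2) ^+ k * iter k Q psi x].
Proof.
have [u [cu u0 u1]] := @bump _ R _ hE lE (@compact_set1 E x0).
have [uc [U cU uU]] := cu.
have [Mu Mu0 uM] := compact_upper_bound uc cU.
have [_ [K' cK' chiK]] := cchi0.
have [M M0 chiM] := compact_upper_bound cchi0.1 cK'.
have cD : compact ([set (p.1 * p.2)%g |
    p in [set (p.1 * p.2)%g | p in U `*` [set x0^-1%g]] `*` K'] `|` [set 1%g]).
  apply: compactU; last exact: compact_set1.
  by apply: compact_mulg => //; apply: compact_mulg => //; exact: compact_set1.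
have [b [cb b0 b1]] := @bump _ R _ hE lE cD.
pose psi z := M * b z.
have cpsi : cc psi by exact: (linear_classZ ccE).
have psi0 z : 0 <= psi z by rewrite mulr_ge0// ltW.
have psi_chi z y : U z -> chi0 (x0 * y)%g <= psi (z * y)%g.
  move=> Uz; have [Ky|/chiK ->//] := pselect (K' (x0 * y)%g).
  apply: (@le_trans _ _ M); first by rewrite (le_trans (ler_norm _))// chiM.
  rewrite ler_peMr ?(ltW M0)// b1//; left.
  exists (z * x0^-1, x0 * y)%g => /=; last by rewrite -mulgA mulKg.
  by split => //; exists (z, x0^-1)%g.
have Q_psi n z : U z -> iter n Q chi0 x0 <= iter n Q psi z.
  move=> Uz; rewrite -[x0]mulg1 -[z]mulg1 -!iter_tilted_transl.
  apply: iter_tilted_mono.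
  - exact: lmul_comp_continuous cchi0.1.
  - exact: lmul_comp_continuous cpsi.1.
  - by move=> y; exact: psi_chi.
have [_ [K2 cK2 psiK]] := cpsi.
have [M2 M20 psiM] := compact_upper_bound cpsi.1 cK2.
have cKU : compact [set (p.1 * p.2)%g | p in [set (x^-1)%g | x in K2] `*` U].
  by apply: compact_mulg => //; exact: compact_invg.
have [chi [cchi chi_ge0 chi1]] := @bump _ R _ hE lE cKU.
have [c [j c0 H]] := tilted_minorization cchi chi_ge0.
pose I := \int[pi]_y u y.
have I0 : 0 < I.
  by apply: haar_cc_gt0 => //; exists x0; rewrite (lt_le_trans ltr01)// u1.
pose c3 := c * I / (Mu * M2).
have c30 : 0 < c3 by rewrite divr_gt0 ?mulr_gt0.
(* In c3 the division by Mu turns the indicator of U into u, whose integral is I, and the division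
   by M2 turns a lower bound by a constant into one by psi. *)
have key n x : c3 * iter n Q chi0 x0 * psi x <= iter (j + n) Q psi x.
  set A := iter n Q chi0 x0; have A0 : 0 <= A by apply: iter_tilted_ge0 => //; exact: cchi0.1.
  have [Kx|/psiK ->] := pselect (K2 x); last first.
    by rewrite mulr0; apply: iter_tilted_ge0 => //; exact: cpsi.1.
  have cQ : continuous (iter n Q psi) by exact: (iter_tilted_cc n cpsi).1.
  have Q0 z : 0 <= iter n Q psi z by apply: iter_tilted_ge0 => //; exact: cpsi.1.
  rewrite iterD; apply: le_trans (H _ cQ Q0 x).
  have h1 : A / Mu * I <= \int[pi]_y (iter n Q psi (x * y)%g * chi y).
    rewrite /I -(haar_RintegralL hE uE piP x cu).
    rewrite -(plinZ ccE haar_plin _ (cc_lmul x cu)).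
    apply: haar_mono.
    - by apply: (linear_classZ ccE); exact: cc_lmul.
    - by apply: ccMl => //; exact: lmul_comp_continuous.
    move=> y; have [Uxy|/uU ->] := pselect (U (x * y)%g); last first.
      by rewrite mulr0 mulr_ge0.
    apply: (@le_trans _ _ A).
      rewrite mulrAC ler_pdivrMr// ler_wpM2l//.
      by rewrite (le_trans (ler_norm _))// uM.
    apply: (le_trans (Q_psi n _ Uxy)); rewrite ler_peMr// chi1//.
    exists (x^-1, x * y)%g => /=; last by rewrite mulKg.
    by split => //; exists x.
  have psix : psi x <= M2 by rewrite (le_trans (ler_norm _))// psiM.
  have := ler_wpM2l (ltW c0) h1; apply: le_trans.
  have -> : c * (A / Mu * I) = c3 * A * M2.
    by rewrite /c3; field; rewrite !gt_eqF.
  by rewrite ler_wpM2l// mulr_ge0// ltW.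
exists psi; split => //.
  by rewrite mulr_gt0// (lt_le_trans ltr01)// b1//; right.
move=> t t1; have t0 : 0 < t by exact: lt_trans ltr01 t1.
have [N _ NP] : \forall n \near \oo, c3^-1 <= t ^+ n.
  have ti : `|t^-1| < 1 by rewrite gtr0_norm ?invr_gt0// invf_lt1.
  have /cvgrPdist_le/(_ _ c30) := cvg_expr ti; apply: filterS => n.
  rewrite sub0r normrN ger0_norm ?exprn_ge0 ?invr_ge0 ?(ltW t0)// exprVn => h.
  by rewrite invf_ple ?posrE ?exprn_gt0.
have [n Nn hn] := chi0_large t1 (maxn N 1).
exists (j + n)%N; first by rewrite addn_gt0 orbC (leq_trans _ Nn)// leq_maxr.
move=> x; apply: le_trans (ler_wpM2l _ (key n x)); last by rewrite exprn_ge0// sqr_ge0.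
rewrite mulrA ler_peMl//.
have h1 : 1 <= c3 * t ^+ n.
  by rewrite -ler_pdivrMl// mulr1; apply: NP; rewrite /= (leq_trans _ Nn)// leq_maxl.
have -> : (t ^+ 2) ^+ (j + n) * (c3 * iter n Q chi0 x0) =
   t ^+ (2 * j) * ((c3 * t ^+ n) * (t ^+ n * iter n Q chi0 x0)).
  have n2 : (2 * n = n + n)%N by rewrite mul2n addnn.
  by rewrite -exprM mulnDr exprD n2 [t ^+ (n + n)]exprD; ring.
apply: mulr_ege1; last exact: mulr_ege1.
by apply: exprn_ege1; exact: ltW.
Qed.

(** Iterating psi <= t^k Q^k psi gives psi <= t^(k l) Q^(k l) psi for all l. The remaining i + j
    steps, with i < k, turn g into a majorant of a multiple of psi: Q^j g dominates a multiple of
    eta, and Q^i eta dominates psi. *)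
Lemma tilted_subexponential g : cc g -> (forall x, 0 <= g x) -> (exists x, 0 < g x) ->
  forall t : R, 1 < t ->
  exists2 c : R, 0 < c & \forall n \near \oo, c <= t ^+ n * iter n Q g 1%g.
Proof.
move=> cg g0 gx t t1; have [psi [cpsi psi0 psi1 H]] := tilted_supersolution.
have t0 : 0 < t by exact: lt_trans ltr01 t1.
pose s := Num.sqrt t.
have s2 : s ^+ 2 = t by rewrite sqr_sqrtr// ltW.
have s1 : 1 < s by rewrite -sqrtr1 ltr_sqrt.
have [k k0 Hk] := H s s1; rewrite s2 in Hk.
have [eta [ceta eta0 Heta]] := tilted_cover_upto k cpsi psi0.
have [_ [L cL etaL]] := ceta.
have [M M0 etaM] := compact_upper_bound ceta.1 cL.
have [j [c c0 Hj]] := tilted_hits cL cg g0 gx.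
pose c' := c / M; have c'0 : 0 < c' by rewrite divr_gt0.
have h1 x : c' * eta x <= iter j Q g x.
  have [Lx|/etaL ->] := pselect (L x); last first.
    by rewrite mulr0; apply: iter_tilted_ge0 => //; exact: cg.1.
  apply: le_trans (Hj x Lx); rewrite /c' mulrAC ler_pdivrMr// ler_wpM2l ?(ltW c0)//.
  by rewrite (le_trans (ler_norm _))// etaM.
have h2 l x : psi x <= t ^+ (k * l) * iter (k * l) Q psi x.
  elim: l x => [|l ih] x; first by rewrite muln0 expr0 mul1r.
  apply: le_trans (Hk x) _; rewrite mulnS exprD iterD -mulrA ler_wpM2l ?exprn_ge0 ?(ltW t0)//.
  have -> : t ^+ (k * l) * iter k Q (iter (k * l) Q psi) x =
      iter k Q (fun z => t ^+ (k * l) * iter (k * l) Q psi z) x.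
    by rewrite iter_tiltedZ//; exact: (iter_tilted_cc _ cpsi).1.
  apply: iter_tilted_mono => //; first exact: cpsi.1.
  by apply: (linear_classZ ctsE); exact: (iter_tilted_cc _ cpsi).1.
exists (c' * psi 1%g); first exact: mulr_gt0.
near=> n; have jn : (j <= n)%N by near: n; exact: nbhs_infty_ge.
pose l := ((n - j) %/ k)%N; pose i := ((n - j) %% k)%N.
have nE : n = (k * l + (i + j))%N by rewrite mulnC addnA -divn_eq subnK.
have ik : (i < k)%N by exact: ltn_pmod.
have h3 x : c' * psi x <= iter (i + j) Q g x.
  rewrite iterD; apply: (@le_trans _ _ (iter i Q (fun z => c' * eta z) x)).
    by rewrite iter_tiltedZ ?ler_pM2l//; [exact: Heta|exact: ceta.1].
  apply: iter_tilted_mono => //; last exact: (iter_tilted_cc _ cg).1.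
  by apply: (linear_classZ ctsE); exact: ceta.1.
have h4 : c' * iter (k * l) Q psi 1%g <= iter n Q g 1%g.
  rewrite nE iterD -iter_tiltedZ; last exact: cpsi.1.
  apply: iter_tilted_mono => //; last exact: (iter_tilted_cc _ cg).1.
  by apply: (linear_classZ ctsE); exact: cpsi.1.
apply: le_trans (ler_wpM2l (exprn_ge0 n (ltW t0)) h4).
rewrite mulrCA ler_pM2l//; apply: le_trans (h2 l 1%g) _.
rewrite ler_wpM2r//; first by apply: iter_tilted_ge0 => //; exact: cpsi.1.
by rewrite ler_weXn2l ?(ltW t1)// [in leqRHS]nE leq_addr.
Unshelve. all: by end_near. Qed.

(** chi is chosen above f1 and also above all its translates by increments: f1 (w) <= chi (w z^-1)
    for z in the compact support S. An additional step z in front of chi is undone by the right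
    translation y -> y z^-1 of pi, and f1 survives under both j and j + 1 steps. *)
Lemma tilted_common_component : exists c : R, exists j f1,
  [/\ 0 < c, cc f1, forall x, 0 <= f1 x, 0 < \int[pi]_y f1 y &
    let A f x := c * \int[pi]_y (f (x * y)%g * f1 y) in
    dominated cts A (iter j Q) /\ dominated cts A (iter j.+1 Q)].
Proof.
have [f1 [cf1 f10 f11]] := @bump _ R _ hE lE (@compact_set1 E 1%g).
have I1 : 0 < \int[pi]_y f1 y.
  by apply: haar_cc_gt0 => //; exists 1%g; rewrite (lt_le_trans ltr01)// f11.
have [f1c [L cL f1L]] := cf1.
have [M M0 f1M] := compact_upper_bound f1c cL.
have cD : compact (L `|` [set (p.1 * p.2)%g | p in L `*` [set (x^-1)%g | x in S]]).
  by apply: compactU => //; apply: compact_mulg => //; exact: compact_invg.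
have [b [cb b0 b1]] := @bump _ R _ hE lE cD.
pose chi z := M * b z.
have cchi : cc chi by exact: (linear_classZ ccE).
have chi_ge0 z : 0 <= chi z by rewrite mulr_ge0// ltW.
have chi1 z : f1 z <= chi z.
  have [Lz|/f1L ->//] := pselect (L z).
  apply: (@le_trans _ _ M); first by rewrite (le_trans (ler_norm _))// f1M.
  by rewrite ler_peMr ?(ltW M0)// b1//; left.
have chiS z w : S z -> f1 w <= chi (w * z^-1)%g.
  move=> Sz; have [Lw|/f1L ->//] := pselect (L w).
  apply: (@le_trans _ _ M); first by rewrite (le_trans (ler_norm _))// f1M.
  rewrite ler_peMr ?(ltW M0)// b1//; right; exists (w, z^-1)%g => //.
  by split => //; exists z.
have [c [j c0 H]] := tilted_minorization cchi chi_ge0.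
exists c, j, f1; split => //; split=> F Fc F0 x.
  apply: le_trans (H F Fc F0 x); rewrite ler_pM2l//; apply: haar_mono.
  - by apply: ccMl => //; exact: lmul_comp_continuous.
  - by apply: ccMl => //; exact: lmul_comp_continuous.
  - by move=> y; rewrite ler_wpM2l.
have QFc : continuous (Q F) by exact: tilted_operator.1.
rewrite iterSr; apply: le_trans (H _ QFc _ x); last first.
  by move=> y; exact: (iter_tilted_ge0 1).
rewrite ler_pM2l//.
pose k y z := F (x * (y * z))%g * (r * phi z) * chi y.
have kc : continuous (fun p : E * E => k p.1 p.2).
  move=> p; apply: cvgM; last first.
    by apply: (@continuous_comp _ _ _ (fun p : E * E => p.1) chi);
      [exact: cvg_fst|exact: cchi.1].
  exact: (@tilted_kernel (fun z => F (x * z)%g) (@lmul_comp_continuous F x Fc) p).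
have [_ [Lc cLc chiLc]] := cchi.
have kL y z : ~ Lc y -> k y z = 0 by move=> /chiLc chiy; rewrite /k chiy mulr0.
have -> : \int[pi]_y (Q F (x * y)%g * chi y) = \int[pi]_y \int[v]_(z in S) k y z.
  apply: eq_Rintegral => y _; rewrite /Q -RintegralZr//; last first.
    exact: (@integrable_continuous _ _ _ hE _ walk_finite _ cS
      (fun z => F (x * y * z)%g * (r * phi z)) _ (@tilted_slice F _ Fc)).
  by apply: eq_Rintegral => z _; rewrite /k mulgA.
rewrite (plin_swap hE walk_finite cS hE lE haar_plin kc cLc kL).
set I := \int[pi]_y _.
rewrite -[leLHS]mulr1 -integral_weight -RintegralZl//; last first.
  exact: (integrable_continuous hE walk_finite cS weight_continuous).
apply: (Rintegral_mono hE walk_finite cS) => //.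
- by move=> y; apply: cvgM; [exact: cvg_cst|exact: weight_continuous].
- exact: (plin_continuous hE lE haar_plin kc cLc kL).
move=> z Sz.
have ck : cc (fun y => F (x * y)%g * chi (y * z^-1)%g).
  by apply: ccMl; [exact: lmul_comp_continuous|exact: cc_rmul].
have -> : \int[pi]_y k y z = (r * phi z) * \int[pi]_y (F (x * y)%g * chi (y * z^-1)%g).
  rewrite -(haar_RintegralR hE piP z ck) -(plinZ ccE haar_plin _ (cc_rmul z ck)).
  by apply: eq_Rintegral => y _; rewrite /k mulgK; ring.
rewrite mulrC ler_pM2l ?weight_gt0//; apply: haar_mono => //.
- by apply: ccMl => //; exact: lmul_comp_continuous.
- by move=> y; rewrite ler_wpM2l// chiS.
Qed.

Lemma tilted_ratio_bounded g : cc g -> (forall x, 0 <= g x <= 1) -> (exists x, 0 < g x) ->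
  iter n.+1 Q g 1%g / iter n Q g 1%g @[n --> \oo] --> (1 : R).
Proof.
move=> cg g01 gx; have g0 x : 0 <= g x by have /andP[] := g01 x.
have [c [j [f1 [c0 cf1 f10 I1 [AQ AQ1]]]]] := tilted_common_component.
pose A f x := c * \int[pi]_y (f (x * y)%g * f1 y).
have c1 : continuous (fun _ : E => 1 : R) by move=> x; exact: cvg_cst.
pose a := c * \int[pi]_y f1 y.
have A1 : A (fun=> 1) = fun=> a.
  by apply/funext => x; congr (_ * _); apply: eq_Rintegral => y _; rewrite mul1r.
have a01 : 0 < a <= 1.
  rewrite mulr_gt0//=; have := AQ (fun=> 1) c1 (fun=> ler01) 1%g.
  by rewrite iter_tilted1 -[X in X <= _]/(A (fun=> 1) 1%g) A1.
have [f1c [L cL f1L]] := cf1.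
have Ap : positive_operator cts A.
  split=> [f fc|x].
    have -> : A f = fun x => c * \int[pi]_(y in L) (f (x * y)%g * f1 y).
      apply/funext => x; congr (_ * _); apply: Rintegral_cc => y /f1L ->.
      by rewrite mulr0.
    apply: (linear_classZ ctsE).
    apply: (continuous_Rintegral hE piK cL (k := fun x y => f (x * y)%g * f1 y)) => //.
      move=> p; apply: cvgM.
        by apply: (@continuous_comp _ _ _ (fun p : E * E => (p.1 * p.2)%g) f);
          [exact: mulg_continuous|exact: fc].
      by apply: (@continuous_comp _ _ _ (fun p : E * E => p.2) f1);
        [exact: cvg_snd|exact: f1c].
    exact: borel_compact.
  split=> [f g' b fc gc|f fc f0]; rewrite /A.
    have cf' (h : E -> R) : continuous h -> cc (fun y => h (x * y)%g * f1 y).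
      by move=> hc; apply: ccMl => //; exact: lmul_comp_continuous.
    rewrite mulrCA -mulrDr; congr (_ * _).
    apply: etrans _ (haar_plin.1 _ _ b (cf' f fc) (cf' g' gc)).
    by apply: eq_Rintegral => y _; ring.
  by rewrite mulr_ge0 ?(ltW c0)//; apply: Rintegral_ge0 => y _; rewrite mulr_ge0.
apply: (ratio_step_limit ctsE tilted_operator Ap AQ AQ1 c1 tilted1 a01 A1 cg.1 g01).
exact: tilted_subexponential.
Qed.

Lemma tilted_ratio g : cc g -> (forall x, 0 <= g x) -> (exists x, 0 < g x) ->
  iter n.+1 Q g 1%g / iter n Q g 1%g @[n --> \oo] --> (1 : R).
Proof.
move=> cg g0 [x gx]; have [_ [K cK gK]] := cg.
have [M M0 gM] := compact_upper_bound cg.1 cK.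
have cg' : cc (fun z => M^-1 * g z) by exact: (linear_classZ ccE).
have g01 z : 0 <= M^-1 * g z <= 1.
  rewrite mulr_ge0 ?invr_ge0 ?(ltW M0)//= ler_pdivrMl// mulr1.
  have [Kz|/gK ->] := pselect (K z); last exact: ltW.
  by rewrite (le_trans (ler_norm _))// gM.
have gx' : exists z, 0 < M^-1 * g z by exists x; rewrite mulr_gt0// invr_gt0.
apply: cvg_near_eq (tilted_ratio_bounded cg' g01 gx').
near=> n; rewrite !iter_tiltedZ; try exact: cg.1.
by rewrite -mulf_div divff ?mul1r// gt_eqF// invr_gt0.
Unshelve. all: by end_near. Qed.

Lemma tilted_eventually_gt0 g : cc g -> (forall x, 0 <= g x) -> (exists x, 0 < g x) ->
  \forall n \near \oo, 0 < iter n Q g 1%g.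
Proof.
move=> cg g0 gx; have [|c c0] := tilted_subexponential cg g0 gx (t := 2); first by rewrite ltr1n.
apply: filterS => n h; rewrite -(pmulr_rgt0 _ (_ : 0 < 2 ^+ n)); last exact: exprn_gt0.
exact: lt_le_trans h.
Qed.

(** * Normalized functionals *)

Variable g0 : E -> R.
Hypotheses (cg0 : cc g0) (g0_ge0 : forall x, 0 <= g0 x) (g0_gt0 : exists x, 0 < g0 x).
Local Notation w n := (iter n Q g0 1%g).
Definition normalized n f := iter n Q f 1%g / w n.
Local Notation rho := normalized.

Lemma normalizer_gt0 : exists N, forall n, (N <= n)%N -> 0 < w n.
Proof.
by have [N _ NP] := tilted_eventually_gt0 cg0 g0_ge0 g0_gt0; exists N => n Nn; exact: NP.
Qed.

Lemma tilted_ratio_shift m : w (n + m) / w n @[n --> \oo] --> (1 : R).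
Proof.
have [N wN] := normalizer_gt0.
elim: m => [|m ih].
  apply/cvgrPdist_le => e e0; near=> n.
  rewrite addn0 divff ?subrr ?normr0 ?ltW// gt_eqF// wN//.
  by near: n; exact: nbhs_infty_ge.
have h := tilted_ratio cg0 g0_ge0 g0_gt0.
have h' : w (n + m).+1 / w (n + m) @[n --> \oo] --> (1 : R).
  by move: h; rewrite -(cvg_shiftn m).
have hm : (w (n + m).+1 / w (n + m)) * (w (n + m) / w n) @[n --> \oo] --> (1 * 1 : R).
  exact: cvgM.
rewrite mulr1 in hm; apply: cvg_near_eq hm.
near=> n; rewrite addnS /= mulrA mulfVK// gt_eqF// wN// (leq_trans _ (leq_addr _ _))//.
by near: n; exact: nbhs_infty_ge.
Unshelve. all: by end_near. Qed.

Lemma normalized_plin n : (0 < w n) -> positive_linear (@cc E R) (rho n).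
Proof.
move=> w0; have [ll lp] := iter_tilted_plin n 1%g; split=> [f g a cf cg|f cf f0].
  by rewrite /rho ll// mulrDl mulrA.
by rewrite /rho divr_ge0// ?(ltW w0)//; exact: lp.
Qed.

(** By [tilted_hits], |f| is at most a multiple of some Q^j g0, and [normalized n] maps Q^j g0 to w
    (n + j) / w n, which tends to 1 and so is eventually at most 2. *)
Lemma normalized_bounded f : cc f ->
  exists2 C, 0 < C & exists N, forall n, (N <= n)%N -> 0 < w n /\ `|rho n f| <= C.
Proof.
move=> cf; have [fc [K cK fK]] := cf.
have [M M0 fM] := compact_upper_bound fc cK.
have [j [c c0 H]] := tilted_hits cK cg0 g0_ge0 g0_gt0.
have [N wN] := normalizer_gt0.
have /cvgrPdist_le/(_ _ ltr01)[N' _ hN'] := tilted_ratio_shift j.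
exists (M / c * 2); first by rewrite !mulr_gt0 ?invr_gt0.
exists (maxn N N') => n; rewrite geq_max => /andP[Nn N'n].
have w0 := wN n Nn; split => //.
have cg : cc (iter j Q g0) by exact: iter_tilted_cc.
have fg x : `|f x - 0| <= M / c * iter j Q g0 x.
  rewrite subr0; have [Kx|/fK ->] := pselect (K x).
    apply: le_trans (fM x Kx) _; rewrite mulrAC ler_pdivlMr// ler_wpM2l ?(ltW M0)//.
    exact: H.
  by rewrite normr0 mulr_ge0 ?divr_ge0 ?(ltW M0) ?(ltW c0)//; apply: iter_tilted_ge0 => //; exact: cg0.1.
have := plin_dist ccE (normalized_plin w0) cf (cc0 _ _) cg fg.
rewrite (plin0 ccE (normalized_plin w0)) subr0 => /le_trans; apply.
rewrite ler_wpM2l ?divr_ge0 ?(ltW M0) ?(ltW c0)//.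
have := hN' n N'n; rewrite /= /rho -iterD => /ler_normlP[h _]; lra.
Qed.

Lemma cc_norm_sub f : cc f -> cc (fun x => `|f x| - f x) /\ forall x, 0 <= `|f x| - f x.
Proof.
move=> cf; split; first by apply: (linear_classB ccE) => //; exact: cc_abs.
by move=> x; rewrite subr_ge0 ler_norm.
Qed.

Lemma normalized_invariant_ge0 f : cc f -> (forall x, 0 <= f x) ->
  rho n (Q f) - rho n f @[n --> \oo] --> (0 : R).
Proof.
move=> cf f0; have [[x fx]|nf] := pselect (exists x, 0 < f x); last first.
  have f00 : f = fun=> 0.
    apply/funext => x; apply/eqP; rewrite eq_le f0 andbT leNgt; apply/negP => fx.
    by apply: nf; exists x.
  have Q0 : Q f = f.
    by rewrite f00; apply/funext => x; rewrite (plin0 ctsE (tilted_operator.2 x)).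
  by under eq_fun do rewrite Q0 subrr; exact: cvg_cst.
have [C C0 [N NC]] := normalized_bounded cf.
have h := tilted_ratio cf f0 (ex_intro _ x fx).
have [N' _ fN'] := tilted_eventually_gt0 cf f0 (ex_intro _ x fx).
apply/cvgrPdist_le => e e0.
have e1 : 0 < e / C by rewrite divr_gt0.
near=> n; have [] : (N <= n)%N /\ (N' <= n)%N.
  by split; near: n; exact: nbhs_infty_ge.
move=> /NC[w0 fC] /fN' /= fn.
(* The ratio limit is applied to f itself rather than to g0; this is why f = 0 was treated apart and
   why signed f come later by subtraction. *)
have -> : rho n (Q f) - rho n f = (iter n.+1 Q f 1%g / iter n Q f 1%g - 1) * rho n f.
  by rewrite /rho -iterSr; field; rewrite !gt_eqF.
rewrite sub0r normrN normrM -[leRHS](mulfVK (lt0r_neq0 C0)) ler_pM//.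
rewrite distrC; near: n.
by have /cvgrPdist_le := h; exact.
Unshelve. all: by end_near. Qed.

Lemma normalized_invariant f : cc f -> rho n (Q f) - rho n f @[n --> \oo] --> (0 : R).
Proof.
move=> cf; have [cp p0] := cc_norm_sub cf.
have ca := cc_abs cf.
have h1 := normalized_invariant_ge0 ca (fun x => normr_ge0 (f x)).
have h2 := normalized_invariant_ge0 cp p0.
pose a x := `|f x|; pose p x := `|f x| - f x.
have hB : (rho n (Q a) - rho n a) - (rho n (Q p) - rho n p) @[n --> \oo] --> (0 - 0 : R).
  exact: cvgB.
rewrite subr0 in hB; apply: cvg_near_eq hB.
have [N wN] := normalizer_gt0.
near=> n; have w0 : 0 < w n by apply: wN; near: n; exact: nbhs_infty_ge.
have lr := normalized_plin w0.
have fE : f = fun x => a x - p x by apply/funext => x; rewrite /a /p; ring.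
have QE : Q f = fun x => Q a x - Q p x.
  apply/funext => x; rewrite {1}fE (plinB (tilted_operator.2 x))//.
    exact: ca.1.
  exact: cp.1.
rewrite QE [in RHS]fE (plinB lr (tilted_cc ca) (tilted_cc cp)) (plinB lr ca cp).
ring.
Unshelve. all: by end_near. Qed.

(** The form in which (B) is used; the lemma of the same name below derives it from uniqueness of
    nu. *)
Hypothesis invariant_constant : forall H : E -> R, continuous H ->
  (forall x, 0 <= H x) ->
  (forall w, \int[v]_(z in S) (H (w * z^-1)%g * (r * phi z)) = H w) ->
  exists k, forall w, H w = k.

(** * Ultrafilter limits are multiples of Haar measure *)

Section ultralimit.
Variable U : set_system nat.
Hypotheses (UU : UltraFilter U) (Uoo : \oo `<=` U).

Definition ultralimit f : R := lim (rho n f @[n --> U]).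
Local Notation l := ultralimit.

Lemma ultra_near (A : set nat) : (\forall n \near \oo, A n) -> \forall n \near U, A n.
Proof. exact: Uoo. Qed.

Lemma ultralimit_cvg f : cc f -> rho n f @[n --> U] --> l f.
Proof.
move=> cf; have [C C0 [N NC]] := normalized_bounded cf.
have [|p h] := @ultra_bounded_cvg R U (rho^~ f) C UU.
  by apply: ultra_near; exists N => // n /NC[].
by apply/cvg_ex; exists p.
Qed.

Lemma ultralimitE f p : rho n f @[n --> U] --> p -> l f = p.
Proof. exact: cvg_lim. Qed.

Lemma ultralimit_plin : positive_linear (@cc E R) l.
Proof.
have [N wN] := normalizer_gt0.
split=> [f g a cf cg|f cf f0].
  apply: ultralimitE; have hf := ultralimit_cvg cf; have hg := ultralimit_cvg cg.
  have h : a * rho n f + rho n g @[n --> U] --> a * l f + l g.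
    by apply: cvgD => //; apply: cvgM => //; exact: cvg_cst.
  move: h; apply: cvg_trans; apply: near_eq_cvg; apply: ultra_near.
  by exists N => // n /wN w0 /=; rewrite (normalized_plin w0).1.
rewrite /ultralimit; apply: limr_ge; first by apply/cvg_ex; exists (l f); exact: ultralimit_cvg.
by apply: ultra_near; exists N => // n /wN w0; exact: (normalized_plin w0).2.
Qed.

Lemma ultralimit_g0 : l g0 = 1.
Proof.
have [N wN] := normalizer_gt0.
apply: ultralimitE; have : (1 : R) @[n --> U] --> (1 : R) by exact: cvg_cst.
apply: cvg_trans; apply: near_eq_cvg; apply: ultra_near.
by exists N => // n /wN w0 /=; rewrite /rho divff// gt_eqF.
Qed.

Lemma ultralimit_invariant f : cc f -> l (Q f) = l f.
Proof.
move=> cf; apply/eqP; rewrite -subr_eq0; apply/eqP.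
have h1 := ultralimit_cvg cf; have h2 := ultralimit_cvg (tilted_cc cf).
have h3 : rho n (Q f) - rho n f @[n --> U] --> l (Q f) - l f by exact: cvgB.
have h4 : rho n (Q f) - rho n f @[n --> U] --> (0 : R).
  by move=> A /(normalized_invariant cf); exact: Uoo.
exact: (cvg_unique _ h3 h4).
Qed.

Lemma cutoff K : compact K -> exists b : E -> R,
  [/\ cc b, forall x, 0 <= b x & forall x, K x -> b x = 1].
Proof.
move=> cK; have [b [cb b0 b1]] := @bump _ R _ hE lE cK.
exists (fun x => Num.min (b x) 1); split.
- split; last by have [_ [L cL bL]] := cb; exists L => // x /bL ->; rewrite min_l// ler01.
  move=> x; apply: (@continuous_min _ _ b (fun=> 1)); [exact: cb.1|exact: cvg_cst].
- by move=> x; rewrite le_min b0 ler01.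
- by move=> x /b1 ?; rewrite min_r.
Qed.

Section right_invariance.
Variable kappa : E -> R.
Hypotheses (ck : cc kappa) (k0 : forall x, 0 <= kappa x).

Let H w := l (fun y => kappa (w * y^-1)%g).

Let cc_kw w : cc (fun y => kappa (w * y^-1)%g).
Proof. exact: (cc_inv (cc_lmul w ck)). Qed.

Let kappa_cont : continuous (fun p : E * E => kappa (p.2 * p.1^-1)%g).
Proof.
move=> p; apply: (@continuous_comp _ _ _ (fun p : E * E => (p.2 * p.1^-1)%g) kappa); last exact: ck.1.
apply: mulg_continuous2; first by move=> ?; exact: cvg_snd.
by apply: invg_continuous1 => ?; exact: cvg_fst.
Qed.

Let H_continuous : continuous H.
Proof.
move=> w0; have [b [cb b0 b1]] := @bump _ R _ hE lE (@compact_set1 E w0).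
have [bc [L cL bL]] := cb; have [_ [K cK kK]] := ck.
(* Without b, the support in y moves with w and leaves every compact set. Multiplying by a bump at
   w0 confines it; dividing by b near w0 recovers H. *)
pose k y w := b w * kappa (w * y^-1)%g.
have kc : continuous (fun p : E * E => k p.1 p.2).
  move=> p; apply: cvgM; last exact: kappa_cont.
  by apply: (@continuous_comp _ _ _ (fun p : E * E => p.2) b); [exact: cvg_snd|exact: bc].
have cD : compact [set (p.1 * p.2)%g | p in [set (x^-1)%g | x in K] `*` L].
  by apply: compact_mulg => //; exact: compact_invg.
have kL y w : ~ [set (p.1 * p.2)%g | p in [set (x^-1)%g | x in K] `*` L] y -> k y w = 0.
  move=> ny; rewrite /k; have [Lw|/bL ->] := pselect (L w); last by rewrite mul0r.
  rewrite kK ?mulr0// => Kw; apply: ny; exists ((w * y^-1)^-1, w)%g => /=.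
    by split => //; exists (w * y^-1)%g.
  by rewrite invgM invgK -mulgA mulVg mulg1.
have lc := plin_continuous hE lE ultralimit_plin kc cD kL.
have bH w : l (k^~ w) = b w * H w.
  by rewrite /H -(plinZ ccE ultralimit_plin _ (cc_kw w)).
have bw0 : b w0 != 0 by rewrite gt_eqF// (lt_le_trans ltr01)// b1.
have h : (b w)^-1 * l (k^~ w) @[w --> w0] --> (b w0)^-1 * l (k^~ w0).
  by apply: cvgM; [apply: cvgV => //; exact: bc|exact: lc].
rewrite bH mulKf// in h; move: h; apply: cvg_trans; apply: near_eq_cvg.
have : \forall w \near w0, b w != 0 by exact: (cvgr_neq0 _ (@bc w0) bw0).
by apply: filterS => w bw; rewrite bH mulKf.
Qed.

Let H_invariant w : \int[v]_(z in S) (H (w * z^-1)%g * (r * phi z)) = H w.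
Proof.
have [b [cb b0 b1]] := cutoff cS.
have [bc [Z cZ bZ]] := cb; have [_ [K cK kK]] := ck.
(* [plin_swap] asks for one compact set carrying y for every z in E, not only for z in S; the factor
   b, equal to 1 on S, provides it without changing the integral. *)
pose k y z := (r * phi z) * b z * kappa (w * (y * z)^-1)%g.
have kc : continuous (fun p : E * E => k p.1 p.2).
  move=> p; apply: cvgM.
    apply: (@continuous_comp _ _ _ (fun p : E * E => p.2) (fun z => r * phi z * b z)); first exact: cvg_snd.
    by apply: cvgM; [exact: weight_continuous|exact: bc].
  apply: (@continuous_comp _ _ _ (fun p : E * E => (w * (p.1 * p.2)^-1)%g) kappa); last exact: ck.1.
  apply: mulg_continuous2; first by move=> ?; exact: cvg_cst.
  by apply: invg_continuous1; exact: mulg_continuous.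
pose D := [set (p.1 * p.2)%g | p in [set (p.1 * p.2)%g |
  p in [set (x^-1)%g | x in K] `*` [set w]] `*` [set (x^-1)%g | x in Z]].
have cD : compact D.
  apply: compact_mulg; last exact: compact_invg.
  by apply: compact_mulg; [exact: compact_invg|exact: compact_set1].
have kD y z : ~ D y -> k y z = 0.
  move=> ny; rewrite /k; have [Zz|/bZ ->] := pselect (Z z); last by rewrite mulr0 mul0r.
  rewrite kK ?mulr0// => Kw; apply: ny.
  exists ((w * (y * z)^-1)^-1 * w, z^-1)%g => /=.
    split; last by exists z.
    by exists ((w * (y * z)^-1)^-1, w)%g => //; split => //; exists (w * (y * z)^-1)%g.
  by rewrite invgM invgK -[(y * z * _ * _)%g]mulgA mulVg mulg1 mulgK.
rewrite [RHS]/H -(ultralimit_invariant (cc_kw w)).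
have -> : Q (fun y => kappa (w * y^-1)%g) = fun y => \int[v]_(z in S) k y z.
  apply/funext => y; apply: eq_Rintegral => z /set_mem Sz.
  by rewrite /k b1// mulr1 mulrC.
rewrite (plin_swap hE walk_finite cS hE lE ultralimit_plin kc cD kD).
apply: eq_Rintegral => z /set_mem Sz.
rewrite /H mulrC -(plinZ ccE ultralimit_plin _ (cc_kw _)); congr l.
by apply/funext => y; rewrite /k b1// mulr1 invgM mulgA.
Qed.

Lemma ultralimit_inverse_right w :
  l (fun y => kappa (w * y^-1)%g) = l (fun y => kappa (y^-1)%g).
Proof.
have H0 x : 0 <= H x by apply: ultralimit_plin.2 => //; exact: cc_kw.
have [k hk] := invariant_constant H_continuous H0 H_invariant.
have := hk 1%g; rewrite /H => h1; have := hk w; rewrite /H => ->; rewrite -h1.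
by congr l; apply/funext => y; rewrite mul1g.
Qed.

End right_invariance.

Lemma ultralimit_right f w : cc f -> (forall x, 0 <= f x) ->
  l (fun y => f (y * w)%g) = l f.
Proof.
move=> cf f0; have := @ultralimit_inverse_right (fun y => f (y^-1)%g) (cc_inv cf) (fun x => f0 _) (w^-1)%g.
rewrite /=; under [X in l X = _]funext do rewrite invgM !invgK.
by under [X in _ = l X]funext do rewrite invgK.
Qed.

(* Both sides are the double integral of f(y) h(x y^-1) against l(dy) pi(dx),
   after the substitution y -> y x on the right. *)
Lemma ultralimit_haar f h : cc f -> (forall x, 0 <= f x) -> cc h ->
  (forall x, 0 <= h x) ->
  l f * \int[pi]_x h x = \int[pi]_x f x * l (fun y => h (y^-1)%g).
Proof.
move=> cf f0 ch h0; have [fc [K cK fK]] := cf; have [hc [L cL hL]] := ch.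
have lP := ultralimit_plin.
pose D := [set (p.1 * p.2)%g | p in L `*` K].
have cD : compact D by exact: compact_mulg.
pose k1 y x := f y * h (x * y^-1)%g.
pose k2 y x := f (y * x)%g * h (y^-1)%g.
have k1c : continuous (fun p : E * E => k1 p.1 p.2).
  move=> p; apply: cvgM.
    by apply: (@continuous_comp _ _ _ (fun p : E * E => p.1) f); [exact: cvg_fst|exact: fc].
  apply: (@continuous_comp _ _ _ (fun p : E * E => (p.2 * p.1^-1)%g) h); last exact: hc.
  apply: mulg_continuous2; first by move=> ?; exact: cvg_snd.
  by apply: invg_continuous1 => ?; exact: cvg_fst.
have k2c : continuous (fun p : E * E => k2 p.1 p.2).
  move=> p; apply: cvgM.
    by apply: (@continuous_comp _ _ _ (fun p : E * E => (p.1 * p.2)%g) f);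
      [exact: mulg_continuous|exact: fc].
  apply: (@continuous_comp _ _ _ (fun p : E * E => (p.1^-1)%g) h); last exact: hc.
  by apply: invg_continuous1 => ?; exact: cvg_fst.
have k1K y x : ~ K y -> k1 y x = 0 by move=> /fK fy; rewrite /k1 fy mul0r.
have k2K y x : ~ [set (x^-1)%g | x in L] y -> k2 y x = 0.
  move=> ny; rewrite /k2 hL ?mulr0// => Ly; apply: ny; exists (y^-1)%g => //.
  by rewrite invgK.
have cLi := compact_invg cL.
have s1 := plin_swap hE piK cD hE lE lP k1c cK k1K.
have s2 := plin_swap hE piK cD hE lE lP k2c cLi k2K.
have e1 y : \int[pi]_(x in D) k1 y x = \int[pi]_x h x * f y.
  rewrite -(@Rintegral_cc _ _ _ _ (k1 y) D); last first.
    move=> x nx; rewrite /k1; have [Ky|/fK ->] := pselect (K y); last by rewrite mul0r.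
    rewrite hL ?mulr0// => Lxy; apply: nx; exists (x * y^-1, y)%g => //=.
    by rewrite mulgVK.
  rewrite -(haar_RintegralR hE piP (y^-1)%g ch) mulrC.
  by rewrite -(plinZ ccE haar_plin _ (cc_rmul (y^-1)%g ch)).
have e2 y : \int[pi]_(x in D) k2 y x = \int[pi]_x f x * h (y^-1)%g.
  rewrite -(@Rintegral_cc _ _ _ _ (k2 y) D); last first.
    move=> x nx; rewrite /k2; have [Ky|/fK ->] := pselect (K (y * x)%g); last by rewrite mul0r.
    rewrite hL ?mulr0// => Ly; apply: nx; exists (y^-1, y * x)%g => //=.
    by rewrite mulKg.
  rewrite -(haar_RintegralL hE uE piP y cf) mulrC.
  rewrite -(plinZ ccE haar_plin _ (cc_lmul y cf)).
  by apply: eq_Rintegral => x _; rewrite /k2 mulrC.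
rewrite (_ : (fun y => \int[pi]_(x in D) k1 y x) = fun y => \int[pi]_x h x * f y) in s1; last exact/funext.
rewrite (_ : (fun y => \int[pi]_(x in D) k2 y x) = fun y => \int[pi]_x f x * h (y^-1)%g) in s2; last exact/funext.
rewrite (plinZ ccE lP _ cf) in s1; rewrite (plinZ ccE lP _ (cc_inv ch)) in s2.
rewrite mulrC s1 s2; apply: eq_Rintegral => x _.
have ck1 : cc (fun y => k1 y x).
  by apply: ccMl => //; exact: (cc_inv (cc_lmul x ch)).
have k10 y : 0 <= k1 y x by rewrite mulr_ge0.
rewrite -(ultralimit_right x ck1 k10); congr l; apply/funext => y.
by rewrite /k1 /k2 invgM mulgA mulgV mul1g.
Qed.

(** In [ultralimit_haar] with h = g0 the unknown factor is l of y -> g0 (y^-1); the case f = g0,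
    where l g0 = 1, shows that it equals 1. *)
Lemma ultralimit_value f : cc f -> (forall x, 0 <= f x) ->
  l f = \int[pi]_x f x / \int[pi]_x g0 x.
Proof.
move=> cf f0; have I0 : 0 < \int[pi]_x g0 x by exact: haar_cc_gt0.
have := ultralimit_haar cg0 g0_ge0 cg0 g0_ge0; rewrite ultralimit_g0 mul1r.
move=> /(congr1 ( *%R (\int[pi]_x g0 x)^-1)); rewrite mulVf ?gt_eqF// mulKf ?gt_eqF// => e1.
have := ultralimit_haar cf f0 cg0 g0_ge0; rewrite -e1 mulr1 => <-.
by rewrite mulfK// gt_eqF.
Qed.

End ultralimit.

(** If convergence failed, the bad indices would meet every tail, and an ultrafilter finer than the
    tails and containing them would contradict [ultralimit_value]. *)
Lemma normalized_limit_ge0 f : cc f -> (forall x, 0 <= f x) ->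
  rho n f @[n --> \oo] --> \int[pi]_x f x / \int[pi]_x g0 x.
Proof.
move=> cf f0; set L := _ / _; apply/cvgrPdist_le => e e0; apply: contrapT => nn.
pose A := [set n | ~ (`|L - rho n f| <= e)].
have PF : ProperFilter (within A \oo).
  split; last exact: within_filter.
  move=> -[N _ HN]; apply: nn; exists N => // n Nn.
  by apply: contrapT => An; exact: (HN n Nn An).
have [U [UU sU]] := ultraFilterLemma PF.
have Uoo : \oo `<=` U by move=> B BB; apply: sU; apply: filterS BB => n Bn _.
have UA : U A by apply: sU; rewrite /within /=; exists 0%N.
have := ultralimit_cvg UU Uoo cf; rewrite (ultralimit_value UU Uoo cf f0).
move=> /cvgrPdist_le/(_ _ e0) h.
have [n [? An]] := filter_ex (filterI h UA : U _).
exact: An.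
Qed.

Lemma normalized_limit f : cc f ->
  rho n f @[n --> \oo] --> \int[pi]_x f x / \int[pi]_x g0 x.
Proof.
move=> cf; have [cp p0] := cc_norm_sub cf; have ca := cc_abs cf.
have h1 := normalized_limit_ge0 ca (fun x => normr_ge0 (f x)).
have h2 := normalized_limit_ge0 cp p0.
pose a x := `|f x|; pose p x := `|f x| - f x.
have fE : f = fun x => a x - p x by apply/funext => x; rewrite /a /p; ring.
have hB : rho n a - rho n p @[n --> \oo] -->
    (\int[pi]_x a x / \int[pi]_x g0 x - \int[pi]_x p x / \int[pi]_x g0 x : R).
  exact: cvgB.
have -> : \int[pi]_x f x / \int[pi]_x g0 x =
    \int[pi]_x a x / \int[pi]_x g0 x - \int[pi]_x p x / \int[pi]_x g0 x.
  by rewrite [in LHS]fE -mulrBl; congr (_ / _); exact: (plinB haar_plin ca cp).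
apply: cvg_near_eq hB; have [N wN] := normalizer_gt0; exists N => // n /wN w0 /=.
by rewrite [in RHS]fE (plinB (normalized_plin w0) ca cp).
Qed.

(** For x near x1 the translates of f by x and x1 differ by at most a small multiple of one function
    h, and [normalized n h] stays bounded in n: the functionals are equicontinuous in x, and
    compactness of K finishes. *)
Lemma normalized_uniform f K e : cc f -> compact K -> 0 < e ->
  \forall n \near \oo, forall x, K x ->
    `|iter n Q f x / w n - \int[pi]_x f x / \int[pi]_x g0 x| <= e.
Proof.
move=> cf cK e0; set L := _ / _; have [fc [M cM fM]] := cf.
have cD : compact [set (p.1 * p.2)%g | p in [set (x^-1)%g | x in K] `*` M].
  by apply: compact_mulg => //; exact: compact_invg.
have [h [ch h0 h1]] := @bump _ R _ hE lE cD.
have [C C0 [N NC]] := normalized_bounded ch.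
have fkc : continuous (fun p : E * E => f (p.1 * p.2)%g).
  by move=> p; apply: (@continuous_comp _ _ _ (fun p : E * E => (p.1 * p.2)%g) f);
    [exact: mulg_continuous|exact: fc].
have iQ n x : iter n Q f x / w n = rho n (fun y => f (x * y)%g).
  by rewrite /rho iter_tilted_transl mulg1.
have /near_covering_withinP cK' := (compact_near_coveringP K).1 cK.
apply: (cK' _ \oo (fun n x => `|iter n Q f x / w n - L| <= e)) => x1 Kx1.
have e2 : 0 < e / 2 by rewrite divr_gt0.
have eC : 0 < e / 2 / C by rewrite divr_gt0.
pose P := [set x | forall y, [set (p.1 * p.2)%g | p in [set (x^-1)%g | x in K] `*` M] y ->
  `|f (x * y)%g - f (x1 * y)%g| <= e / 2 / C].
have nP : nbhs x1 P.
  exact: (@near_compact_close R E E (fun x y => f (x * y)%g) _ x1 _ fkc cD eC).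
have := normalized_limit (cc_lmul x1 cf).
rewrite (haar_RintegralL hE uE piP x1 cf) -/L => /cvgrPdist_le/(_ _ e2)[N' _ hN'].
exists (P, [set n | (N <= n)%N /\ (N' <= n)%N]) => /=.
  by split => //; exists (maxn N N') => // n /=; rewrite geq_max => /andP[].
move=> [x n] /= [Px [Nn N'n]] Kx; have [w0 hC] := NC n Nn.
have lr := normalized_plin w0.
have d1 : `|rho n (fun y => f (x * y)%g) - rho n (fun y => f (x1 * y)%g)| <= e / 2 / C * rho n h.
  apply: (plin_dist ccE lr); [exact: cc_lmul|exact: cc_lmul|by []|].
  move=> y; have [Dy|nDy] := pselect ([set (p.1 * p.2)%g | p in [set (x^-1)%g | x in K] `*` M] y).
    by apply: (le_trans (Px y Dy)); rewrite ler_peMr ?(ltW eC)// h1.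
  rewrite !fM ?subrr ?normr0 ?(mulr_ge0 (ltW eC))//.
    move=> My; apply: nDy; exists (x1^-1, x1 * y)%g => /=; last by rewrite mulKg.
    by split => //; exists x1.
  move=> My; apply: nDy; exists (x^-1, x * y)%g => /=; last by rewrite mulKg.
  by split => //; exists x.
have d2 : e / 2 / C * rho n h <= e / 2.
  rewrite -[leRHS](divfK (lt0r_neq0 C0)) ler_wpM2l ?(ltW eC)//.
  by rewrite (le_trans (ler_norm _)).
have d3 := hN' n N'n; rewrite /= in d3.
rewrite iQ; move: (le_trans d1 d2) d3 => /ler_normlP[a1 a2] /ler_normlP[a3 a4].
by apply/ler_normlP; split; lra.
Qed.

Lemma normalized_uniform_shift m f K e : cc f -> compact K -> 0 < e ->
  \forall n \near \oo, forall x, K x ->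
    `|iter (n + m) Q f x / w n - \int[pi]_x f x / \int[pi]_x g0 x| <= e.
Proof.
move=> cf cK e0; set L := _ / _.
(* From ab - L = (a - L) + (a - L) (b - 1) + L (b - 1), with both deviations at most dl <= 1, the
   total is at most dl (|L| + 2). *)
pose dl := Num.min 1 (e / (`|L| + 2)).
have L2 : 0 < `|L| + 2 by rewrite ltr_wpDl.
have d0 : 0 < dl by rewrite lt_min ltr01 divr_gt0.
have d1 : dl <= 1 by rewrite ge_min lexx.
have de : dl * (`|L| + 2) <= e by rewrite -ler_pdivlMr// ge_min lexx orbT.
have [N _ hN] := normalized_uniform cf cK d0.
have [N' wN] := normalizer_gt0.
have /cvgrPdist_le/(_ _ d0)[N2 _ hN2] := tilted_ratio_shift m.
exists (maxn N (maxn N' N2)) => // n; rewrite /= !geq_max => /and3P[Nn N'n N2n] x Kx.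
have := hN (n + m)%N (leq_trans Nn (leq_addr _ _)) x Kx; rewrite -/L.
have w0 := wN n N'n; have w1 := wN (n + m)%N (leq_trans N'n (leq_addr _ _)).
have := hN2 n N2n; rewrite /=.
set b := w (n + m) / w n; set a := _ / w (n + m).
have -> : iter (n + m) Q f x / w n = a * b by rewrite /a /b mulrA mulfVK// gt_eqF.
move=> hb ha.
have -> : a * b - L = (a - L) + (a - L) * (b - 1) + L * (b - 1) by ring.
rewrite distrC in hb.
apply: le_trans (ler_normD _ _) _; apply: le_trans (lerD (ler_normD _ _) (lexx _)) _.
rewrite (normrM (a - L)) (normrM L); apply: le_trans de; rewrite /= in ha hb.
have h3 : `|a - L| * `|b - 1| <= dl * 1 by rewrite ler_pM// (le_trans hb).
have h4 : `|L| * `|b - 1| <= `|L| * dl by rewrite ler_wpM2l.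
lra.
Qed.

End subexponential.

Lemma iter_tilted_le_cst n f M x : continuous f -> (forall x, f x <= M) -> iter n Q f x <= M.
Proof.
move=> fc fM; have c1 : continuous (fun _ : E => 1 : R) by move=> y; exact: cvg_cst.
have cM : continuous (fun _ : E => M * 1) by move=> y; exact: cvg_cst.
have := @iter_tilted_mono n f (fun=> M * 1) x fc cM.
by rewrite iter_tiltedZ// iter_tilted1 mulr1; apply.
Qed.

(** The small function s and the small measure mu come from two different minorizations. The first
    gives s <= P^m chi1 with chi1 compactly supported, the second bounds mu by a multiple of the law
    of m' steps from x1. So the coefficients of the defining series are at most a multiple of P^(n +
    l) chi1 (x1), and decay of these at a rate below r^-n would enlarge the radius of
    convergence. *)
Lemma tilted_divergence : convergence_parameter v pi r ->
  exists chi0 x0, [/\ cc chi0, forall x, 0 <= chi0 x &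
    forall t : R, 1 < t -> forall N, exists2 n, (N <= n)%N &
      1 <= t ^+ n * iter n Q chi0 x0].
Proof.
move=> [s [mu [[mu' ms] [s' ms'] rad]]].
have [mns s0 _ mu'0 [m [beta [_ b0 Hm]]]] := ms.
have [_ s'0 is' _ [m' [beta' [_ b'0 Hm']]]] := ms'.
have [K [cK KT]] := sigma_compact lE cE.
have mK k : measurable (K k) by exact: borel_compact.
have [k Kk] : exists k, (0 < mu' (K k))%E.
  apply: contrapT => nk; have : mu' (\bigcup_(k in setT) K k) = 0%E.
    apply: countable_bigcup_null => // k _; apply/eqP; rewrite -measure_le0 leNgt.
    by apply/negP => h; apply: nk; exists k.
  by rewrite KT => h; rewrite h ltxx in mu'0.
(* mu' may be infinite on compact sets; a positive real lower bound is all that is used. *)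
have [kap kap0 hk] : exists2 kap : R, 0 < kap & (kap%:E <= mu' (K k))%E.
  by case: (mu' (K k)) Kk => [x| |//] h; [exists x|exists 1 => //; rewrite leey].
have [b [cb bge0 b1]] := @bump _ R _ hE lE (cK k).
pose chi1 x := (beta * kap)^-1 * b x.
have bk0 : 0 < beta * kap by rewrite mulr_gt0.
have cchi1 : cc chi1 by exact: (linear_classZ ccE).
pose chi x := (phi x)^-1 * chi1 x.
have cchi : cc chi by apply: ccMl => //; exact: exponentialV_continuous.
have chi_ge0 x : 0 <= chi x.
  by rewrite !mulr_ge0 ?invr_ge0 ?(ltW bk0)// ltW// exponential_gt0.
have mb : measurable_fun setT (EFin \o b).
  by apply/measurable_EFinP; exact: measurable_continuousR cb.1.
have mE (A : set E) : measurable A -> measurable_fun setT (EFin \o (\1_A : E -> R)).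
  by move=> mA; apply/measurable_EFinP.
have mchi1 : measurable_fun setT (EFin \o chi1).
  by apply/measurable_EFinP; exact: measurable_continuousR cchi1.1.
have chi1_ge0 x : (0 <= (EFin \o chi1) x)%E.
  by rewrite lee_fin mulr_ge0// invr_ge0 ltW.
have s_le x : ((EFin \o s) x <= walk_iter v m chi1 x)%E.
  have h1 : (beta%:E * (s x)%:E * kap%:E <= walk_iter v m b x)%E.
    apply: (@le_trans _ _ (walk_iter v m (\1_(K k)) x)).
      apply: le_trans (Hm x _ (mK k)); apply: lee_wpmul2l => //.
      by rewrite -EFinM lee_fin mulr_ge0// ltW.
    apply: (iter_walk_le cE) => //; first exact: mE.
      by move=> y; rewrite lee_fin.
    move=> y; rewrite lee_fin indicE; case: (boolP (y \in K k)) => [|_] //.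
    by rewrite inE => /b1.
  have bc := cb.1; have chi1c := cchi1.1.
  rewrite (walk_iter_tilted m x bc) -!EFinM lee_fin in h1.
  rewrite (walk_iter_tilted m x chi1c) lee_fin.
  have -> : (fun z => (phi z)^-1 * chi1 z) = fun z => (beta * kap)^-1 * ((phi z)^-1 * b z).
    by apply/funext => z; rewrite /chi1 mulrCA.
  rewrite iter_tiltedZ; last by move=> z; apply: cvgM; [exact: exponentialV_continuous|exact: bc].
  set Y := iter m Q _ x in h1 *.
  have -> : r ^- m * (phi x * ((beta * kap)^-1 * Y)) = (beta * kap)^-1 * (r ^- m * (phi x * Y)).
    ring.
  by rewrite ler_pdivlMl// mulrAC.
pose a n := (\int[mu]_x walk_iter v n s x)%E.
have mEs : measurable_fun setT (EFin \o s) by apply/measurable_EFinP.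
have Es0 y : (0 <= (EFin \o s) y)%E by rewrite lee_fin.
have [x1 sx1] : exists x, 0 < s' x.
  apply: contrapT => ns; have : (\int[pi]_x (s' x)%:E = 0)%E.
    apply: integral0_eq => x _; congr EFin; apply/eqP; rewrite eq_le s'0 andbT leNgt.
    by apply/negP => h; apply: ns; exists x.
  by move=> h; rewrite h ltxx in is'.
pose c' := beta' * s' x1; have c'0 : 0 < c' by rewrite mulr_gt0.
pose l := (m' + m)%N.
pose B n := r ^- (n + l) * (phi x1 * iter (n + l) Q chi x1) / c'.
have a_le n : (a n <= (B n)%:E)%E.
  have [mF F0] := ge0_measurable_iter_walk cE v n mEs Es0.
  have [mG G0] := ge0_measurable_iter_walk cE v m mchi1 chi1_ge0.
  have [mG' G0'] := ge0_measurable_iter_walk cE v n mG G0.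
  have mc : measurable_fun setT (fun _ : E => c') by exact: measurable_cst.
  have rho_le A : measurable A ->
      (density_measure mu mc (fun=> ltW c'0) A <= walk_iter v m' (\1_A) x1)%E.
    move=> mA; apply: le_trans (Hm' x1 A mA); rewrite -EFinM -/c' -integral_cst//.
  have h1 := measure_le_iter_walk cE rho_le mF F0.
  rewrite ge0_integral_density// ge0_integralZr// in h1; last by rewrite lee_fin ltW.
  rewrite /B EFinM lee_pdivlMr//; apply: (le_trans h1).
  have h2 : (iter m' (walk_op v) (iter n (walk_op v) (EFin \o s)) x1 <=
     walk_iter v (m' + (n + m)) chi1 x1)%E.
    rewrite /walk_iter iterD; apply: (iter_walk_le cE) => //.
      by rewrite iterD.
    by move=> y; rewrite iterD; exact: (iter_walk_le cE).
  apply: (le_trans h2); have chi1c := cchi1.1.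
  rewrite (walk_iter_tilted (m' + (n + m))%N x1 chi1c).
  by rewrite (_ : m' + (n + m) = n + l)%N// addnCA.
have a_ge0 n : (0 <= a n)%E.
  by apply: integral_ge0 => x _; have [_ ->] := ge0_measurable_iter_walk cE v n mEs Es0.
exists chi, x1; split => // t t1 N; apply: contrapT => nlarge.
have t0 : 0 < t by exact: lt_trans ltr01 t1.
have [_ [Kc cKc chiK]] := cchi.
have [M M0 chiM] := compact_upper_bound cchi.1 cKc.
have QM n : iter n Q chi x1 <= M.
  apply: iter_tilted_le_cst; first exact: cchi.1.
  move=> x; have [Kx|/chiK ->] := pselect (Kc x); last exact: ltW.
  by rewrite (le_trans (ler_norm _))// chiM.
have Q0 n : 0 <= iter n Q chi x1 by apply: iter_tilted_ge0 => //; exact: cchi.1.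
(* 1 bounds the terms from N on, by the negated claim; t^N M bounds the earlier ones, since Q does
   not increase the upper bound M of chi. *)
pose D := 1 + t ^+ N * M.
have D0 : 0 < D by rewrite ltr_wpDr// mulr_ge0 ?exprn_ge0 ?ltW.
have tQ n : t ^+ n * iter n Q chi x1 <= D.
  have [Nn|nN] := leqP N n.
    apply: (@le_trans _ _ 1); last by rewrite lerDl mulr_ge0 ?exprn_ge0 ?ltW.
    by rewrite leNgt; apply/negP => h; apply: nlarge; exists n => //; exact: ltW.
  apply: (@le_trans _ _ (t ^+ N * M)); last by rewrite lerDr.
  rewrite ler_pM ?exprn_ge0 ?(ltW t0)//.
  by rewrite ler_weXn2l ?(ltW t1)// ltnW.
(* A rate strictly between 1 and t: the series at r t2 is dominated by a geometric one of ratio t2 /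
   t < 1, although r t2 exceeds the radius r. *)
pose t2 := (1 + t) / 2; have t21 : 1 < t2 by rewrite /t2; lra.
have t20 : 0 < t2 by exact: lt_trans ltr01 t21.
pose q := t2 / t; have q0 : 0 < q by rewrite divr_gt0.
have q1 : q < 1 by rewrite ltr_pdivrMr// mul1r /t2; lra.
pose G := r ^- l * phi x1 * D / (t ^+ l * c').
have G0 : 0 < G.
  by rewrite divr_gt0 ?mulr_gt0 ?invr_gt0 ?exprn_gt0// exponential_gt0.
pose r' := r * t2.
have term n : ((r' ^+ n)%:E * a n <= (G * q ^+ n)%:E)%E.
  apply: (@le_trans _ _ ((r' ^+ n)%:E * (B n)%:E)%E).
    by apply: lee_wpmul2l => //; rewrite lee_fin exprn_ge0// mulr_ge0 ?ltW.
  rewrite -EFinM lee_fin.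
  have -> : r' ^+ n * B n = t2 ^+ n * (r ^- l * phi x1 / c' / t ^+ (n + l)) *
     (t ^+ (n + l) * iter (n + l) Q chi x1).
    rewrite /B /r' exprMn exprD; field.
    by rewrite !expf_neq0 ?gt_eqF.
  have -> : G * q ^+ n = t2 ^+ n * (r ^- l * phi x1 / c' / t ^+ (n + l)) * D.
    rewrite /G /q expr_div_n exprD; field.
    by rewrite !expf_neq0 ?gt_eqF.
  rewrite ler_pM2l//.
  by rewrite mulr_gt0 ?exprn_gt0// !divr_gt0 ?mulr_gt0 ?invr_gt0 ?exprn_gt0// exponential_gt0.
have partial k' : (\sum_(0 <= n < k') (r' ^+ n)%:E * a n <= (G / (1 - q))%:E)%E.
  apply: (@le_trans _ _ (G * (1 - q ^+ k') / (1 - q))%:E); last first.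
    rewrite lee_fin ler_pM2r ?invr_gt0 ?subr_gt0// -[leRHS]mulr1 ler_pM2l//.
    by rewrite gerBl exprn_ge0// ltW.
  elim: k' => [|k' ih]; first by rewrite big_geq// expr0 subrr mulr0 mul0r.
  rewrite big_nat_recr//=; apply: le_trans (leeD ih (term k')) _.
  rewrite -EFinD lee_fin le_eqVlt; apply/orP; left; apply/eqP.
  by rewrite exprS; field; rewrite subr_eq0 gt_eqF.
have fin : (\sum_(0 <= n <oo) (r' ^+ n)%:E * a n < +oo)%E.
  apply: (@le_lt_trans _ _ (G / (1 - q))%:E); last exact: ltry.
  apply: lime_le; last exact: nearW.
  apply: is_cvg_nneseries => n _ _; apply: mule_ge0 => //.
  by rewrite lee_fin exprn_ge0// mulr_ge0 ?ltW.
have : (r'%:E <= r%:E)%E.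
  rewrite -rad; apply: ereal_sup_ubound; exists r' => //; split => //.
  by rewrite mulr_ge0 ?ltW.
by rewrite lee_fin /r' -[leRHS]mulr1 ler_pM2l// leNgt t21.
Qed.

(** * Invariant measures with a continuous density *)

Section invariant_density.
Variable H : E -> R.
Hypotheses (Hc : continuous H) (H0 : forall x, 0 <= H x).
Hypothesis HQ : forall w, \int[v]_(z in S) (H (w * z^-1)%g * (r * phi z)) = H w.

Let h x := (phi x)^-1 * H x.

Let hc : continuous h.
Proof. by move=> x; apply: cvgM; [exact: exponentialV_continuous|exact: Hc]. Qed.

Let mh : measurable_fun setT h. Proof. exact: measurable_continuousR. Qed.

Let h0 x : 0 <= h x. Proof. by rewrite mulr_ge0// invr_ge0 ltW// exponential_gt0. Qed.

Definition invariant_measure : {measure set E -> \bar R} := density_measure pi mh h0.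

Lemma invariant_measure_finite : finite_on_compacts invariant_measure.
Proof.
move=> K cK; have mK := borel_compact hE cK.
have iK := integrable_continuous hE piK cK hc mK (@subset_refl _ K).
rewrite /invariant_measure /= /density_copy.
by have := integrable_fin_num mK iK; rewrite fin_numElt => /andP[].
Qed.

(** phi^-1 (x y^-1) = phi^-1 (x) phi (y), so the density h = phi^-1 H absorbs the weight phi (y) of
    the equation for H. *)
Let h_average x : (\int[v]_y (h (x * y^-1)%g)%:E = (r^-1 * h x)%:E)%E.
Proof.
have hxc : continuous (fun y => h (x * y^-1)%g).
  move=> y; apply: (@continuous_comp _ _ _ (fun y => (x * y^-1)%g) h); last exact: hc.
  by apply: mulg_continuous2 => ?; [exact: cvg_cst|exact: invg_continuous].
rewrite (integral_support cE hE cS hxc); congr EFin.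
have Hxc : continuous (fun z => H (x * z^-1)%g * (r * phi z)).
  move=> z; apply: cvgM; last exact: weight_continuous.
  apply: (@continuous_comp _ _ _ (fun y => (x * y^-1)%g) H); last exact: Hc.
  by apply: mulg_continuous2 => ?; [exact: cvg_cst|exact: invg_continuous].
rewrite [in RHS]/h -(HQ x) mulrA -RintegralZl//; last first.
  exact: (integrable_continuous hE walk_finite cS Hxc).
apply: eq_Rintegral => y _; rewrite /h exponentialM exponentialV; field.
by rewrite !gt_eqF ?exponential_gt0.
Qed.

(** Tonelli and the right translation x -> x y^-1 of pi move the increment from the indicator of A
    to the density, where [h_average] applies. *)
Lemma invariant_measureP A : measurable A ->
  (invariant_measure A = r%:E * \int[invariant_measure]_x trans v x A)%E.
Proof.
move=> mA; have mm := measurable_mulg cE.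
pose p := sigma_finite_measure_of (radon_sigma_finite hE lE cE piK).
have m1 : measurable_fun setT (\1_A : E -> R) by exact: measurable_indic.
have i0 (x : E) : (0 <= (\1_A x : R)%:E)%E by rewrite lee_fin.
pose F (z : E * E) : \bar R := (\1_A (z.1 * z.2)%g * h z.1)%:E.
have F0 z : (0 <= F z)%E by rewrite lee_fin mulr_ge0.
have mF : measurable_fun setT F.
  apply/measurable_EFinP; apply: measurable_funM; first exact: (measurableT_comp m1 mm).
  exact: (measurableT_comp mh measurable_fst).
pose G (z : E * E) : \bar R := (\1_A z.1 * h (z.1 * z.2^-1)%g)%:E.
have G0 z : (0 <= G z)%E by rewrite lee_fin mulr_ge0.
have minv : measurable_fun setT (fun x : E => x^-1)%g.
  apply: measurable_continuous => U oU; apply: borel_open.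
  by apply: open_comp => // y _; exact: invg_continuous.
have mdiv : measurable_fun setT (fun z : E * E => (z.1 * z.2^-1)%g).
  apply: (measurableT_comp mm (g := fun z : E * E => (z.1, (z.2^-1)%g))).
  apply: measurable_fun_pair; first exact: measurable_fst.
  exact: (measurableT_comp minv measurable_snd).
have mG : measurable_fun setT G.
  apply/measurable_EFinP; apply: measurable_funM.
    exact: (measurableT_comp m1 measurable_fst).
  exact: (measurableT_comp mh mdiv).
have mtA x : measurable ((fun y : E => (x * y)%g) @^-1` A).
  by apply: measurable_preimage => //; exact: lmulg_measurable.
have transE x : (trans v x A * (h x)%:E = \int[v]_y F (x, y))%E.
  rewrite /F /=; under eq_integral do rewrite EFinM.
  have m1x : measurable_fun setT (fun y : E => (\1_A (x * y)%g : R)%:E).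
    by apply/measurable_EFinP; exact: (measurableT_comp m1 (lmulg_measurable x)).
  rewrite (ge0_integralZr _ measurableT m1x) ?lee_fin//.
  congr (_ * _)%E; rewrite -[RHS]/(\int[v]_y (\1_((fun y : E => (x * y)%g) @^-1` A) y)%:E)%E.
  by rewrite integral_indic// setIT.
have mtr : measurable_fun setT (fun x => trans v x A).
  have mF1 : measurable_fun setT (fun z : E * E => (\1_A (z.1 * z.2)%g : R)%:E).
    by apply/measurable_EFinP; exact: (measurableT_comp m1 mm).
  have := @measurable_fun_fubini_tonelli_F _ _ E E R v _ mF1 (fun z => i0 _).
  congr measurable_fun; apply/funext => x.
  rewrite /fubini_F -[LHS]/(\int[v]_y (\1_((fun y : E => (x * y)%g) @^-1` A) y)%:E)%E.
  by rewrite integral_indic// setIT.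
rewrite ge0_integral_density//.
under eq_integral do rewrite transE.
have := @fubini_tonelli _ _ E E R p v F mF F0; rewrite -[X in X = _]/(\int[pi]_x \int[v]_y F (x, y))%E => ->.
have -> : (\int[v]_y \int[p]_x F (x, y) = \int[v]_y \int[p]_x G (x, y))%E.
  apply: eq_integral => y _; rewrite -[LHS]/(\int[pi]_x F (x, y))%E.
  rewrite -(ge0_haar_integralR piP (y^-1)%g (F := fun x => F (x, y)))//; last first.
    exact: (measurableT_comp mF (measurable_pair2 y)).
  by apply: eq_integral => x _; rewrite /F /G /= mulgVK.
rewrite -(@fubini_tonelli _ _ E E R p v G mG G0).
rewrite -[X in (_ * X)%E]/(\int[pi]_x \int[v]_y G (x, y))%E.
have GE x : (\int[v]_y G (x, y) = (r^-1)%:E * ((\1_A x)%:E * (h x)%:E))%E.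
  rewrite /G /=; under eq_integral do rewrite EFinM.
  rewrite ge0_integralZl//; last 2 first.
  - apply/measurable_EFinP; apply: (measurableT_comp mh (g := fun y => (x * y^-1)%g)).
    exact: (measurableT_comp (lmulg_measurable x) minv).
  - by move=> y _; rewrite lee_fin.
  by rewrite h_average -!EFinM; congr EFin; ring.
under eq_integral do rewrite GE.
rewrite ge0_integralZl//; last 3 first.
- by apply/measurable_EFinP; exact: measurable_funM.
- by move=> x _; rewrite -EFinM lee_fin mulr_ge0.
- by rewrite lee_fin invr_ge0 ltW.
rewrite muleA -EFinM mulfV ?gt_eqF// mul1e.
rewrite /invariant_measure /= /density_copy integral_mkcond; apply: eq_integral => x _.
by rewrite patchE indicE; case: ifPn => _; rewrite ?mul1e ?mul0e.
Qed.

End invariant_density.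

Lemma invariant_measure_gt0 (H : E -> R) (Hc : continuous H) (H0 : forall x, 0 <= H x) :
  (exists x, 0 < H x) -> (0 < invariant_measure Hc H0 setT)%E.
Proof.
move=> [x Hx]; have [b [cb b0 b1]] := @bump _ R _ hE lE (@compact_set1 E x).
have [_ [K cK bK]] := cb; have [M M0 bM] := compact_upper_bound cb.1 cK.
pose h z := (phi z)^-1 * H z.
have hc : continuous h by move=> z; apply: cvgM; [exact: exponentialV_continuous|exact: Hc].
have h0 z : 0 <= h z by rewrite mulr_ge0// invr_ge0 ltW// exponential_gt0.
have mh : measurable_fun setT (EFin \o h).
  by apply/measurable_EFinP; exact: measurable_continuousR.
have cbh : cc (fun z => h z * b z) by exact: ccMl.
have I0 : 0 < \int[pi]_z (h z * b z).
  apply: haar_cc_gt0 => //; first by move=> z; rewrite mulr_ge0.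
  exists x; rewrite mulr_gt0 ?(lt_le_trans ltr01 (b1 _ _))//.
  by rewrite mulr_gt0// invr_gt0 exponential_gt0.
have h1 : ((\int[pi]_z (h z * b z))%:E <= M%:E * invariant_measure Hc H0 setT)%E.
  rewrite -(Rintegral_cc_fin hE piK cbh).
  rewrite -[X in (_ <= _ * X)%E]/(\int[pi]_z (h z)%:E)%E.
  rewrite -ge0_integralZl ?lee_fin ?(ltW M0)//; last by move=> z _; rewrite lee_fin.
  apply: ge0_le_integral => //.
  - by move=> z _; rewrite lee_fin mulr_ge0.
  - by apply/measurable_EFinP; exact: measurable_continuousR cbh.1.
  - by apply: emeasurable_funM => //.
  - move=> z _; rewrite -EFinM lee_fin mulrC ler_wpM2r//.
    have [Kz|/bK ->] := pselect (K z); last exact: ltW.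
    by rewrite (le_trans (ler_norm _))// bM.
rewrite lt0e measure_ge0 andbT; apply/eqP => z0.
by rewrite z0 mule0 lee_fin leNgt I0 in h1.
Qed.

Lemma Rintegral_invariant_measure (H : E -> R) (Hc : continuous H) (H0 : forall x, 0 <= H x) f :
  cc f -> (forall x, 0 <= f x) ->
  \int[invariant_measure Hc H0]_x f x = \int[pi]_x ((phi x)^-1 * H x * f x).
Proof.
move=> cf f0; rewrite /Rintegral ge0_integral_density//.
- by congr fine; apply: eq_integral => x _; rewrite -EFinM mulrC.
- by apply/measurable_EFinP; exact: measurable_continuousR cf.1.
Qed.

Lemma Rintegral_proportional (mu1 mu2 : {measure set E -> \bar R}) c f : 0 < c ->
  (forall A, measurable A -> mu1 A = (c%:E * mu2 A)%E) ->
  cc f -> (forall x, 0 <= f x) -> \int[mu1]_x f x = c * \int[mu2]_x f x.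
Proof.
move=> c0 H cf f0; have mf : measurable_fun setT (EFin \o f).
  by apply/measurable_EFinP; exact: measurable_continuousR cf.1.
have -> : \int[mu1]_x f x = \int[mscale (NngNum (ltW c0)) mu2]_x f x.
  by congr fine; apply: eq_measure_integral => A mA _; exact: H.
rewrite /Rintegral ge0_integral_mscale//=; last by move=> x _; rewrite lee_fin.
have [->|] := eqVneq (\int[mu2]_x (f x)%:E)%E +oo%E.
  by rewrite mulry gtr0_sg// mul1e /= mulr0.
move=> Ioo; rewrite fineM// ge0_fin_numE ?ltey//.
by apply: integral_ge0 => x _; rewrite lee_fin.
Qed.

Lemma positive_linear_ext (l1 l2 : (E -> R) -> R) : positive_linear (@cc E R) l1 ->
  positive_linear (@cc E R) l2 ->
  (forall f, cc f -> (forall x, 0 <= f x) -> l1 f = l2 f) -> forall f, cc f -> l1 f = l2 f.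
Proof.
move=> p1 p2 H f cf; have [cp p0] := cc_norm_sub cf; have ca := cc_abs cf.
have fE : f = fun x => `|f x| - (`|f x| - f x) by apply/funext => x; ring.
by rewrite fE (plinB p1 ca cp) (plinB p2 ca cp) !H.
Qed.

Variable nu : {measure set E -> \bar R}.
Hypothesis nu_unique : forall nu' : {measure set E -> \bar R},
  r_invariant v r nu' -> finite_on_compacts nu' ->
  exists2 c : R, 0 < c & forall A, measurable A -> nu' A = (c%:E * nu A)%E.

Lemma invariant_proportional (H : E -> R) : continuous H -> (forall x, 0 <= H x) ->
  (exists x, 0 < H x) ->
  (forall w, \int[v]_(z in S) (H (w * z^-1)%g * (r * phi z)) = H w) ->
  exists2 c, 0 < c & forall f, cc f -> (forall x, 0 <= f x) ->
    \int[pi]_x ((phi x)^-1 * H x * f x) = c * \int[nu]_x f x.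
Proof.
move=> Hc H0 Hx HQ.
have inv : r_invariant v r (invariant_measure Hc H0).
  split => //; first exact: invariant_measure_gt0.
  by move=> A mA; exact: invariant_measureP.
have [c c0 cP] := nu_unique inv (@invariant_measure_finite _ Hc H0).
exists c => // f cf f0; rewrite -(Rintegral_invariant_measure Hc H0 cf f0).
exact: Rintegral_proportional.
Qed.

Let one_continuous : continuous (fun _ : E => 1 : R).
Proof. by move=> x; exact: cvg_cst. Qed.

Let one_invariant (w : E) :
  \int[v]_(z in S) ((fun _ : E => 1) (w * z^-1)%g * (r * phi z)) = 1.
Proof. by rewrite -[RHS]integral_weight; apply: eq_Rintegral => z _; rewrite mul1r. Qed.

(** H = 1 solves the equation because r phi v is a probability; hence phi^-1 pi is itself
    r-invariant. *)
Lemma haar_proportional : finite_on_compacts nu -> exists2 c, 0 < c & forall f, cc f ->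
  \int[pi]_x ((phi x)^-1 * f x) = c * \int[nu]_x f x.
Proof.
move=> nuK.
have [|c c0 H] := invariant_proportional one_continuous (fun=> ler01) _ one_invariant.
  by exists 1%g.
exists c => //; have nup := positive_linear_radon hE nuK.
have cphi f : cc f -> cc (fun x => (phi x)^-1 * f x).
  by apply: ccMl; exact: exponentialV_continuous.
apply: (@positive_linear_ext (fun f => \int[pi]_x ((phi x)^-1 * f x)) (fun f => c * \int[nu]_x f x)).
- split=> [f g a cf cg|f cf f0]; last first.
    by apply: haar_plin.2 => [|x]; [exact: cphi|rewrite mulr_ge0// invr_ge0 ltW// exponential_gt0].
  apply: etrans _ (haar_plin.1 _ _ a (cphi f cf) (cphi g cg)).
  by apply: eq_Rintegral => x _; ring.
- split=> [f g a cf cg|f cf f0]; last by rewrite mulr_ge0 ?(ltW c0)//; exact: nup.2.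
  by rewrite (nup.1 _ _ a cf cg); ring.
- move=> f cf f0; rewrite -H//; apply: eq_Rintegral => x _; ring.
Qed.

(** phi^-1 H pi and phi^-1 pi are both multiples of nu, so H acts as the constant k = c1 / c2 under
    the integral. *)
Lemma invariant_constant (H : E -> R) : continuous H -> (forall x, 0 <= H x) ->
  (forall w, \int[v]_(z in S) (H (w * z^-1)%g * (r * phi z)) = H w) ->
  exists k, forall w, H w = k.
Proof.
move=> Hc H0 HQ; have [Hx|nH] := pselect (exists x, 0 < H x); last first.
  exists 0 => w; apply/eqP; rewrite eq_le H0 andbT leNgt; apply/negP => h.
  by apply: nH; exists w.
have [c1 c10 h1] := invariant_proportional Hc H0 Hx HQ.
have [|c2 c20 h2] := invariant_proportional one_continuous (fun=> ler01) _ one_invariant.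
  by exists 1%g.
pose k := c1 / c2; exists k => w; apply/eqP; apply: contrapT => /negP Hw.
have [b [cb b0 b1]] := @bump _ R _ hE lE (@compact_set1 E w).
pose I g := \int[pi]_x ((phi x)^-1 * g x).
have cphi g : cc g -> cc (fun x => (phi x)^-1 * g x).
  by apply: ccMl; exact: exponentialV_continuous.
have IE f : cc f -> (forall x, 0 <= f x) -> I (fun x => H x * f x) = k * I f.
  move=> cf f0; have := h1 f cf f0; have := h2 f cf f0; rewrite /I.
  under eq_Rintegral do rewrite mulr1.
  under [in X in _ -> X -> _]eq_Rintegral do rewrite -mulrA.
  by move=> -> ->; rewrite /k; field; rewrite gt_eqF.
have Hkc : continuous (fun x => (H x - k) ^+ 2).
  move=> x; apply: (@continuous_comp _ _ _ (fun x => H x - k) (fun y => y ^+ 2)).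
    by apply: cvgB; [exact: Hc|exact: cvg_cst].
  exact: exprn_continuous.
(* A variance argument gives H w = k pointwise: expanding the square and using [IE] for the
   nonnegative functions b and H b yields k^2 - 2 k^2 + k^2 = 0 times I b, against positivity at
   w. *)
have D0 : 0 < I (fun x => (H x - k) ^+ 2 * b x).
  apply: haar_cc_gt0 => //.
  - by apply: cphi; exact: ccMl.
  - move=> x; apply: mulr_ge0; first by rewrite invr_ge0 ltW// exponential_gt0.
    by apply: mulr_ge0; [exact: sqr_ge0|exact: b0].
  - exists w; apply: mulr_gt0; first by rewrite invr_gt0 exponential_gt0.
    apply: mulr_gt0; last by rewrite (lt_le_trans ltr01)// b1.
    by rewrite exprn_even_gt0//= subr_eq0.
have cHb : cc (fun x => H x * b x) by exact: ccMl.
have cHHb : cc (fun x => H x * (H x * b x)) by exact: ccMl.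
have e1 := IE _ cHb (fun x => mulr_ge0 (H0 x) (b0 x)).
have e2 := IE _ cb b0.
have lin f g a : cc f -> cc g -> I (fun x => a * f x + g x) = a * I f + I g.
  move=> cf cg; apply: etrans _ (haar_plin.1 _ _ a (cphi f cf) (cphi g cg)).
  by apply: eq_Rintegral => x _; ring.
have : I (fun x => (H x - k) ^+ 2 * b x) = 0.
  have -> : (fun x => (H x - k) ^+ 2 * b x) = fun x => (- (2 * k)) * (H x * b x) +
      (k ^+ 2 * b x + H x * (H x * b x)) by apply/funext => x; ring.
  rewrite lin// ?lin//; last exact: cc_lin.
  by rewrite e1 e2; ring.
by move=> h; rewrite h ltxx in D0.
Qed.

Lemma tilted_uniform_limit : convergence_parameter v pi r ->
  exists w : nat -> R, exists I : R, [/\ 0 < I,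
    exists N, forall n, (N <= n)%N -> 0 < w n &
    forall m f K e, cc f -> compact K -> 0 < e -> \forall n \near \oo,
      forall x, K x -> `|iter (n + m) Q f x / w n - \int[pi]_x f x / I| <= e].
Proof.
move=> /tilted_divergence[chi0 [x0 [cchi0 chi0_ge0 chi0_large]]].
have [g [cg g0 g1]] := @bump _ R _ hE lE (@compact_set1 E 1%g).
have gx : exists x, 0 < g x by exists 1%g; rewrite (lt_le_trans ltr01)// g1.
exists (fun n => iter n Q g 1%g), (\int[pi]_x g x); split; first exact: haar_cc_gt0.
  exact: (normalizer_gt0 cchi0 chi0_ge0 chi0_large).
move=> m f K e; apply: (normalized_uniform_shift cchi0 chi0_ge0 chi0_large cg g0 gx).
exact: invariant_constant.
Qed.

End haar.
End tilted_walk.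

(** * Ratios of iterates *)

Lemma uniform_cvg_within_setT (T : choiceType) (R : realType) (A : set T)
    (u : nat -> T -> R) (l : T -> R) :
  (forall e, 0 < e -> \forall n \near \oo, forall x, A x -> `|l x - u n x| <= e) ->
  {uniform A, u @ within (~` set0) \oo --> l}.
Proof.
rewrite setC0 withinET => ul P /uniform_nbhs[V [eV VP]].
move: eV; rewrite -entourage_ballE => -[e /= e0 eVP].
have := ul _ (divr_gt0 e0 (ltr0Sn _ 1)); apply: filterS => n un.
apply: VP => x Ax; apply: eVP => /=; apply: le_lt_trans (un x Ax) _.
by rewrite ltr_pdivrMr// mulr_natr mulr2n ltrDl.
Qed.

Lemma cvg_within_setT (R : realType) (u : nat -> R) (l : R) :
  (forall e, 0 < e -> \forall n \near \oo, `|l - u n| <= e) ->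
  u n @[n --> within (~` set0) \oo] --> l.
Proof. by rewrite setC0 withinET => ul; apply/cvgrPdist_le. Qed.

Lemma quotient_close (R : realType) (a b e : R) : b != 0 -> 0 < e ->
  exists2 t, 0 < t & forall x y, `|x - a| <= t -> `|y - b| <= t ->
    `|a / b - x / y| <= e.
Proof.
move=> b0 e0; pose q (z : R * R) := z.1 / z.2.
have : q z @[z --> (a, b)] --> a / b.
  by apply: cvgM; [exact: cvg_fst|apply: cvgV => //; exact: cvg_snd].
move=> /cvgrPdist_le/(_ e e0)[[A B] /= [/nbhs_ballP[s /= s0 sA] /nbhs_ballP[t /= t0 tB]] AB].
have st0 : 0 < Num.min s t / 2 by rewrite divr_gt0// lt_min s0 t0.
have st : Num.min s t / 2 < Num.min s t.
  by rewrite ltr_pdivrMr// mulr_natr mulr2n ltrDl lt_min s0 t0.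
exists (Num.min s t / 2) => // x y xa yb; apply: (AB (x, y)); split=> /=.
  by apply: sA; rewrite /ball/= distrC (le_lt_trans xa)// (lt_le_trans st)// ge_min lexx.
by apply: tB; rewrite /ball/= distrC (le_lt_trans yb)// (lt_le_trans st)// ge_min lexx orbT.
Qed.

Lemma quotient_uniform_limit (T T' : Type) (R : realType) (K : set T)
    (K' : set T') (a : nat -> T -> R) (b : nat -> T' -> R) (la lb : R) : lb != 0 ->
  (forall e, 0 < e -> \forall n \near \oo, forall x, K x -> `|a n x - la| <= e) ->
  (forall e, 0 < e -> \forall n \near \oo, forall y, K' y -> `|b n y - lb| <= e) ->
  forall e, 0 < e -> \forall n \near \oo, forall x y, K x -> K' y ->
    `|la / lb - a n x / b n y| <= e.
Proof.
move=> lb0 al bl e e0; have [t t0 ht] := quotient_close la lb0 e0.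
have := al t t0; apply: filterS2 (bl t t0) => n bn an x y Kx Ky.
by apply: ht; [exact: an|exact: bn].
Qed.

Lemma quotient_weights (R : realType) (p q u w F G : R) : p != 0 -> q != 0 -> w != 0 ->
  (q * (u * F)) / (q * (p * G)) = u / p * ((F / w) / (G / w)).
Proof.
(* The inverse of 0 is 0, so both sides vanish when G = 0; the identity thus holds even for n where
   the denominator is zero. *)
move=> p0 q0 w0; have [->|G0] := eqVneq G 0.
  by rewrite !mul0r !mulr0 !invr0 !mulr0.
by field; rewrite p0 q0 w0 G0.
Qed.

Lemma density_zero_set0 (R : realType) : density_zero R set0.
Proof.
rewrite /density_zero; apply: cvg_near_cst; apply: nearW => n.
by rewrite big1 ?mul0r// => m _; rewrite indicE in_set0.
Qed.

Theorem theorem1 (R : realType) (d : measure_display) (E : borelGroupType d)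
    (E_hausdorff : hausdorff_space E)
    (E_locally_compact : locally_compact [set: E])
    (E_countable_base : @second_countable E)
    (E_unimodular : unimodular E R)
    (pi : {measure set E -> \bar R}) (pi_haar : right_haar_measure pi)
    (v : probability E R) (v_compact : compactly_supported v)
    (r : R) (r_conv : convergence_parameter v pi r)
    (hypA : forall f : E -> R, continuous_compact_support f ->
      (forall x, 0 <= f x) ->
      exists gamma : R, exists j : nat, [/\ 0 < gamma, (1 <= j)%N &
        forall A, measurable A ->
          (gamma%:E * \int[pi]_(x in A) (f x)%:E <= conv_power v j A)%E])
    (nu : {measure set E -> \bar R})
    (nu_invariant : r_invariant v r nu) (nu_finite : finite_on_compacts nu)
    (nu_unique : forall nu' : {measure set E -> \bar R},
      r_invariant v r nu' -> finite_on_compacts nu' ->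
      exists2 c : R, 0 < c &
        forall A, measurable A -> nu' A = (c%:E * nu A)%E)
    (phi : E -> R) (phi_exp : exponential phi) (phi_cont : continuous phi)
    (phi_v : (\int[v]_x (phi x)%:E = (r^-1)%:E)%E) :
  exists N : set nat,
    [/\ (forall n, N n -> (0 < n)%N), density_zero R N &
    forall f g : E -> R, continuous_compact_support f ->
      continuous_compact_support g -> \int[nu]_x g x != 0 ->
      let ratio n (xy : E * E) :=
        fine (walk_iter v n f xy.1) / fine (walk_iter v n g xy.2) in
      let limit (xy : E * E) :=
        (\int[pi]_z ((phi z)^-1 * f z) * phi xy.1) /
        (\int[pi]_z ((phi z)^-1 * g z) * phi xy.2) in
      let shift_ratio m n (y : E) :=
        fine (walk_iter v (n + m) g y) / fine (walk_iter v n g y) in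
      [/\ forall x y : E,
            ratio n (x, y) @[n --> within (~` N) \oo] --> limit (x, y),
          forall x y : E, limit (x, y) =
            (\int[nu]_z f z * phi x) / (\int[nu]_z g z * phi y),
          forall (m : nat) (y : E), (0 < m)%N ->
            shift_ratio m n y @[n --> within (~` N) \oo] --> (r ^+ m)^-1,
          forall K : set E, compact K ->
            {uniform K `*` K, ratio @ within (~` N) \oo --> limit} &
          forall (m : nat) (K : set E), (0 < m)%N -> compact K ->
            {uniform K, shift_ratio m @ within (~` N) \oo -->
              (fun _ : E => (r ^+ m)^-1)}]].
Proof.
have [r0 _ _] := nu_invariant.
exists set0; split=> //; first exact: density_zero_set0.
move=> f g fcs gcs nug ratio limit shift_ratio.
have [c c0 pi_nu] := haar_proportional E_hausdorff E_locally_compact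
  E_countable_base v_compact r0 phi_exp phi_cont phi_v pi_haar nu_unique nu_finite.
have [w [I [I0 [N0 w0] Q_cvg]]] := tilted_uniform_limit E_hausdorff
  E_locally_compact E_countable_base v_compact r0 phi_exp phi_cont phi_v
  E_unimodular pi_haar hypA nu_unique r_conv.
have fcc : cc f := (ccP f E_hausdorff).2 fcs.
have gcc : cc g := (ccP g E_hausdorff).2 gcs.
have psi_cont : continuous (fun z => (phi z)^-1 : R) by exact: exponentialV_continuous.
have f'cc := ccMl psi_cont fcc; have g'cc := ccMl psi_cont gcc.
have pig : \int[pi]_z ((phi z)^-1 * g z) != 0.
  by rewrite pi_nu// mulf_neq0// gt_eqF.
have phi0 x : phi x != 0 by rewrite gt_eqF// (exponential_gt0 phi_exp).
have walkE h n x : continuous h -> fine (walk_iter v n h x) =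
    r ^- n * (phi x * iter n (tilted v r phi) (fun z => (phi z)^-1 * h z) x).
  by move=> hc; rewrite (walk_iter_tilted E_hausdorff E_countable_base
    v_compact r0 phi_exp phi_cont).
have r0n n : r ^- n != 0 by rewrite invr_neq0// expf_neq0// gt_eqF.
have w0n : \forall n \near \oo, w n != 0.
  by exists N0 => // n /= Nn; rewrite gt_eqF// w0.
have pigI : \int[pi]_z ((phi z)^-1 * g z) / I != 0.
  by rewrite mulf_neq0// invr_neq0// gt_eqF.
(* The factor r^-n and the normalizer w n cancel. The remaining factor phi x / phi y is at most M /
   l on K, which accounts for the tolerance e (l / M). *)
have ratio_cvg K e : compact K -> 0 < e -> \forall n \near \oo,
    forall xy, (K `*` K) xy -> `|limit xy - ratio n xy| <= e.
  move=> cK e0.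
  have [M M0 phi_le_M] := compact_upper_bound phi_cont cK.
  have [l l0 l_le_phi] := compact_lower_bound phi_cont
    (fun x _ => exponential_gt0 phi_exp x) cK.
  have el : 0 < e * (l / M) by rewrite mulr_gt0// divr_gt0.
  have := quotient_uniform_limit pigI
    (fun e => Q_cvg 0%N _ K e f'cc cK) (fun e => Q_cvg 0%N _ K e g'cc cK) el.
  apply: filterS2 w0n => n wn cvgn [x y] [/= Kx Ky].
  rewrite /limit /ratio /= !walkE; [|exact: gcc.1|exact: fcc.1].
  rewrite (quotient_weights _ _ _ (phi0 y) (r0n n) wn).
  have := cvgn x y Kx Ky; rewrite /= !addn0.
  set a := iter _ _ _ x / _; set b := (_ / w n) => ab.
  have -> : \int[pi]_z ((phi z)^-1 * f z) * phi x /
      (\int[pi]_z ((phi z)^-1 * g z) * phi y) =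
      phi x / phi y * ((\int[pi]_z ((phi z)^-1 * f z) / I) /
        (\int[pi]_z ((phi z)^-1 * g z) / I)).
    by field; rewrite phi0 pig gt_eqF.
  have phi_ge0 : 0 <= phi x / phi y by rewrite divr_ge0// ltW// (exponential_gt0 phi_exp).
  rewrite -mulrBr normrM (ger0_norm phi_ge0).
  apply: le_trans (ler_wpM2l phi_ge0 ab) _.
  have phi_le : phi x / phi y <= M / l.
    have phix : phi x <= M := le_trans (ler_norm _) (phi_le_M x Kx).
    have phiy : (phi y)^-1 <= l^-1.
      by rewrite lef_pV2 ?posrE ?(exponential_gt0 phi_exp)//; exact: l_le_phi.
    by apply: ler_pM => //; rewrite ?invr_ge0 ltW// (exponential_gt0 phi_exp).
  apply: le_trans (ler_wpM2r (ltW el) phi_le) _.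
  by rewrite le_eqVlt; apply/orP; left; apply/eqP; field; rewrite !gt_eqF.
(* After division by w n, the tilted iterates of orders n + m and n have the same nonzero limit, so
   only r^-m is left; scaling by it turns the tolerance e r^m into e. *)
have shift_cvg m K e : compact K -> 0 < e -> \forall n \near \oo,
    forall y, K y -> `|(r ^+ m)^-1 - shift_ratio m n y| <= e.
  move=> cK e0; have erm : 0 < e * r ^+ m by rewrite mulr_gt0// exprn_gt0.
  have := quotient_uniform_limit pigI
    (fun e => Q_cvg m _ K e g'cc cK) (fun e => Q_cvg 0%N _ K e g'cc cK) erm.
  apply: filterS2 w0n => n wn cvgn y Ky.
  rewrite /shift_ratio !walkE; [|exact: gcc.1|exact: gcc.1].
  have -> : r ^- (n + m) = r ^- n * r ^- m by rewrite exprD invfM.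
  rewrite -(mulrA (r ^- n)) (mulrA (r ^- m)).
  rewrite (quotient_weights _ _ _ (phi0 y) (r0n n) wn) mulfK//.
  have := cvgn y y Ky Ky; rewrite /= addn0 divff//.
  set a := _ / (_ / _) => a_close.
  rewrite -[X in `|X - _|]mulr1 -mulrBr normrM gtr0_norm ?invr_gt0 ?exprn_gt0//.
  by rewrite mulrC ler_pdivrMr ?exprn_gt0.
(* The pointwise ratio limit is the uniform one on this finite set. *)
have pointwise (x y : E) : compact ([set x] `|` [set y]).
  by apply: compactU; exact: compact_set1.
split.
- move=> x y; apply: cvg_within_setT => e e0.
  by have := ratio_cvg _ e (pointwise x y) e0; apply: filterS => n; apply; split; [left|right].
- move=> x y; rewrite /limit /= !pi_nu//.
  by field; rewrite phi0 nug gt_eqF.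
- move=> m y _; apply: cvg_within_setT => e e0.
  by have := shift_cvg m _ e (@compact_set1 _ y) e0; apply: filterS => n; apply.
- by move=> K cK; apply: uniform_cvg_within_setT => e; exact: ratio_cvg.
- by move=> m K _ cK; apply: uniform_cvg_within_setT => e; exact: shift_cvg.
Qed.
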